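(* Let $G\rightrightarrows M$ be a Lie groupoid and let $x\in M$ be a fixed point such that $G$ is proper at $x$. Let $n=\dim M$. Then there exist an open set $U$ with $x\in U\subset M$ and a diffeomorphism $G_U\cong G_x\times\mathbb{R}^n$ which extends the obvious one $G_x\cong G_x\times 0$, and under which the source map corresponds to the projection $G_x\times\mathbb{R}^n\to\mathbb{R}^n$ and the units correspond to $1\times\mathbb{R}^n$. Explicitly: there are diffeomorphisms $\Phi:G_U\to G_x\times\mathbb{R}^n$ and $\varphi:U\to\mathbb{R}^n$ with $\Phi(g)=(g,0)$ for all $g\in G_x$, $\mathrm{pr}_2\circ\Phi=\varphi\circ s$, and $\Phi(1_y)=(1,\varphi(y))$ for all $y\in U$.
   Context: Manifolds are smooth, Hausdorff, second countable and without boundary. A Lie groupoid $G\rightrightarrows M$ has manifolds of objects $M$ and arrows $G$, submersions $s,t:G\to M$ (source, target), and smooth multiplication, unit ($y\mapsto 1_y$) and inverse. $G_x=s^{-1}(x)\cap t^{-1}(x)$ is the isotropy Lie group, with unit $1=1_x$. A point $x\in M$ is a fixed point if its orbit $t(s^{-1}(x))$ equals $\{x\}$. $G$ is proper at $x$ if its anchor $\rho=(t,s):G\to M\times M$ is proper at $(x,x)$, i.e. every sequence $(g_n)\subset G$ with $\rho(g_n)\to(x,x)$ has a convergent subsequence. For $U\subset M$ open, $G_U=s^{-1}(U)\cap t^{-1}(U)$, an open subgroupoid $G_U\rightrightarrows U$. *)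

(* Defs.v *)
From mathcomp Require Import all_boot all_order all_algebra.
From mathcomp Require Import all_classical all_reals all_analysis.

Set Implicit Arguments.
Unset Strict Implicit.
Unset Printing Implicit Defensive.

Import Order.TTheory GRing.Theory Num.Theory.
Import numFieldNormedType.Exports.
Local Open Scope classical_set_scope.
Local Open Scope ring_scope.

Fixpoint Ck_on (R : realType) (m n k : nat) (O : set 'rV[R]_m)
    (f : 'rV[R]_m -> 'rV[R]_n) : Prop :=
  match k with
  | 0 => forall v, O v -> {for v, continuous f}
  | k'.+1 => (forall v, O v -> differentiable f v) /\
             forall u, Ck_on k' O ('D_u f)
  end.

Definition smooth_near (R : realType) (m n : nat)
    (f : 'rV[R]_m -> 'rV[R]_n) (v : 'rV[R]_m) : Prop :=
  exists O : set 'rV[R]_m, [/\ open O, O v & forall k, Ck_on k O f].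

(** Only the values of [cmap] on [cdom] are meaningful.  The dimension belongs
    to the chart, so that the atlas of a subset can be defined before its
    dimension is known. *)
Record chart (R : realType) (T : Type) := Chart {
  cdim : nat;
  cdom : set T;
  cmap :> T -> 'rV[R]_cdim }.
Arguments Chart {R T} cdim cdom cmap.

Definition is_chart (R : realType) (T : topologicalType) (c : chart R T) :=
  [/\ open (cdom c),
      {in cdom c &, injective c},
      forall p, cdom c p -> {for p, continuous c} &
      forall O, open O -> O `<=` cdom c -> open (c @` O)].

(** [F] is the expression of [f] near [p] in the charts [c] and [c']; since [c]
    is a homeomorphism onto an open set, the germ of [F] at [c p] is that of
    [c' \o f \o c^-1]. *)
Definition local_rep (R : realType) (S T : topologicalType) (c : chart R S)
    (c' : chart R T) (f : S -> T) (p : S)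
    (F : 'rV[R]_(cdim c) -> 'rV[R]_(cdim c')) : Prop :=
  [/\ cdom c p, cdom c' (f p), {for p, continuous f}, smooth_near F (c p) &
      \forall q \near p, c' (f q) = F (c q)].
Arguments local_rep {R S T} c c' f p F.

Definition compatible (R : realType) (T : topologicalType)
    (c c' : chart R T) : Prop :=
  forall p, cdom c p -> cdom c' p ->
    (exists F, local_rep c c' id p F) /\ (exists F, local_rep c' c id p F).

Record smooth_space (R : realType) := SmoothSpace {
  carrier :> topologicalType;
  atlas : set (chart R carrier) }.
Arguments SmoothSpace {R} carrier atlas.
Arguments atlas {R} s _.

Definition smooth_chart (R : realType) (X : smooth_space R) (c : chart R X) :=
  is_chart c /\ forall c', atlas X c' -> compatible c c'.

Record manifold (R : realType) := Manifold {
  mspace :> smooth_space R;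
  mdim : nat;
  mhausdorff : hausdorff_space mspace;
  msecond_countable : @second_countable mspace;
  matlas_dim : forall c, atlas mspace c -> cdim c = mdim;
  matlas_chart : forall c, atlas mspace c -> smooth_chart c;
  matlas_cover : forall p : mspace, exists2 c, atlas mspace c & cdom c p }.

Definition smooth_at (R : realType) (X Y : smooth_space R) (f : X -> Y)
    (p : X) : Prop :=
  exists (c : chart R X) (c' : chart R Y) F,
    [/\ atlas X c, atlas Y c' & local_rep c c' f p F].

Definition smooth (R : realType) (X Y : smooth_space R) (f : X -> Y) : Prop :=
  forall p, smooth_at f p.

Definition submersion (R : realType) (X Y : smooth_space R) (f : X -> Y) :=
  forall p, exists (c : chart R X) (c' : chart R Y) F,
    [/\ atlas X c, atlas Y c', local_rep c c' f p F &
        forall w, exists v, 'd F (c p) v = w].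

(** [f] restricts to a diffeomorphism from the open set [A] onto [Y]; the
    values of [f] outside [A] are irrelevant. *)
Definition diffeo_from (R : realType) (X Y : smooth_space R) (A : set X)
    (f : X -> Y) : Prop :=
  (forall p, A p -> smooth_at f p) /\
  exists g : Y -> X,
    [/\ smooth g, forall q, A (g q), forall p, A p -> g (f p) = p &
        forall q, f (g q) = q].

Definition euclidean (R : realType) (n : nat) : smooth_space R :=
  SmoothSpace 'rV[R]_n [set Chart n [set: 'rV[R]_n] id].

Definition prod_space (R : realType) (X Y : smooth_space R) : smooth_space R :=
  SmoothSpace (X * Y)%type
    [set c | exists (a : chart R X) (b : chart R Y),
       [/\ atlas X a, atlas Y b &
           c = Chart (cdim a + cdim b) (cdom a `*` cdom b)
                     (fun p => row_mx (a p.1) (b p.2))]].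

(** The subset [A] of [X] with the subspace topology and the charts induced by
    the slice charts of [X], i.e. those [m] such that [m (D `&` A)] is the slice
    [m D `&` (R^k x 0)].  When [A] is an embedded submanifold, these form its
    maximal atlas; the dimension [k] is allowed to vary. *)
Definition sub_space (R : realType) (X : smooth_space R) (A : set X) :
    smooth_space R :=
  SmoothSpace (set_type A)
    [set c | exists k l (D : set X) (m : X -> 'rV[R]_(k + l)),
       [/\ smooth_chart (Chart (k + l) D m),
           m @` (D `&` A) = (m @` D) `&` [set v | rsubmx v = 0] &
           c = Chart k (set_val @^-1` D) (fun a => lsubmx (m (set_val a)))]].

Definition composable (R : realType) (M G : smooth_space R) (s t : G -> M) :
    set (prod_space G G) := [set gh | s gh.1 = t gh.2].

(** Arrows go from [src] to [tgt]; [gmul g h] is meaningful only when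
    [src g = tgt h]. *)
Record lie_groupoid (R : realType) := LieGroupoid {
  obj : manifold R;
  arr : manifold R;
  src : arr -> obj;
  tgt : arr -> obj;
  gmul : arr -> arr -> arr;
  gunit : obj -> arr;
  ginv : arr -> arr;
  src_submersion : submersion src;
  tgt_submersion : submersion tgt;
  gmul_smooth : @smooth R (sub_space (composable src tgt)) arr
    (fun gh => gmul (set_val gh).1 (set_val gh).2);
  gunit_smooth : smooth gunit;
  ginv_smooth : smooth ginv;
  src_gmul : forall g h, src g = tgt h -> src (gmul g h) = src h;
  tgt_gmul : forall g h, src g = tgt h -> tgt (gmul g h) = tgt g;
  gmulA : forall g h k, src g = tgt h -> src h = tgt k ->
    gmul g (gmul h k) = gmul (gmul g h) k;
  src_gunit : forall y, src (gunit y) = y;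
  tgt_gunit : forall y, tgt (gunit y) = y;
  gmul1g : forall g, gmul (gunit (tgt g)) g = g;
  gmulg1 : forall g, gmul g (gunit (src g)) = g;
  src_ginv : forall g, src (ginv g) = tgt g;
  tgt_ginv : forall g, tgt (ginv g) = src g;
  gmulVg : forall g, gmul (ginv g) g = gunit (src g);
  gmulgV : forall g, gmul g (ginv g) = gunit (tgt g) }.

Definition restriction (R : realType) (G : lie_groupoid R) (U : set (obj G)) :
    set (arr G) := src (l:=G) @^-1` U `&` tgt (l:=G) @^-1` U.

Definition isotropy_set (R : realType) (G : lie_groupoid R) (x : obj G) :
    set (arr G) := src (l:=G) @^-1` [set x] `&` tgt (l:=G) @^-1` [set x].

Definition isotropy (R : realType) (G : lie_groupoid R) (x : obj G) :
    smooth_space R := sub_space (isotropy_set x).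

Lemma gunit_isotropy (R : realType) (G : lie_groupoid R) (x : obj G) :
  gunit x \in isotropy_set x.
Proof. by rewrite inE; split; rewrite /= ?src_gunit ?tgt_gunit. Qed.

Definition isotropy1 (R : realType) (G : lie_groupoid R) (x : obj G) :
  isotropy x := SigSub (gunit_isotropy x).

Definition fixed_point (R : realType) (G : lie_groupoid R) (x : obj G) :=
  tgt (l:=G) @` (src (l:=G) @^-1` [set x]) = [set x].

Definition anchor (R : realType) (G : lie_groupoid R) (g : arr G) :
  obj G * obj G := (tgt g, src g).

Definition proper_at (R : realType) (G : lie_groupoid R) (x : obj G) : Prop :=
  forall g : nat -> arr G, (anchor (g n) @[n --> \oo] --> (x, x)) ->
    exists (i : nat -> nat) (h : arr G),
      {homo i : a b / (a < b)%N} /\ (g (i n) @[n --> \oo] --> h).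

(* Main.v *)
(** Near a fixed point [x] at which the groupoid is proper, the fibre [s^-1(x) = G_x] is compact.
  Charts in which the source map is a projection give local smooth retractions onto this fibre;
  finitely many of them are glued with cutoffs into a retraction [pi] of a neighbourhood of [G_x],
  the last one being centred at the unit, so that [pi] maps nearby units to [1_x].  By the inverse
  function theorem and properness, [(pi, s)] is then a diffeomorphism from the arrows between
  points near [x] onto its image in [G_x * R^n].  Along the arrow over [(g, v)] the function
  [Q_g v = |t(g, v)|^2] is nondecreasing on small rays, because it is close to a nondegenerate
  quadratic form; hence the sets [{v | sup_g Q_g v < r}] are star-shaped, and they are invariant
  because an arrow carries the supremum at its source to the supremum at its target.  A smooth
  exhaustion [H] of such a set [U], nondecreasing along rays, yields the diffeomorphism
  [v |-> (1 + H v) v] from [U] onto [R^n], which turns [(pi, s)] into the required [Phi]. *)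
Require Import Defs.
From HB Require Import structures.
From mathcomp Require Import all_boot all_order all_algebra.
From mathcomp Require Import finmap.
From mathcomp Require Import all_classical all_reals all_analysis.
From mathcomp Require Import ring lra.
Set Implicit Arguments.
Unset Strict Implicit.
Unset Printing Implicit Defensive.
Import Order.TTheory GRing.Theory Num.Theory.
Import numFieldNormedType.Exports.
Local Open Scope classical_set_scope.
Local Open Scope ring_scope.

(** A ball around $x$ will not do for $U$: for $(\pi,s)$ to map $G_U$ onto $G_x\times U$, the arrow
    over every $(g,y)$ with $y\in U$ must also end in $U$, and balls are not invariant. Bounding
    $|t|^2$ over all arrows out of a point forces invariance, but the supremum need not be smooth,
    and its sublevel sets are only known to be open and star-shaped; the diffeomorphism with
    $\mathbb{R}^n$ has to be built from finitely many $Q_g$ at a time. Monotonicity along rays comes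
    from the fixed point condition: $t$ is constant on $G_x$ and a submersion, so its derivative
    transverse to $G_x$ is invertible and $|t|^2$ has a nondegenerate transverse Hessian. $\Phi$
    only has to respect sources, units and $G_x$, so its first component can be any retraction onto
    $G_x$ that maps units to $1_x$. The encoding shapes the text as well: charts, their inverses and
    $\pi$ are total functions, meaningful only on some open set, so continuity and smoothness are
    stated pointwise and the domains are carried along. *)

Section Differentials.
Context {R : realType}.
Implicit Types V W : normedModType R.

(** Trades the little-o of the definition for an epsilon estimate, so that later remainders can be
    bounded by plain inequalities. *)
Lemma differentiable_intro V W (f : V -> W) (L : {linear V -> W}) v :
  continuous L ->
  (forall e, 0 < e -> \forall h \near (0 : V),
     `|f (h + v) - f v - L h| <= e * `|h|) ->
  differentiable f v /\ 'd f v = L :> (V -> W).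
Proof.
move=> Lc fL.
have E : f \o shift v = cst (f v) + L +o_ (0 : V) id.
  apply/eqaddoP => e e0; have := fL e e0; apply: filterS => h.
  by rewrite /= !fctE /cst/= opprD addrA.
have dE := diff_unique Lc E.
split => //; apply/diff_locallyP; split; first by rewrite dE.
by rewrite dE.
Qed.

Lemma diff_near V W (f : V -> W) v : differentiable f v ->
  forall e, 0 < e -> \forall h \near (0 : V),
     `|f (h + v) - f v - 'd f v h| <= e * `|h|.
Proof.
move=> /diff_locallyP[_ /eqaddoP E] e e0; have := E e e0.
by apply: filterS => h; rewrite /= !fctE /cst/= opprD addrA.
Qed.

Lemma near_eq_diff V W (f g : V -> W) v : (\forall w \near v, f w = g w) ->
  differentiable f v -> differentiable g v /\ 'd g v = 'd f v :> (V -> W).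
Proof.
move=> fg df; apply: differentiable_intro; first exact: diff_continuous.
move=> e e0; have gv : f v = g v by exact: nbhs_singleton fg.
have fg0 : \forall h \near (0 : V), f (h + v) = g (h + v).
  rewrite (near_shift v 0); apply: filterS fg => z; rewrite /= sub0r addrNK.
  by [].
have := diff_near df e0; apply: filter_app; near=> h => H.
rewrite -gv -[g _](_ : f (h + v) = _) //.
by near: h.
Unshelve. all: by end_near. Qed.

Lemma rV_linear_continuous m W (f : {linear 'rV[R]_m -> W}) : continuous f.
Proof.
have E : (f : _ -> _) = fun w : 'rV[R]_m => \sum_(j < m) w 0 j *: f (delta_mx 0 j).
  apply/funext => w; rewrite {1}(row_sum_delta w) linear_sum; apply: eq_bigr => j _.
  by rewrite linearZ.
rewrite E; apply: continuous_big => [|j _ w]; first exact: add_continuous.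
exact: (continuousZr_tmp (@coord_continuous R 1 m 0 j w)).
Qed.

Lemma derive_rV m W (f : 'rV[R]_m -> W) v u : differentiable f v ->
  'D_u f v = \sum_(j < m) u 0 j *: 'D_(delta_mx 0 j) f v.
Proof.
move=> df; rewrite deriveE // {1}(row_sum_delta u) linear_sum; apply: eq_bigr => j _.
by rewrite linearZ deriveE.
Qed.

End Differentials.

Lemma near_eq_for_continuous {T U : topologicalType} (f g : T -> U) v :
  (\forall w \near v, f w = g w) -> {for v, continuous f} -> {for v, continuous g}.
Proof.
move=> fg fc; rewrite /prop_for /continuous_at -(nbhs_singleton fg).
by apply: cvg_trans fc; apply: near_eq_cvg; apply: filterS fg => w ->.
Qed.

(** * Functions of class $C^k$ on an open set *)

Section ContinuouslyDifferentiable.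
Context {R : realType}.
Implicit Types (m n k : nat) (V W : normedModType R).

(** The recursion of [Ck_on], but with values in any normed space: scalar factors such as cutoffs
    and determinants are needed too. *)
Fixpoint Ck {m W} k (O : set 'rV[R]_m) (f : 'rV[R]_m -> W) : Prop :=
  match k with
  | 0 => forall v, O v -> {for v, continuous f}
  | k'.+1 => (forall v, O v -> differentiable f v) /\
             forall u, Ck k' O ('D_u f)
  end.

Lemma Ck_onE m n k O (f : 'rV[R]_m -> 'rV[R]_n) : Ck_on k O f <-> Ck k O f.
Proof.
elim: k f => [f|k IH f]; first by split.
split=> -[df Df]; (split=> // u); [exact: (proj1 (IH _) (Df u))|exact: (proj2 (IH _) (Df u))].
Qed.

Lemma Ck_cont m W k O (f : 'rV[R]_m -> W) : Ck k O f ->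
  forall v, O v -> {for v, continuous f}.
Proof. by case: k => [//|k] [df _] v Ov; apply/differentiable_continuous/df. Qed.

Lemma CkS m W k O (f : 'rV[R]_m -> W) : Ck k.+1 O f -> Ck k O f.
Proof.
elim: k f => [|k IH] f; first exact: (@Ck_cont m W 1).
by move=> [df Df]; split => // u; apply/IH/Df.
Qed.

Lemma Ck_sub m W k O O' (f : 'rV[R]_m -> W) : O' `<=` O -> Ck k O f -> Ck k O' f.
Proof.
move=> OO'; elim: k f => [|k IH] f /=; first by move=> fc v /OO'/fc.
by move=> [df Df]; split=> [v /OO'/df//|u]; apply/IH/Df.
Qed.

Lemma Ck_ext m W k O (f g : 'rV[R]_m -> W) : open O ->
  (forall v, O v -> f v = g v) -> Ck k O f -> Ck k O g.
Proof.
move=> oO; elim: k f g => [|k IH] f g fg /=.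
  move=> fc v Ov; apply: near_eq_for_continuous (fc v Ov).
  by apply: filterS (open_nbhs_nbhs (conj oO Ov)) => w /fg.
move=> [df Df]; have nfg v : O v -> \forall w \near v, f w = g w.
  by move=> Ov; apply: filterS (open_nbhs_nbhs (conj oO Ov)) => w /fg.
split=> [v Ov|u]; first by have [] := near_eq_diff (nfg v Ov) (df v Ov).
by apply: IH (Df u) => v Ov; apply: near_eq_derive; exact: nfg.
Qed.

Lemma Ck_cst m W k O (c : W) : Ck k O (fun _ : 'rV[R]_m => c).
Proof.
elim: k c => [|k IH] c /=; first by move=> v _; exact: (@cst_continuous _ _ c v).
split=> [v _|u]; first exact: differentiable_cst.
rewrite (_ : 'D_u _ = fun _ => 0); first exact: IH.
by apply/funext => v; exact: derive_cst.
Qed.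

Lemma Ck_linl m V W k O (L : {linear V -> W}) (f : 'rV[R]_m -> V) : open O ->
  continuous L -> Ck k O f -> Ck k O (L \o f).
Proof.
move=> oO Lc; elim: k f => [|k IH] f /=.
  by move=> fc v Ov; apply: continuous_comp; [exact: fc|exact: Lc].
have Ld w : differentiable L w by exact: linear_differentiable.
move=> [df Df]; split=> [v Ov|u].
  by apply: differentiable_comp; [exact: df|exact: Ld].
apply: Ck_ext oO _ (IH _ (Df u)) => v Ov /=.
have Lf : differentiable (L \o f) v.
  by apply: differentiable_comp; [exact: df|exact: Ld].
rewrite (deriveE _ (df v Ov)) (deriveE _ Lf) (diff_comp (df v Ov) (Ld _)) /=.
by rewrite diff_lin.
Qed.

Lemma CkD m W k O (f g : 'rV[R]_m -> W) : open O ->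
  Ck k O f -> Ck k O g -> Ck k O (f + g).
Proof.
move=> oO; elim: k f g => [|k IH] f g /=.
  by move=> fc gc v Ov; exact: (continuousD (fc v Ov) (gc v Ov)).
move=> [df Df] [dg Dg]; split=> [v Ov|u].
  by apply: differentiableD; [exact: df|exact: dg].
apply: Ck_ext oO _ (IH _ _ (Df u) (Dg u)) => v Ov /=.
by rewrite deriveD //; apply: diff_derivable; [exact: df|exact: dg].
Qed.

Lemma Ck_sum m W k O (I : Type) (r : seq I) (F : I -> 'rV[R]_m -> W) : open O ->
  (forall i, Ck k O (F i)) -> Ck k O (fun v => \sum_(i <- r) F i v).
Proof.
move=> oO HF; elim: r => [|i r IH].
  by rewrite (_ : (fun _ => _) = fun=> 0);
    [exact: Ck_cst|apply/funext => v; rewrite big_nil].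
rewrite (_ : (fun _ => _) = F i + fun v => \sum_(j <- r) F j v).
  exact: CkD.
by apply/funext => v; rewrite big_cons.
Qed.

Lemma diffZf V W (a : V -> R) (f : V -> W) v :
  differentiable a v -> differentiable f v ->
  differentiable (fun w => a w *: f w) v /\
  forall u, 'D_u (fun w => a w *: f w) v = 'D_u a v *: f v + a v *: 'D_u f v.
Proof.
move=> da df.
(* The product rule is the chain rule for scaling, which is bilinear: its second-order remainder is
   [h1 *: h2], so the radius [e] serves for the tolerance [e]. *)
have scD : differentiable (fun p : R * W => p.1 *: p.2) (a v, f v) /\
    forall q, 'd (fun p : R * W => p.1 *: p.2) (a v, f v) q
       = a v *: q.2 + q.1 *: f v.
  pose L0 (q : R * W) := a v *: q.2 + q.1 *: f v.
  have L0l : linear L0.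
    move=> c [x1 x2] [y1 y2]; rewrite /L0 /= !scalerDr !scalerDl !scalerA.
    by rewrite mulrC addrACA.
  pose M := GRing.isLinear.Build _ _ _ _ L0 L0l.
  pose L : {linear (R * W)%type -> W} := HB.pack L0 M.
  have Lc : continuous L.
    move=> q.
    have c1 : {for q, continuous (fun q : (R * W)%type => a v *: q.2)}.
      by apply: (continuousZl_tmp (f := snd)); exact: cvg_snd.
    have c2 : {for q, continuous (fun q : (R * W)%type => q.1 *: f v)}.
      by apply: (continuousZr_tmp (s := fst)); exact: cvg_fst.
    exact: (continuousD c1 c2).
  have [|dm dE] := @differentiable_intro _ _ _ (fun p : (R * W)%type => p.1 *: p.2) L (a v, f v) Lc;
    last by split=> // q; rewrite dE.
  move=> e e0; apply/nbhs_ballP; exists e => //= -[h1 h2] /=.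
  rewrite -ball_normE /= sub0r normrN => he.
  rewrite /L0 /= !scalerDl !scalerDr.
  rewrite [X in X - _ - _](_ : _ = h1 *: h2 + (a v *: h2 + h1 *: f v) + a v *: f v).
    rewrite addrK addrK normrZ.
    have h1e : `|h1| <= `|(h1, h2)| by rewrite prod_normE le_max lexx.
    have h2e : `|h2| <= `|(h1, h2)| by rewrite prod_normE le_max lexx orbT.
    by rewrite ler_pM // (le_trans h1e (ltW he)).
  by rewrite [a v *: h2 + _]addrC !addrA.
have dp : differentiable (fun w => (a w, f w)) v by exact: differentiable_pair.
have E : (fun w => a w *: f w) = (fun p : R * W => p.1 *: p.2) \o (fun w => (a w, f w)) by [].
have dc : differentiable (fun w => a w *: f w) v.
  by rewrite E; apply: differentiable_comp => //; case: scD.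
split => // u; rewrite deriveE // E diff_comp //=; last by case: scD.
rewrite (proj2 scD) diff_pair //= addrC; congr (_ *: _ + _ *: _).
  by rewrite deriveE.
by rewrite deriveE.
Qed.

Lemma CkZ m W k O (a : 'rV[R]_m -> R) (f : 'rV[R]_m -> W) : open O ->
  Ck k O a -> Ck k O f -> Ck k O (fun v => a v *: f v).
Proof.
move=> oO; elim: k a f => [|k IH] a f.
  by move=> ac fc v Ov; exact: (continuousZ (ac v Ov) (fc v Ov)).
move=> Ca Cf; move: (CkS Ca) (CkS Cf) => Ca' Cf'.
case: Ca => [da Da]; case: Cf => [df Df]; split=> [v Ov|u].
  by have [] := diffZf (da v Ov) (df v Ov).
apply: Ck_ext oO _ (CkD oO (IH _ _ (Da u) Cf') (IH _ _ Ca' (Df u))) => v Ov.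
by have [_ ->] := diffZf (da v Ov) (df v Ov).
Qed.

Lemma CkM m k O (a b : 'rV[R]_m -> R) : open O ->
  Ck k O a -> Ck k O b -> Ck k O (fun v => a v * b v).
Proof. exact: (@CkZ m R k O a b). Qed.

Lemma Ck_coord m n k O (f : 'rV[R]_m -> 'rV[R]_n) : open O ->
  Ck k O f <-> forall j, Ck k O (fun v => f v 0 j : R).
Proof.
move=> oO; split=> [Cf j|Cf].
  pose L0 (w : 'rV[R]_n) : R := w 0 j.
  have L0l : linear L0 by move=> c x y; rewrite /L0 !mxE.
  pose M := GRing.isLinear.Build _ _ _ _ L0 L0l.
  pose L : {linear 'rV[R]_n -> R} := HB.pack L0 M.
  exact: (Ck_linl (L := L) oO (@rV_linear_continuous _ _ _ L) Cf).
rewrite (_ : f = fun v => \sum_j f v 0 j *: delta_mx 0 j).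
  by apply: Ck_sum => // j; apply: CkZ => //; exact: Ck_cst.
by apply/funext => v; rewrite [LHS]row_sum_delta.
Qed.

Lemma derive_comp_rV m n W (f : 'rV[R]_m -> 'rV[R]_n) (g : 'rV[R]_n -> W) v u :
  differentiable f v -> differentiable g (f v) ->
  'D_u (g \o f) v = \sum_(j < n) ('D_u f v) 0 j *: 'D_(delta_mx 0 j) g (f v).
Proof.
move=> df dg; rewrite (deriveE _ (differentiable_comp df dg)) (diff_comp df dg) /=.
by rewrite -(deriveE _ df) -(deriveE _ dg) derive_rV.
Qed.

(** By the chain rule a derivative of [g \o f] is a sum of coordinates of a derivative of [f] times
    partial derivatives of [g] composed with [f]; the induction on [k] applies to the latter. *)
Lemma Ck_comp m n W k O O' (f : 'rV[R]_m -> 'rV[R]_n) (g : 'rV[R]_n -> W) :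
  open O -> (forall v, O v -> O' (f v)) ->
  Ck k O f -> Ck k O' g -> Ck k O (g \o f).
Proof.
move=> oO fO; elim: k g => [|k IH] g.
  by move=> fc gc v Ov; apply: continuous_comp; [exact: fc|apply: gc; exact: fO].
move=> Cf Cg; have Cf' := CkS Cf; case: Cf => df Df; case: Cg => dg Dg.
split=> [v Ov|u].
  by apply: differentiable_comp; [exact: df|apply: dg; exact: fO].
apply: (@Ck_ext _ _ _ _ (fun v => \sum_j ('D_u f v) 0 j *: ('D_(delta_mx 0 j) g \o f) v)) => //.
  by move=> v Ov; rewrite derive_comp_rV //; [exact: df|apply: dg; exact: fO].
apply: Ck_sum => // j; apply: (CkZ oO _ (IH _ Cf' (Dg _))).
by have /(Ck_coord _ _ oO) := Df u; exact.
Qed.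

(** The derivative of [1 / a] contains [1 / a] again, only to one order less: the induction
    bootstraps. *)
Lemma CkV m k O (a : 'rV[R]_m -> R) : open O -> (forall v, O v -> a v != 0) ->
  Ck k O a -> Ck k O (fun v => (a v)^-1).
Proof.
move=> oO a0; elim: k => [|k IH].
  by move=> ac v Ov; exact: (continuousV (a0 v Ov) (ac v Ov)).
move=> Ca; have Cv := IH (CkS Ca); case: Ca => da Da; split=> [v Ov|u].
  by apply: differentiableV; [exact: da|exact: a0].
apply: (@Ck_ext _ _ _ _ (fun v => (- (a v)^-1 * (a v)^-1) *: 'D_u a v)) => //.
  move=> v Ov; rewrite deriveV; [|exact: a0|exact/diff_derivable/da].
  by rewrite mulNr -invfM -expr2.
have CN : Ck k O (fun v => - (a v)^-1 : R).
  have C1 : Ck k O (fun _ : 'rV[R]_m => -1 : R) by exact: Ck_cst.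
  by have := CkM oO C1 Cv; apply: Ck_ext => // v _; rewrite mulN1r.
exact: (CkZ oO (CkM oO CN Cv) (Da u)).
Qed.

End ContinuouslyDifferentiable.

(** * Smoothness at a point *)

Section SmoothGerms.
Context {R : realType}.
Implicit Types (m n k : nat) (V W : normedModType R).

(** One neighbourhood serves for all orders [k], as in [smooth_near]; this makes smoothness an open
    condition. *)
Definition cinf {m W} (f : 'rV[R]_m -> W) v :=
  exists O : set 'rV[R]_m, [/\ open O, O v & forall k, Ck k O f].

Lemma smooth_nearE m n (f : 'rV[R]_m -> 'rV[R]_n) v : smooth_near f v <-> cinf f v.
Proof.
by split => -[ O [oO Ov Cf]]; exists O; split => // k; apply/Ck_onE.
Qed.

Lemma cinf_near m W (f : 'rV[R]_m -> W) v : cinf f v -> \forall w \near v, cinf f w.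
Proof.
by move=> [ O [oO Ov Cf]]; apply: filterS (open_nbhs_nbhs (conj oO Ov)) => w Ow; exists O.
Qed.

Lemma cinf_cont m W (f : 'rV[R]_m -> W) v : cinf f v -> {for v, continuous f}.
Proof. by move=> [ O [oO Ov Cf]]; exact: (Cf 0). Qed.

Lemma cinf_diff m W (f : 'rV[R]_m -> W) v : cinf f v -> differentiable f v.
Proof. by move=> [ O [oO Ov Cf]]; apply: (proj1 (Cf 1%N)). Qed.

Lemma cinf_derive m W (f : 'rV[R]_m -> W) u v : cinf f v -> cinf ('D_u f) v.
Proof. by move=> [ O [oO Ov Cf]]; exists O; split => // k; apply: (proj2 (Cf k.+1)). Qed.

Lemma cinf_ext m W (f g : 'rV[R]_m -> W) v : (\forall w \near v, f w = g w) ->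
  cinf f v -> cinf g v.
Proof.
move=> nfg [ O [oO Ov Cf]].
have [ O' [oO' O'v] fg] : exists2 O', open_nbhs v O' & O' `<=` (fun w => f w = g w).
  exists (interior (fun w => f w = g w)); last exact: interior_subset.
  by split; [exact: open_interior|exact: nfg].
exists (O `&` O'); split=> [| |k]; [exact: openI|by []|].
apply: (@Ck_ext _ _ _ _ _ f) => [|w [_ /fg]//|]; first exact: openI.
by apply: Ck_sub (Cf k) => w [].
Qed.

Lemma cinf_cst m W (c : W) (v : 'rV[R]_m) : cinf (fun=> c) v.
Proof. by exists setT; split=> [||k]; [exact: openT|by []|exact: Ck_cst]. Qed.

Lemma cinf2 m V1 V2 W (f : 'rV[R]_m -> V1) (g : 'rV[R]_m -> V2) (h : 'rV[R]_m -> W) v :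
  (forall O k, open O -> Ck k O f -> Ck k O g -> Ck k O h) ->
  cinf f v -> cinf g v -> cinf h v.
Proof.
move=> H [ O [oO Ov Cf]] [ O' [oO' O'v Cg]].
exists (O `&` O'); split=> [| |k]; [exact: openI|by []|].
apply: H; first exact: openI.
  by apply: Ck_sub (Cf k) => w [].
by apply: Ck_sub (Cg k) => w [].
Qed.

Lemma cinfD m W (f g : 'rV[R]_m -> W) v :
  cinf f v -> cinf g v -> cinf (fun w => f w + g w) v.
Proof. by apply: cinf2 => O k oO; exact: CkD. Qed.

Lemma cinfZ m W (a : 'rV[R]_m -> R) (f : 'rV[R]_m -> W) v :
  cinf a v -> cinf f v -> cinf (fun w => a w *: f w) v.
Proof. by apply: cinf2 => O k oO; exact: CkZ. Qed.

Lemma cinfM m (a b : 'rV[R]_m -> R) v :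
  cinf a v -> cinf b v -> cinf (fun w => a w * b w) v.
Proof. by apply: cinf2 => O k oO; exact: CkM. Qed.

Lemma cinfN m W (f : 'rV[R]_m -> W) v : cinf f v -> cinf (fun w => - f w) v.
Proof.
move=> Cf; have C1 := cinf_cst (-1 : R) v.
by apply: cinf_ext (cinfZ C1 Cf); near=> w; rewrite scaleN1r.
Unshelve. all: by end_near. Qed.

Lemma cinfB m W (f g : 'rV[R]_m -> W) v :
  cinf f v -> cinf g v -> cinf (fun w => f w - g w) v.
Proof. by move=> Cf /cinfN; exact: cinfD. Qed.

Lemma cinf_sum m W (I : Type) (r : seq I) (F : I -> 'rV[R]_m -> W) v :
  (forall i, cinf (F i) v) -> cinf (fun w => \sum_(i <- r) F i w) v.
Proof.
move=> HF; elim: r => [|i r IH].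
  by rewrite (_ : (fun _ => _) = fun=> 0);
    [exact: cinf_cst|apply/funext => w; rewrite big_nil].
rewrite (_ : (fun _ => _) = fun w => F i w + \sum_(j <- r) F j w).
  exact: cinfD.
by apply/funext => w; rewrite big_cons.
Qed.

Lemma cinfV m (a : 'rV[R]_m -> R) v : a v != 0 -> cinf a v -> cinf (fun w => (a w)^-1) v.
Proof.
move=> a0 Ca; have [ O [oO Ov Cf]] := Ca.
pose O' := [set w | O w /\ a w != 0].
have oO' : open O'.
  rewrite openE => w [Ow aw]; apply: filterI; first exact: open_nbhs_nbhs.
  have ac := Ck_cont (Cf 0) Ow.
  have N : nbhs (a w) [set x : R | x != 0].
    by apply: open_nbhs_nbhs; split; [exact: open_neq|].
  exact: (ac _ N).
exists O'; split => // k; apply: CkV => //; first by move=> w [].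
by apply: Ck_sub (Cf k) => w [].
Qed.

(** Continuity is asked only at points of [O], which suits charts and other maps that are meaningful
    on an open set only. *)
Lemma open_setI_preimage {T U : topologicalType} (f : T -> U) O O' :
  open O -> open O' -> (forall v, O v -> {for v, continuous f}) ->
  open (O `&` f @^-1` O').
Proof.
move=> oO oO' fc; rewrite openE => w [Ow O'w]; apply: filterI.
  exact: open_nbhs_nbhs.
exact: (fc w Ow _ (open_nbhs_nbhs (conj oO' O'w))).
Qed.

Lemma cinf_comp m n W (f : 'rV[R]_m -> 'rV[R]_n) (g : 'rV[R]_n -> W) v :
  cinf f v -> cinf g (f v) -> cinf (g \o f) v.
Proof.
move=> [ O [oO Ov Cf]] [ O' [oO' O'v Cg]].
have oI := open_setI_preimage oO oO' (Ck_cont (Cf 0)).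
exists (O `&` f @^-1` O'); split=> // k.
apply: (Ck_comp (O' := O')) => //; first by move=> w [].
by apply: Ck_sub (Cf k) => w [].
Qed.

Lemma cinf_id m (v : 'rV[R]_m) : cinf id v.
Proof.
exists setT; split=> [||[|k]]; [exact: openT|by []|by move=> w _; exact: cvg_id|].
split=> [w _|u]; first exact: ex_diff.
rewrite (_ : 'D_u id = fun=> u); first exact: Ck_cst.
by apply/funext => w; exact: derive_id.
Qed.

Lemma cinf_lin m W (L : {linear 'rV[R]_m -> W}) v : cinf L v.
Proof.
have [ O [oO Ov Cid]] := cinf_id v; exists O; split=> // k.
exact: (Ck_linl (f := id) oO (@rV_linear_continuous _ _ _ L)).
Qed.

Lemma cinf_coord m n (f : 'rV[R]_m -> 'rV[R]_n) v j :
  cinf f v -> cinf (fun w => f w 0 j : R) v.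
Proof.
by move=> [ O [oO Ov Cf]]; exists O; split => // k; have /(Ck_coord _ _ oO) := Cf k; exact.
Qed.

Lemma cinf_mulmx m n p (f : 'rV[R]_m -> 'rV[R]_n) (M : 'M[R]_(n, p)) v :
  cinf f v -> cinf (fun w => f w *m M) v.
Proof. by move=> Cf; exact: (cinf_comp Cf (cinf_lin (mulmxr M) _)). Qed.

Lemma cinf_lsubmx m n p (f : 'rV[R]_m -> 'rV[R]_(n + p)) v :
  cinf f v -> cinf (fun w => lsubmx (f w)) v.
Proof. by move=> Cf; exact: (cinf_comp Cf (cinf_lin lsubmx _)). Qed.

Lemma cinf_rsubmx m n p (f : 'rV[R]_m -> 'rV[R]_(n + p)) v :
  cinf f v -> cinf (fun w => rsubmx (f w)) v.
Proof. by move=> Cf; exact: (cinf_comp Cf (cinf_lin rsubmx _)). Qed.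

Lemma cinf_row_mx m n p (f : 'rV[R]_m -> 'rV[R]_n) (g : 'rV[R]_m -> 'rV[R]_p) v :
  cinf f v -> cinf g v -> cinf (fun w => row_mx (f w) (g w)) v.
Proof.
move=> Cf Cg.
have := cinfD (cinf_mulmx (row_mx 1%:M 0) Cf) (cinf_mulmx (row_mx 0 1%:M) Cg).
apply: cinf_ext; near=> w.
by rewrite !mul_mx_row !mulmx1 !mulmx0 add_row_mx addr0 add0r.
Unshelve. all: by end_near. Qed.

End SmoothGerms.

(** * The mean value inequality *)

Section MeanValue.
Context {R : realType}.
Implicit Types (m n k : nat) (V W : normedModType R).

Lemma rV_norm_le n (v : 'rV[R]_n) c : 0 <= c ->
  (forall j, `|v 0 j| <= c) -> `|v| <= c.
Proof.
move=> c0 H; rewrite /Num.norm/= mx_normrE; apply: bigmax_le => // -[i j] _ /=.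
by rewrite (ord1 i).
Qed.

Lemma rV_norm_ge n (v : 'rV[R]_n) j : `|v 0 j| <= `|v|.
Proof.
by rewrite [leRHS]/Num.norm/= mx_normrE; exact: (le_bigmax _ (fun i : 'I_1 * 'I_n => `|v i.1 i.2|) (0, j)).
Qed.

Lemma derive_line V W (f : V -> W) (u y : V) (t : R) :
  derivable f (t *: u + y) u ->
  is_derive t 1 (fun s : R => f (s *: u + y)) ('D_u f (t *: u + y)).
Proof.
move=> df.
have E : (fun h : R => h^-1 *: (((fun s : R => f (s *: u + y)) \o shift t) (h *: (1 : R)) - f (t *: u + y)))
  = (fun h : R => h^-1 *: ((f \o shift (t *: u + y)) (h *: u) - f (t *: u + y))).
  by apply/funext => h; rewrite /= scalerDl addrA [_ *: 1]mulr1.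
by apply: DeriveDef; rewrite /derivable /derive E.
Qed.

Lemma ball_convex V (a x y : V) r (t : R) : 0 <= t <= 1 ->
  ball a r x -> ball a r y -> ball a r (t *: (x - y) + y).
Proof.
move=> /andP[t0 t1]; rewrite -ball_normE /= => ax ay.
have -> : a - (t *: (x - y) + y) = t *: (a - x) + (1 - t) *: (a - y).
  rewrite scalerBl scale1r !scalerBr !opprD !opprK.
  by rewrite [RHS]addrCA (addrACA (t *: a)) subrr add0r -[RHS]addrA [- y + _]addrC.
rewrite (le_lt_trans (ler_normD _ _))// !normrZ (ger0_norm t0) ger0_norm ?subr_ge0//.
have [->|tn] := eqVneq t 0; first by rewrite mul0r add0r subr0 mul1r.
have -> : r = t * r + (1 - t) * r by rewrite mulrBl mul1r addrC subrK.
apply: ltr_leD; first by rewrite ltr_pM2l // lt_def tn t0.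
by rewrite ler_wpM2l ?subr_ge0// ltW.
Qed.

(** The mean value theorem is applied to each coordinate along the segment; since the norm is the
    maximum norm, passing to coordinates loses no constant. *)
Lemma mean_value_ball m n (f : 'rV[R]_m -> 'rV[R]_n) a r C :
  (forall x, ball a r x -> differentiable f x /\ forall w, `|'d f x w| <= C * `|w|) ->
  forall x y, ball a r x -> ball a r y -> `|f x - f y| <= C * `|x - y|.
Proof.
move=> df x y ax ay.
have C0 : 0 <= C * `|x - y| by rewrite (le_trans _ ((df x ax).2 _)).
apply: rV_norm_le => // j.
have seg (t : R) : t \in `[0, 1]%R -> ball a r (t *: (x - y) + y).
  by rewrite in_itv /= => t01; exact: ball_convex.
have dc z u : ball a r z -> derivable (fun z => f z 0 j : R) z u /\
    'D_u (fun z => f z 0 j : R) z = ('d f z u) 0 j.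
  move=> az; have [dfz _] := df z az; have dv := diff_derivable (v := u) dfz; split.
    by have /derivable_mxP := dv; exact.
  by rewrite -(deriveE _ dfz) (derive_mx dv) mxE.
pose g (t : R) : R := f (t *: (x - y) + y) 0 j.
pose g' (t : R) : R := ('d f (t *: (x - y) + y) (x - y)) 0 j.
have dg (t : R) : t \in `[0, 1]%R -> is_derive t 1 g (g' t).
  rewrite /g' => /seg at_; have [d1 <-] := dc _ (x - y) at_.
  exact: (derive_line (f := fun z => f z 0 j : R)).
have gc : {within `[0, 1], continuous g}.
  apply: derivable_within_continuous => t t01.
  by have [] := dg t t01.
have D (t : R) : t \in `]0, 1[%R -> is_derive t 1 g (g' t).
  by move=> t01; apply: dg; exact: (subset_itv_oo_cc t01).
have [t t01 E] := MVT_segment (@ler01 R) D gc.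
have {E} : g 1 - g 0 = g' t by rewrite E subr0 mulr1.
rewrite /g /g' scale1r scale0r add0r subrK [(f x - f y) 0 j]mxE [(- f y) 0 j]mxE => ->.
apply: le_trans (rV_norm_ge _ _) _.
exact: (proj2 (df _ (seg _ t01))).
Qed.

Lemma cinf_diff_close m W (f : 'rV[R]_m -> W) a e : cinf f a -> 0 < e ->
  \forall x \near a, forall w, `|'d f x w - 'd f a w| <= e * `|w|.
Proof.
(* Each of the [m] partial derivatives gets an equal share of [e]; [m.+1] keeps the quotient
   meaningful for [m = 0]. *)
move=> Cf e0; pose e1 := e / m.+1%:R.
have e10 : 0 < e1 by rewrite divr_gt0.
have H : \forall x \near a, forall j : 'I_m,
    `|'D_(delta_mx 0 j) f a - 'D_(delta_mx 0 j) f x| < e1.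
  have C j := cinf_cont (cinf_derive (delta_mx 0 j) Cf).
  apply: (filter_forall (F := nbhs a)) => j.
  by move/cvgrPdist_lt: (C j) => /(_ _ e10).
near=> x => w.
have dx : differentiable f x by apply: cinf_diff; near: x; exact: cinf_near.
have da : differentiable f a by exact: cinf_diff.
have Ex : 'd f x w = \sum_(j < m) w 0 j *: 'D_(delta_mx 0 j) f x.
  by rewrite -(deriveE w dx); exact: derive_rV.
have Ea : 'd f a w = \sum_(j < m) w 0 j *: 'D_(delta_mx 0 j) f a.
  by rewrite -(deriveE w da); exact: derive_rV.
rewrite [X in `|X| <= _](_ : _ = \sum_(j < m) w 0 j *:
    ('D_(delta_mx 0 j) f x - 'D_(delta_mx 0 j) f a)); last first.
  apply: etrans (congr2 (fun p q => p - q) Ex Ea) _.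
  by rewrite -sumrB; apply: eq_bigr => j _; rewrite scalerBr.
apply: le_trans (ler_norm_sum _ _ _) _.
apply: (@le_trans _ _ (\sum_(j < m) (e1 * `|w|))).
  apply: ler_sum => j _; rewrite normrZ mulrC ler_pM //; last exact: rV_norm_ge.
  by rewrite distrC ltW //; move: j; near: x.
rewrite sumr_const card_ord -mulr_natl mulrA ler_wpM2r//.
rewrite /e1 mulrCA ger_pMr// ler_pdivrMr// mul1r ler_nat//.
Unshelve. all: by end_near. Qed.

End MeanValue.

(** * Jacobian matrices *)

Section Jacobian.
Context {R : realType}.
Implicit Types (m n p k : nat).

(* Rows are the partial derivatives: vectors act on the left. *)
Definition Jm m n (f : 'rV[R]_m -> 'rV[R]_n) x : 'M[R]_(m, n) :=
  \matrix_(i < m) 'D_(delta_mx 0 i) f x.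

Lemma derive_Jm m n (f : 'rV[R]_m -> 'rV[R]_n) x u :
  differentiable f x -> 'D_u f x = u *m Jm f x.
Proof.
move=> df; rewrite mulmx_sum_row (derive_rV _ df); apply: eq_bigr => i _.
by rewrite rowK.
Qed.

Lemma diff_Jm m n (f : 'rV[R]_m -> 'rV[R]_n) x u :
  differentiable f x -> 'd f x u = u *m Jm f x.
Proof. by move=> df; rewrite -derive_Jm //; exact: (esym (deriveE u df)). Qed.

Lemma Jm_eq m n (f : 'rV[R]_m -> 'rV[R]_n) x M :
  (forall u, 'D_u f x = u *m M) -> Jm f x = M.
Proof. by move=> H; apply/row_matrixP => i; rewrite rowK H rowE. Qed.

Lemma Jm_diff m n (f : 'rV[R]_m -> 'rV[R]_n) x M :
  (forall e, 0 < e -> \forall h \near (0 : 'rV[R]_m),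
     `|f (h + x) - f x - h *m M| <= e * `|h|) ->
  differentiable f x /\ Jm f x = M.
Proof.
move=> H.
have [df dE] := @differentiable_intro R _ _ f (mulmxr M) x (@rV_linear_continuous _ _ _ _) H.
split=> //; apply: Jm_eq => u; rewrite (deriveE _ df).
exact: (congr1 (fun L => L u) dE).
Qed.

Lemma near_Jm m n (f : 'rV[R]_m -> 'rV[R]_n) x : differentiable f x ->
  forall e, 0 < e -> \forall h \near (0 : 'rV[R]_m),
     `|f (h + x) - f x - h *m Jm f x| <= e * `|h|.
Proof.
move=> df e e0; have := diff_near df e0; apply: filterS => h.
by have -> := diff_Jm h df.
Qed.

Lemma near_eq_Jm m n (f g : 'rV[R]_m -> 'rV[R]_n) x :
  (\forall y \near x, f y = g y) -> Jm f x = Jm g x.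
Proof.
move=> fg; apply/row_matrixP => i; rewrite !rowK.
by apply: near_eq_derive; apply: filterS fg.
Qed.

Lemma Jm_comp m n p (f : 'rV[R]_m -> 'rV[R]_n) (g : 'rV[R]_n -> 'rV[R]_p) x :
  differentiable f x -> differentiable g (f x) ->
  Jm (g \o f) x = Jm f x *m Jm g (f x).
Proof.
move=> df dg; apply: Jm_eq => u.
by rewrite (derive_comp_rV _ df dg) mulmxA -(derive_Jm _ df) -(derive_Jm _ dg) (derive_rV _ dg).
Qed.

Lemma Jm_lin m n (L : {linear 'rV[R]_m -> 'rV[R]_n}) x : Jm L x = lin1_mx L.
Proof.
apply: Jm_eq => u; rewrite mul_rV_lin1.
have dL : differentiable L x by exact/linear_differentiable/rV_linear_continuous.
rewrite (deriveE _ dL); have := diff_lin x (@rV_linear_continuous _ _ _ L).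
exact: (congr1 (fun L => L u)).
Qed.

Lemma Jm_id m x : Jm (@id 'rV[R]_m) x = 1%:M.
Proof. by apply: Jm_eq => u; rewrite mulmx1 derive_id. Qed.

Lemma Jm_mulmx m n p (f : 'rV[R]_m -> 'rV[R]_n) (M : 'M[R]_(n, p)) x :
  differentiable f x -> Jm (fun y => f y *m M) x = Jm f x *m M.
Proof.
move=> df; pose g := mulmxr M : 'rV[R]_n -> 'rV[R]_p.
have dg : differentiable g (f x) by exact/linear_differentiable/rV_linear_continuous.
rewrite (Jm_comp df dg) Jm_lin; congr (_ *m _).
by apply/row_matrixP => i; rewrite rowE mul_rV_lin1 /= -rowE.
Qed.

Lemma JmB m n (f g : 'rV[R]_m -> 'rV[R]_n) x :
  differentiable f x -> differentiable g x ->
  Jm (fun y => f y - g y) x = Jm f x - Jm g x.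
Proof.
move=> df dg; apply: Jm_eq => u.
rewrite mulmxBr -!derive_Jm //; apply: deriveB; exact: diff_derivable.
Qed.

Lemma JmD m n (f g : 'rV[R]_m -> 'rV[R]_n) x :
  differentiable f x -> differentiable g x ->
  Jm (fun y => f y + g y) x = Jm f x + Jm g x.
Proof.
move=> df dg; apply: Jm_eq => u.
rewrite mulmxDr -!derive_Jm //; apply: deriveD; exact: diff_derivable.
Qed.

Lemma Jm_row_mx m n p (f : 'rV[R]_m -> 'rV[R]_n) (g : 'rV[R]_m -> 'rV[R]_p) x :
  cinf f x -> cinf g x ->
  Jm (fun y => row_mx (f y) (g y)) x = row_mx (Jm f x) (Jm g x).
Proof.
move=> Cf Cg.
have E : (fun y => row_mx (f y) (g y)) =
    (fun y => f y *m row_mx 1%:M 0 + g y *m row_mx 0 1%:M).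
  apply/funext => y.
  by rewrite !mul_mx_row !mulmx1 !mulmx0 add_row_mx addr0 add0r.
rewrite E.
have d1 := cinf_diff (cinf_mulmx (row_mx 1%:M (0 : 'M[R]_(n, p))) Cf).
have d2 := cinf_diff (cinf_mulmx (row_mx (0 : 'M[R]_(p, n)) 1%:M) Cg).
rewrite (JmD d1 d2) (Jm_mulmx _ (cinf_diff Cf)) (Jm_mulmx _ (cinf_diff Cg)).
by rewrite !mul_mx_row !mulmx1 !mulmx0 add_row_mx addr0 add0r.
Qed.

Lemma mean_value_Jm m n (f : 'rV[R]_m -> 'rV[R]_n) a r C :
  (forall x, ball a r x -> differentiable f x /\ forall w : 'rV[R]_m, `|w *m Jm f x| <= C * `|w|) ->
  forall x y, ball a r x -> ball a r y -> `|f x - f y| <= C * `|x - y|.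
Proof.
move=> H; apply: mean_value_ball => x /H[df Hw]; split=> // w.
by have -> := diff_Jm w df.
Qed.

Lemma Jm_close m n (f : 'rV[R]_m -> 'rV[R]_n) a e : cinf f a -> 0 < e ->
  \forall x \near a, forall w : 'rV[R]_m, `|w *m (Jm f x - Jm f a)| <= e * `|w|.
Proof.
move=> Cf e0; have := cinf_diff_close Cf e0; apply: filter_app; near=> x => H w.
have dx : differentiable f x by apply: cinf_diff; near: x; exact: cinf_near.
have da := cinf_diff Cf.
move: (H w); rewrite mulmxBr; congr (`|_ - _| <= _).
  exact: diff_Jm.
exact: diff_Jm.
Unshelve. all: by end_near. Qed.

Lemma mulmx_bound m n (M : 'M[R]_(m, n)) :
  exists2 C, 0 < C & forall w : 'rV[R]_m, `|w *m M| <= C * `|w|.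
Proof.
exact: (linear_lipschitz (@rV_linear_continuous _ _ _ (mulmxr M))).
Qed.

Lemma cinf_Ck m n (f : 'rV[R]_m -> 'rV[R]_n) a : cinf f a ->
  exists2 r, 0 < r & forall k, Ck k (ball a r) f.
Proof.
move=> [ O [oO Oa Cf]].
have /nbhs_ballP[r r0 sr] := open_nbhs_nbhs (conj oO Oa).
by exists r => // k; apply: Ck_sub (Cf k).
Qed.

Lemma Ck_prod m k (O : set 'rV[R]_m) (I : Type) (r : seq I) (F : I -> 'rV[R]_m -> R) :
  open O -> (forall i, Ck k O (F i)) -> Ck k O (fun v => \prod_(i <- r) F i v).
Proof.
move=> oO HF; elim: r => [|i r IH].
  by rewrite (_ : (fun _ => _) = fun=> 1);
    [exact: Ck_cst|apply/funext => v; rewrite big_nil].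
rewrite (_ : (fun _ => _) = fun v => F i v * \prod_(j <- r) F j v).
  exact: CkM.
by apply/funext => v; rewrite big_cons.
Qed.

Lemma Ck_det m n k (O : set 'rV[R]_m) (A : 'rV[R]_m -> 'M[R]_n) : open O ->
  (forall i j, Ck k O (fun v => A v i j : R)) -> Ck k O (fun v => \det (A v)).
Proof.
move=> oO HA; apply: Ck_sum => // s; apply: CkM => //; first exact: Ck_cst.
exact: Ck_prod.
Qed.

(** Cramer's rule: the inverse is the adjugate over the determinant, both polynomial in the
    entries. *)
Lemma Ck_invmx m n k (O : set 'rV[R]_m) (A : 'rV[R]_m -> 'M[R]_n) (u : 'rV[R]_n) :
  open O -> (forall v, O v -> A v \in unitmx) ->
  (forall i j, Ck k O (fun v => A v i j : R)) -> Ck k O (fun v => u *m invmx (A v)).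
Proof.
move=> oO uA HA.
have E v : O v -> (\det (A v))^-1 *: (u *m \adj (A v)) = u *m invmx (A v).
  by move=> Ov; rewrite /invmx uA // -scalemxAr.
apply: (Ck_ext oO E); apply: CkZ => //.
  apply: CkV => //; last exact: Ck_det.
  by move=> v /uA; rewrite unitmxE unitfE.
apply/(Ck_coord _ _ oO) => j.
rewrite (_ : (fun _ => _) = fun v => \sum_i u 0 i * \adj (A v) i j); last first.
  by apply/funext => v; rewrite mxE.
apply: Ck_sum => // i; apply: CkM => //; first exact: Ck_cst.
rewrite (_ : (fun _ => _) = fun v => (-1) ^+ (j + i) * \det (row' j (col' i (A v)))); last first.
  by apply/funext => v; rewrite mxE.
apply: CkM => //; first exact: Ck_cst.
apply: Ck_det => // a b.
rewrite (_ : (fun _ => _) = fun v => A v (lift j a) (lift i b)); first exact: HA.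
by apply/funext => v; rewrite !mxE.
Qed.

End Jacobian.

(** * The inverse function theorem *)

Section InverseFunction.
Context {R : realType}.

Lemma closed_ball_compact n (a : 'rV[R]_n) r : compact [set x | `|a - x| <= r].
Proof.
apply: bounded_closed_compact; last first.
  rewrite (_ : [set x | _] = (fun x => `|a - x|) @^-1` [set t | t <= r]) //.
  apply: closed_comp => [x _|]; last exact: closed_le.
  apply: continuous_comp; last exact: norm_continuous.
  by apply: continuousB; [exact: cst_continuous|exact: cvg_id].
exists (r + `|a|); split; first exact: num_real.
move=> M rM x /= ax; apply: le_trans (ltW rM).
by rewrite -[x](subKr a) (le_trans (ler_normB _ _)) // addrC lerD2r.
Qed.

(** Near [a] the map [k], the identity minus [f] normalised by the inverse Jacobian, contracts by
    $1/2$. Hence [f] is expanding up to a constant, so injective with Lipschitz inverse, and every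
    value near [f a] is reached through a fixed point of a translate of [k]. *)
Lemma inverse_function n (f : 'rV[R]_n -> 'rV[R]_n) a N :
  cinf f a -> Jm f a \in unitmx -> nbhs a N ->
  exists (O : set 'rV[R]_n) (g : 'rV[R]_n -> 'rV[R]_n),
    [/\ open O, O a, O `<=` N, open (f @` O) &
      (forall x, O x -> g (f x) = x) /\ forall y, (f @` O) y -> cinf g y].
Proof.
move=> Cf uJ Na; pose Li := invmx (Jm f a); pose k (x : 'rV[R]_n) := x - f x *m Li.
have ck x : cinf f x -> cinf k x.
  by move=> Cx; apply: cinfB; [exact: cinf_id|exact: cinf_mulmx].
have Jk x : cinf f x -> Jm k x = 1%:M - Jm f x *m Li.
  move=> Cx; rewrite /k (JmB (cinf_diff (cinf_id x)) (cinf_diff (cinf_mulmx Li Cx))).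
  by rewrite Jm_id (Jm_mulmx _ (cinf_diff Cx)).
have [r0 r00 Cr0] := cinf_Ck Cf.
have h0 : 0 < (2^-1 : R) by rewrite invr_gt0.
have [r r_gt0 Hr] : exists2 r, 0 < r & forall x, ball a r x ->
    [/\ N x, ball a r0 x & forall w : 'rV[R]_n, `|w *m (Jm k x - Jm k a)| <= 2^-1 * `|w|].
  have /nbhs_ballP[r r_gt0 sr] : nbhs a [set x |
      [/\ N x, ball a r0 x & forall w : 'rV[R]_n, `|w *m (Jm k x - Jm k a)| <= 2^-1 * `|w|]].
    have H1 := Jm_close (ck _ Cf) h0.
    have H2 := nbhsx_ballx a _ r00.
    by near=> x; split; near: x.
  by exists r.
have Cx x : ball a r x -> cinf f x.
  by move=> /Hr[_ rx _]; exists (ball a r0); split=> //; exact: ball_open.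
have kK x : ball a r x -> forall w : 'rV[R]_n, `|w *m Jm k x| <= 2^-1 * `|w|.
  move=> ax w; have [_ _ /(_ w)] := Hr x ax.
  by rewrite (Jk a Cf) mulmxV // subrr subr0.
have contr x y : ball a r x -> ball a r y -> `|k x - k y| <= 2^-1 * `|x - y|.
  apply: mean_value_Jm => z az; split; last exact: kK.
  exact: (cinf_diff (ck _ (Cx _ az))).
have expd x y : ball a r x -> ball a r y -> `|x - y| <= 2 * `|(f x - f y) *m Li|.
  move=> ax ay; have := contr x y ax ay.
  have -> : k x - k y = (x - y) - (f x - f y) *m Li.
    rewrite /k mulmxBl; move: (f x *m Li) (f y *m Li) => A B.
    by apply/rowP => i; rewrite !mxE; ring.
  move=> H; have := ler_normD (x - y - (f x - f y) *m Li) ((f x - f y) *m Li).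
  rewrite subrK => H'; lra.
(* [T] below then maps the closed ball of radius $r/2$ to itself, as $\frac12\cdot\frac r2+\frac
   r4=\frac r2$. *)
pose P := [set y : 'rV[R]_n | ball (0 : 'rV[R]_n) (r / 4) ((y - f a) *m Li)].
have oP : open P.
  have := @open_setI_preimage _ _ (fun y : 'rV[R]_n => (y - f a) *m Li) setT (ball (0 : 'rV[R]_n) (r / 4)).
  rewrite setTI; apply; [exact: openT|exact: ball_open|move=> y _].
  exact: (cinf_cont (cinf_mulmx Li (cinfB (cinf_id y) (cinf_cst (f a) y)))).
have inb x : `|a - x| <= r / 2 -> ball a r x.
  move=> H; rewrite -ball_normE /=; apply: le_lt_trans H _; lra.
have aa : ball a r a by exact: ballxx.
have surj y : P y -> exists x, ball a r x /\ f x = y.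
  move=> Py0; have Py : `|(y - f a) *m Li| < r / 4.
    by move: Py0; rewrite /P /= -ball_normE /= sub0r normrN.
  pose T (x : 'rV[R]_n) := k x + y *m Li; pose U := [set x : 'rV[R]_n | `|a - x| <= r / 2].
  have TU x : U x -> U (T x).
    move=> Ux; rewrite /U /=.
    have -> : a - T x = (k a - k x) - (y - f a) *m Li.
      rewrite /T /k mulmxBl; move: (f x *m Li) (f a *m Li) (y *m Li) => A B C.
      rewrite !opprD !opprK; apply/rowP => i; rewrite !mxE; ring.
    apply: le_trans (ler_normB _ _) _.
    have := contr a x aa (inb _ Ux); move: Ux; rewrite /U /=; lra.
  have cphi : {within U, continuous (fun x : 'rV[R]_n => `|x - T x|)}.
    apply: continuous_in_subspaceT => x /set_mem Ux.
    apply: continuous_comp; last exact: norm_continuous.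
    have Cxx := Cx _ (inb _ Ux).
    exact: (cinf_cont (cinfB (cinf_id x) (cinfD (ck _ Cxx) (cinf_cst (y *m Li) x)))).
  have U0 : U !=set0 by exists a; rewrite /U /= subrr normr0; lra.
  (* The fixed point is found by minimising the displacement $|x-Tx|$ on a compact ball: applying
     [T] to a minimiser halves the displacement, so the minimum is zero. *)
  have [c /set_mem Uc cmin] := EVT_min_rV U0 (@closed_ball_compact n a (r / 2)) cphi.
  have := cmin (T c) (mem_set (TU _ Uc)).
  have TT u v : T u - T v = k u - k v by rewrite /T opprD addrACA subrr addr0.
  rewrite TT.
  have := contr _ _ (inb _ Uc) (inb _ (TU _ Uc)) => H1 H2.
  have c0 : `|c - T c| <= 0 by lra.
  exists c; split; first exact: (inb _ Uc).
  move: c0; rewrite normr_le0 /T /k subr_eq0 eq_sym -addrA addrC -subr_eq0 addrK.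
  rewrite addrC -mulmxBl => /eqP E.
  have := congr1 (fun w => w *m Jm f a) E.
  by rewrite mul0mx mulmxKV // => /eqP; rewrite subr_eq0 => /eqP.
pose g (y : 'rV[R]_n) := xget a [set x | ball a r x /\ f x = y].
have gP y : P y -> ball a r (g y) /\ f (g y) = y.
  by move=> /surj ex; have := @xgetPex _ a [set x | ball a r x /\ f x = y] ex.
pose O := ball a r `&` f @^-1` P.
have oO : open O.
  apply: open_setI_preimage => //; first exact: ball_open.
  by move=> x /Cx; exact: cinf_cont.
have fO : f @` O = P.
  apply/seteqP; split=> [_ [x [_ Px] <-] //|y Py].
  by have [gy fgy] := gP _ Py; exists (g y) => //; split=> //=; rewrite fgy.
have gf x : O x -> g (f x) = x.
  move=> [ax Px]; have [ay fy] := gP _ Px.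
  apply/eqP; rewrite -subr_eq0 -normr_le0.
  by rewrite (le_trans (expd _ _ ay ax)) // fy subrr mul0mx normr0 mulr0.
have uM x : ball a r x -> Jm f x \in unitmx.
  move=> ax; rewrite -row_free_unit; apply: inj_row_free => v v0.
  have := kK x ax v; rewrite (Jk _ (Cx _ ax)) mulmxBr mulmx1 mulmxA v0 mul0mx subr0.
  move=> H; apply/eqP; rewrite -normr_le0; lra.
have [c1 c10 Hc1] := mulmx_bound Li.
have lip y y' : P y -> P y' -> `|g y - g y'| <= (2 * c1) * `|y - y'|.
  move=> Py Py'; have [ay fy] := gP _ Py; have [ay' fy'] := gP _ Py'.
  rewrite (le_trans (expd _ _ ay ay')) // fy fy' -mulrA ler_pM2l //; exact: Hc1.
have dg y : P y -> differentiable g y /\ Jm g y = invmx (Jm f (g y)).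
  move=> Py; have [ay fy] := gP _ Py; set x := g y; pose Mi := invmx (Jm f x).
  have [c2 c20 Hc2] := mulmx_bound Mi.
  apply: Jm_diff => e e0.
  (* [c2] bounds the inverse Jacobian at [x], and [2 * c1] is the Lipschitz constant of [g]. *)
  pose e' := e / (c2 * (2 * c1)).
  have e'0 : 0 < e' by rewrite divr_gt0 // !mulr_gt0.
  have /nbhs_ballP[d d0 Hd] := near_Jm (cinf_diff (Cx _ ay)) e'0.
  have nP : \forall h \near (0 : 'rV[R]_n), P (h + y).
    rewrite (near_shift y 0); apply: filterS (open_nbhs_nbhs (conj oP Py)) => z Pz.
    by rewrite /= sub0r addrNK.
  near=> h.
  have Ph : P (h + y) by near: h.
  have dl : `|g (h + y) - x| <= (2 * c1) * `|h|.
    by rewrite -{2}(addrK y h); exact: lip.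
  set x' := g (h + y) in dl *; have [ax' fx'] := gP _ Ph.
  have : ball (0 : 'rV[R]_n) d (x' - x).
    rewrite -ball_normE /= sub0r normrN (le_lt_trans dl) //.
    rewrite -ltr_pdivlMl ?mulr_gt0 //.
    have : ball (0 : 'rV[R]_n) ((2 * c1)^-1 * d) h.
      near: h; apply: nbhsx_ballx; by rewrite mulr_gt0 // invr_gt0 mulr_gt0.
    by rewrite -ball_normE /= sub0r normrN.
  move=> /Hd /=; rewrite subrK fx' fy addrK => H.
  have -> : x' - x - h *m Mi = - ((h - (x' - x) *m Jm f x) *m Mi).
    by rewrite mulmxBl (mulmxK (uM _ ay)) opprB.
  rewrite normrN (le_trans (Hc2 _)) // -ler_pdivlMl // (le_trans H) //.
  rewrite (le_trans (ler_wpM2l (ltW e'0) dl)) // /e'.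
  rewrite le_eqVlt; apply/orP; left; apply/eqP; field.
  by apply/andP; split; exact: lt0r_neq0.
have dgd y : P y -> differentiable g y by move=> /dg[].
(* Bootstrap: the derivative of [g] is the inverse Jacobian of [f] evaluated at [g], hence as
   regular as [g] itself. *)
have Cg k' : Ck k' P g.
  elim: k' => [|k' IH]; first by move=> y Py; exact/differentiable_continuous/dgd.
  split=> // u.
  have Cu : Ck k' (ball a r) (fun x => u *m invmx (Jm f x)).
    apply: Ck_invmx => // [|i j]; first exact: ball_open.
    have Cr : forall k, Ck k (ball a r) f.
      by move=> k0; apply: Ck_sub (Cr0 k0) => x /Hr[].
    have := (proj2 (Cr k'.+1)) (delta_mx 0 i).
    move=> /(Ck_coord _ _ (ball_open a r)) /(_ j).
    apply: Ck_ext; first exact: ball_open.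
    by move=> x _; rewrite mxE.
  have fg y : P y -> ball a r (g y) by move=> /gP[].
  have := Ck_comp oP fg IH Cu; apply: Ck_ext => // y Py /=.
  by have [dy <-] := dg y Py; rewrite derive_Jm.
exists O, g; split=> //.
- by split=> //; rewrite /P /= subrr mul0mx; apply: ballxx; lra.
- by move=> x [/Hr[]].
- by rewrite fO.
- split=> // y; rewrite fO => Py; exists P; split=> //.
Unshelve. all: by end_near. Qed.

End InverseFunction.

(** * The flat function $e^{-1/x}$ and cutoffs *)

Section FlatFunction.
Context {R : realType}.

(** The power of $1/x$ makes the family closed, up to linear combinations, under differentiation, so
    that smoothness follows by one induction over all [j]. *)
Definition flat (j : nat) (x : R) : R := if 0 < x then x^-1 ^+ j * expR (- x^-1) else 0.

Lemma flat_gt0 x : 0 < x -> 0 < flat 0 x.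
Proof. by move=> x0; rewrite /flat x0 expr0 mul1r expR_gt0. Qed.

Lemma flat_le0 j x : x <= 0 -> flat j x = 0.
Proof. by rewrite /flat leNgt => /negbTE ->. Qed.

Lemma flat_ge0 j x : 0 <= flat j x.
Proof.
rewrite /flat; case: ltP => // x0.
by rewrite mulr_ge0 ?expR_ge0 // exprn_ge0 // invr_ge0 ltW.
Qed.

Lemma flat0_homo x y : x <= y -> flat 0 x <= flat 0 y.
Proof.
rewrite /flat; case: (ltP 0 x) => x0 xy; last first.
  by rewrite -[leRHS]/(flat 0 y) flat_ge0.
by rewrite (lt_le_trans x0 xy) !expr0 !mul1r ler_expR lerN2 lef_pV2 // posrE // (lt_le_trans x0).
Qed.

(** Gives derivative zero at the origin. With $y=1/x$ the constant comes from $y^{j+2}/(j+2)!\le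
    e^y$. *)
Lemma flat_le_sqr j : exists2 C, 0 < C & forall x, `|flat j x| <= C * x ^+ 2.
Proof.
exists (j.+2`!%:R) => [|x]; first by rewrite ltr0n fact_gt0.
rewrite ger0_norm ?flat_ge0 // /flat; case: ltP => x0; last first.
  by rewrite mulr_ge0 ?ler0n // sqr_ge0.
have y0 : 0 < x^-1 by rewrite invr_gt0.
have := expR_ge1Dxn j.+1 (ltW y0); set e := expR _ => He.
have e0 : 0 < e by exact: expR_gt0.
rewrite expRN -/e ler_pdivrMr //.
have He' : x^-1 ^+ j.+2 <= j.+2`!%:R * e.
  rewrite -ler_pdivrMl // mulrC (le_trans _ He) // lerDr //.
rewrite mulrAC -ler_pdivrMr ?exprn_gt0 // (le_trans _ He') //.
by rewrite -exprVn -exprD addn2.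
Qed.

Lemma flat_derive j (x : R) :
  is_derive x (1 : R) (flat j) (flat j.+2 x - j%:R * flat j.+1 x).
Proof.
have [x0|x0|->] := ltgtP x 0.
- rewrite !flat_le0 ?ltW // mulr0 subrr.
  apply: (@near_eq_is_derive _ _ _ (fun=> 0)).
  by near=> y; rewrite flat_le0 // ltW //; near: y; exact: lt_nbhsl.
- have nE : \forall y \near x, y^-1 ^+ j * expR (- y^-1) = flat j y.
    by near=> y; rewrite /flat ifT //; near: y; exact: lt_nbhsr.
  apply: (near_eq_is_derive nE).
  have dV : is_derive x 1 (fun y : R => y^-1) (- x^-1 ^+ 2).
    have xn : x != 0 by rewrite gt_eqF.
    have D := is_deriveV (f := id) xn (is_derive_id x (1 : R)).
    by apply: (is_derive_eq D); rewrite /GRing.scale /= mulr1 exprVn.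
  have dE : is_derive x 1 (fun y : R => expR (- y^-1)) (expR (- x^-1) * x^-1 ^+ 2).
    have dN := is_deriveN dV; rewrite opprK in dN.
    exact: (is_derive1_comp (g := fun y => - y^-1) (is_derive_expR _) dN).
  have dX : is_derive x 1 (fun y : R => y^-1 ^+ j) (- j%:R * x^-1 ^+ j.+1).
    clear nE; case: j => [|j]; first by rewrite oppr0 mul0r; exact: (is_derive_cst (1 : R) x 1).
    have D := is_deriveX j.+1 dV; rewrite exprfctE in D.
    apply: (is_derive_eq D).
    by rewrite /GRing.scale /= !exprS expr0; move: x^-1 => y; ring.
  apply: (is_derive_eq (is_deriveM dX dE)).
  rewrite /flat x0 /GRing.scale /= !exprS expr0.
  by ring.
- rewrite !flat_le0 // mulr0 subrr.
  have [C C0 HC] := flat_le_sqr j.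
  have [| |df dE] := @differentiable_intro R R R (flat j) (\0 : {linear R -> R}) 0.
  + exact: cst_continuous.
  + move=> e e0; apply/nbhs_ballP; exists (e / C); first by rewrite /= divr_gt0.
    move=> h; rewrite /= -ball_normE /= sub0r normrN => he.
    rewrite addr0 (flat_le0 _ (lexx 0)) !subr0 (le_trans (HC h)) //.
    rewrite -real_normK ?num_real // expr2 mulrA ler_wpM2r //.
    by rewrite mulrC -ler_pdivlMr // ltW.
  + apply: DeriveDef; first exact: diff_derivable.
    rewrite (deriveE _ df); exact: (congr1 (fun L => L 1) dE).
Unshelve. all: by end_near. Qed.

Lemma Ck_flat m k j (O : set 'rV[R]_m) (a : 'rV[R]_m -> R) :
  open O -> Ck k O a -> Ck k O (fun v => flat j (a v)).
Proof.
move=> oO; elim: k j a => [|k IH] j a.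
  move=> ac v Ov; apply: continuous_comp; first exact: ac.
  by apply/differentiable_continuous/derivable1_diffP; have [] := flat_derive j (a v).
move=> Ca; have Ca' := CkS Ca; case: Ca => da Da.
have dj v : differentiable (flat j) (a v).
  by apply/derivable1_diffP; have [] := flat_derive j (a v).
split=> [v Ov|u].
  by apply: differentiable_comp; [exact: da|exact: dj].
have C1 : Ck k O (fun v => flat j.+2 (a v) + (- j%:R) * flat j.+1 (a v)).
  apply: CkD => //; first exact: IH.
  by apply: CkM => //; [exact: Ck_cst|exact: IH].
apply: (Ck_ext oO _ (CkM oO C1 (Da u))) => v Ov.
have dc := differentiable_comp (da v Ov) (dj v).
rewrite (deriveE u dc) (diff_comp (da v Ov) (dj v)) /=.
have [_ E] := flat_derive j (a v).
have E1 : 'd (flat j) (a v) 1 = flat j.+2 (a v) - j%:R * flat j.+1 (a v).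
  by rewrite -E; exact: esym (deriveE (1 : R) (dj v)).
rewrite (deriveE u (da v Ov)) mulNr -E1.
move: ('d a v u) => t; rewrite -{2}[t]mulr1 mulrC.
by rewrite -[t * 1]/(t *: (1 : R)) linearZ.
Qed.

Lemma cinf_flat m (a : 'rV[R]_m -> R) v : cinf a v -> cinf (fun w => flat 0 (a w)) v.
Proof. by move=> [ O [oO Ov Ca]]; exists O; split=> // k; exact: Ck_flat. Qed.

(** The norm of row vectors is the maximum norm, which is not smooth; cutoffs and the functions
    $Q_g$ use the Euclidean square instead. *)
Definition sqn n (v : 'rV[R]_n) : R := \sum_j v 0 j * v 0 j.

Lemma cinf_sqn m n (f : 'rV[R]_m -> 'rV[R]_n) v :
  cinf f v -> cinf (fun w => sqn (f w)) v.
Proof.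
by move=> Cf; apply: cinf_sum => j; apply: cinfM; exact: cinf_coord.
Qed.

Lemma sqn0 n : sqn (0 : 'rV[R]_n) = 0.
Proof. by rewrite /sqn big1 // => j _; rewrite mxE mulr0. Qed.

Lemma sqn_lt_norm n (v : 'rV[R]_n) r : 0 < r -> sqn v < r ^+ 2 -> `|v| < r.
Proof.
move=> r0 vr; rewrite /Num.norm/= mx_normrE; apply: bigmax_lt => // -[i j] _ /=.
rewrite (ord1 i) -(@ltr_pXn2r _ 2) ?nnegrE // ?ltW // (le_lt_trans _ vr) //.
rewrite real_normK ?num_real // /sqn (bigD1 j) //= expr2 lerDl.
by apply: sumr_ge0 => k _; rewrite -expr2 sqr_ge0.
Qed.

Lemma norm_sqn_ge n (v : 'rV[R]_n) : `|v| ^+ 2 <= sqn v.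
Proof.
have [->|v0] := eqVneq v 0; first by rewrite normr0 expr0n /= sqn0.
rewrite leNgt; apply/negP => /sqn_lt_norm; rewrite normr_gt0 => /(_ v0).
by rewrite ltxx.
Qed.

Lemma sqn_le n (v : 'rV[R]_n) : sqn v <= n%:R * `|v| ^+ 2.
Proof.
apply: (@le_trans _ _ (\sum_(j < n) `|v| ^+ 2)).
  apply: ler_sum => j _; rewrite -expr2 -real_normK ?num_real //.
  by rewrite ler_pXn2r ?nnegrE // rV_norm_ge.
by rewrite sumr_const card_ord mulr_natl.
Qed.

(* A smooth cutoff: [1] where [|v|^2 <= b] and [0] where [|v|^2 >= a]. *)
Definition cutoff n (b a : R) (v : 'rV[R]_n) : R :=
  flat 0 (a - sqn v) / (flat 0 (a - sqn v) + flat 0 (sqn v - b)).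

Lemma cutoff_denom n b a (v : 'rV[R]_n) : b < a ->
  0 < flat 0 (a - sqn v) + flat 0 (sqn v - b).
Proof.
move=> ba; have [va|va] := ltP (sqn v) a.
  by rewrite ltr_pwDl ?flat_ge0 // flat_gt0 // subr_gt0.
by rewrite ltr_pwDr ?flat_ge0 // flat_gt0 // subr_gt0 (lt_le_trans ba).
Qed.

Lemma cutoff1 n b a (v : 'rV[R]_n) : b < a -> sqn v <= b -> cutoff b a v = 1.
Proof.
move=> ba vb; have := cutoff_denom v ba; rewrite /cutoff [flat 0 (sqn v - b)]flat_le0 ?subr_le0 //.
by rewrite addr0 => d0; rewrite divff // gt_eqF.
Qed.

Lemma cutoff0 n b a (v : 'rV[R]_n) : a <= sqn v -> cutoff b a v = 0.
Proof. by move=> va; rewrite /cutoff flat_le0 ?mul0r // subr_le0. Qed.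

Lemma cutoff01 n b a (v : 'rV[R]_n) : b < a -> 0 <= cutoff b a v <= 1.
Proof.
move=> ba; have d0 := cutoff_denom v ba; rewrite /cutoff.
rewrite divr_ge0 ?flat_ge0 ?(ltW d0) //= ler_pdivrMr // mul1r lerDl.
exact: flat_ge0.
Qed.

Lemma cinf_cutoff m n (f : 'rV[R]_m -> 'rV[R]_n) b a v : b < a ->
  cinf f v -> cinf (fun w => cutoff b a (f w)) v.
Proof.
move=> ba Cf; have Cs := cinf_sqn Cf.
have C1 := cinf_flat (cinfB (cinf_cst a v) Cs).
have C2 := cinf_flat (cinfB Cs (cinf_cst b v)).
apply: cinfM => //; apply: cinfV; last exact: cinfD.
by rewrite gt_eqF // cutoff_denom.
Qed.

End FlatFunction.

(** * Star-shaped sublevel sets are diffeomorphic to $\mathbb{R}^n$ *)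

Section RadialDiffeo.
Context {R : realType} {n : nat}.
Implicit Types (v w z : 'rV[R]_n).

(** The point [c] given by the mean value theorem is positive, so the derivative along [c *: v] has
    the sign of the derivative along [v]. *)
Lemma ray_monotone (P : 'rV[R]_n -> R) v (t : R) : 0 <= t <= 1 ->
  (forall s : R, 0 <= s <= 1 -> cinf P (s *: v) /\ 0 <= 'D_(s *: v) P (s *: v)) ->
  P (t *: v) <= P v.
Proof.
move=> /andP[t0 t1] HP; pose g (s : R) : R := P (s *: v + 0).
have dg (s : R) : 0 <= s <= 1 -> is_derive s 1 g ('D_v P (s *: v + 0)).
  move=> s01; apply: derive_line; rewrite addr0; apply: diff_derivable.
  exact: cinf_diff (proj1 (HP s s01)).
have gc : {within `[t, 1], continuous g}.
  apply: derivable_within_continuous => s; rewrite in_itv /= => /andP[s0 s1].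
  by have [|] := dg s; first by rewrite (le_trans t0 s0).
have D (s : R) : s \in `]t, 1[%R -> is_derive s 1 g ('D_v P (s *: v + 0)).
  rewrite in_itv /= => /andP[s0 s1]; apply: dg.
  by rewrite ltW ?(le_lt_trans t0 s0) // ltW.
have [->|tn1] := eqVneq t 1; first by rewrite scale1r.
have tl1 : t < 1 by rewrite lt_neqAle tn1.
have [c] := MVT tl1 D gc; rewrite in_itv /= => /andP[tc c1] E.
have c_gt0 : 0 < c by exact: le_lt_trans tc.
have [|Cc Dc] := HP c; first by rewrite !ltW.
have dc := cinf_diff Cc.
have Dv : 0 <= 'D_v P (c *: v).
  move: Dc; rewrite (deriveE _ dc) linearZ /= -(deriveE _ dc).
  by rewrite -[_ *: _]/(c * 'D_v P (c *: v)) pmulr_rge0.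
have : 0 <= g 1 - g t by rewrite E mulr_ge0 ?subr_ge0 // addr0.
by rewrite /g !addr0 scale1r subr_ge0.
Qed.

(** The supremum of the [Q i] is replaced by a finite sum of functions [flat 0 (Q i v - s)], each
    smooth and radially nondecreasing; compactness of the part of the closed ball outside [U s']
    selects finitely many indices. *)
Lemma bump_exhaustion (I : choiceType) (K : set I) (Q : I -> 'rV[R]_n -> R)
    (rho rho' r : R) :
  let U s := [set v | ball 0 rho v /\ forall i, K i -> Q i v < s] in
  rho' < rho ->
  (forall i, K i -> forall v, ball 0 rho v -> cinf (Q i) v /\ 0 <= 'D_v (Q i) v) ->
  (forall s, s <= r -> open (U s)) ->
  forall s s', s < s' -> s' <= r ->
  exists h : 'rV[R]_n -> R,
    [/\ forall v, ball 0 rho v -> [/\ cinf h v, 0 <= h v & 0 <= 'D_v h v],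
        forall v, U s v -> h v = 0 &
        forall v, `|v| <= rho' -> ~ U s' v -> 1 <= h v].
Proof.
move=> U rr HQ oU s s' ss' s'r.
(* Outside [U s'] some [Q i] is at least [s'], hence satisfies the open condition [m < Q i]; there
   its summand is at least [flat 0 (m - s)], which is positive and serves as normalisation. *)
pose m := (s + s') / 2.
have sm : s < m by rewrite /m; lra.
have ms : m < s' by rewrite /m; lra.
have inb v : `|v| <= rho' -> ball 0 rho v.
  by move=> H; rewrite -ball_normE /= sub0r normrN (le_lt_trans H).
pose C := [set v | `|0 - v| <= rho'] `&` ~` U s'.
have Cc : compact C.
  apply: subclosed_compact (@closed_ball_compact _ _ 0 rho') _; last by move=> v [].
  apply: closedI; last exact/open_closedC/oU.
  exact: compact_closed (@closed_ball_compact _ _ 0 rho').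
have := Cc; rewrite compact_cover => /(_ I K (fun i => ball 0 rho `&` Q i @^-1` [set x | m < x])).
move=> [||D' DK Ccov].
- move=> i Ki; apply: open_setI_preimage; [exact: ball_open|exact: open_gt|].
  by move=> v bv; exact: cinf_cont (proj1 (HQ _ Ki _ bv)).
- move=> v [/=]; rewrite sub0r normrN => vr /not_andP[|]; first by move/inb: vr.
  move=> /existsNP[i /not_implyP[Ki /negP]]; rewrite -leNgt => Qi.
  by exists i => //; split; [exact: inb|exact: lt_le_trans ms Qi].
pose c := flat 0 (m - s).
have c0 : 0 < c by rewrite flat_gt0 // subr_gt0.
have KD i : i \in D' -> K i by move=> /DK; rewrite inE.
pose q i v := flat 0 (Q i v - s).
have Cq i v : K i -> ball 0 rho v -> cinf (q i) v /\ 0 <= 'D_v (q i) v.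
  move=> Ki bv; have [CQ DQ] := HQ i Ki v bv.
  have Cs := cinfB CQ (cinf_cst s v); split; first exact: cinf_flat.
  have d1 := cinf_diff Cs.
  have d2 : differentiable (flat 0) (Q i v - s).
    by apply/derivable1_diffP; have [] := flat_derive 0 (Q i v - s).
  (* At index 0 only the nonnegative term [flat 2] of the derivative survives. *)
  have E1 : 'd (flat 0) (Q i v - s) 1 = flat 2 (Q i v - s).
    rewrite -(deriveE (1 : R) d2); have [_ ->] := flat_derive 0 (Q i v - s).
    by rewrite mul0r subr0.
  have d12 := differentiable_comp d1 d2.
  have -> : 'D_v (q i) v = 'd (flat 0) (Q i v - s) ('D_v (fun w => Q i w - s) v).
    rewrite (deriveE v d1); apply: etrans (deriveE v d12) _.
    by rewrite (diff_comp d1 d2).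
  have -> : 'D_v (fun w => Q i w - s) v = 'D_v (Q i) v.
    rewrite (deriveB (f := Q i) (g := fun=> s)); last exact: derivable_cst.
      by rewrite derive_cst subr0.
    exact/diff_derivable/cinf_diff.
  move: ('D_v (Q i) v) DQ => t t0.
  have -> : 'd (flat 0) (Q i v - s) t = t * 'd (flat 0) (Q i v - s) 1.
    by rewrite -{1}[t]mulr1 -[t * 1]/(t *: (1 : R)) linearZ.
  by rewrite E1 mulr_ge0 // flat_ge0.
have q0 i v : 0 <= q i v by exact: flat_ge0.
have CS (l : seq I) v : (forall i, i \in l -> K i) -> ball 0 rho v ->
    cinf (fun w => \sum_(i <- l) q i w) v /\ 0 <= 'D_v (fun w => \sum_(i <- l) q i w) v.
  move=> Kl bv; elim: l Kl => [|i l IH] Kl.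
    rewrite (_ : (fun w => _) = fun=> 0); last by apply/funext => w; rewrite big_nil.
    by split; [exact: cinf_cst|rewrite derive_cst].
  have -> : (fun w => \sum_(j <- i :: l) q j w) = (fun w => q i w + \sum_(j <- l) q j w).
    by apply/funext => w; rewrite big_cons.
  have [C1 D1] := Cq i v (Kl i (mem_head _ _)) bv.
  have [C2 D2] : cinf (fun w => \sum_(i <- l) q i w) v /\ 0 <= 'D_v (fun w => \sum_(i <- l) q i w) v.
    by apply: IH => j jl; apply: Kl; rewrite inE jl orbT.
  split; first exact: cinfD.
  rewrite (deriveD (f := q i) (g := fun w => \sum_(j <- l) q j w)); first exact: addr_ge0.
    exact/diff_derivable/cinf_diff.
  exact/diff_derivable/cinf_diff.
pose l : seq I := enum_fset D'.
have Kl i : i \in l -> K i by exact: KD.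
pose S v : R := \sum_(i <- l) q i v.
exists (fun v => c^-1 *: S v); split.
- move=> v bv; have [C1 D1] := CS l v Kl bv; split.
  + exact: cinfZ (cinf_cst c^-1 v) C1.
  + by rewrite mulr_ge0 ?invr_ge0 ?(ltW c0) // sumr_ge0 // => i _; exact: q0.
  + rewrite (deriveZ (f := S)); last exact/diff_derivable/cinf_diff.
    by rewrite mulr_ge0 ?invr_ge0 ?(ltW c0).
- move=> v [_ Us]; rewrite /S big1_seq ?scaler0 // => i /andP[_ /Kl /Us Qi].
  by rewrite /q flat_le0 // subr_le0 ltW.
- move=> v vr nU; have [|i Di [_ mQ]] := Ccov v.
    by split; rewrite //= sub0r normrN.
  rewrite -[c^-1 *: _]/(c^-1 * _) mulrC ler_pdivlMr // mul1r /S.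
  rewrite (big_rem i) //= (le_trans (flat0_homo (y := Q i v - s) _)) //.
    by rewrite lerB // ltW.
  by rewrite lerDl sumr_ge0 // => j _; exact: q0.
Qed.

(* Along rays [v |-> (1 + H v) v] is strictly increasing, and it is proper because [H] is;
   hence it is a diffeomorphism from the star-shaped [U] onto the whole space. *)
Lemma radial_diffeo (U : set 'rV[R]_n) (H : 'rV[R]_n -> R) (A : nat -> set 'rV[R]_n) :
  open U -> U 0 ->
  (forall v (t : R), U v -> 0 <= t <= 1 -> U (t *: v)) ->
  (forall v, U v -> [/\ cinf H v, 0 <= H v & 0 <= 'D_v H v]) ->
  (forall N, closed (A N)) -> (forall N, A N `<=` U) ->
  (forall N v, U v -> H v < N%:R -> A N v) ->
  exists psi psi' : 'rV[R]_n -> 'rV[R]_n,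
    [/\ psi 0 = 0, forall v, U v -> cinf psi v & forall z, cinf psi' z] /\
    [/\ forall z, U (psi' z), forall v, U v -> psi' (psi v) = v &
        forall z, psi (psi' z) = z].
Proof.
move=> oU U0 star HH Acl AU HA.
pose psi v : 'rV[R]_n := (1 + H v) *: v.
have HC v : U v -> cinf H v by case/HH.
have H0 v : U v -> 0 <= H v by case/HH.
have H1 v : U v -> 0 < 1 + H v by move=> /H0 ?; lra.
have mono v (t : R) : U v -> 0 <= t <= 1 -> H (t *: v) <= H v.
  by move=> Uv t01; apply: ray_monotone => // s s01; have [] := HH _ (star v s Uv s01).
have Cpsi v : U v -> cinf psi v.
  move=> Uv; apply: cinfZ; last exact: cinf_id.
  exact: cinfD (cinf_cst _ _) (HC _ Uv).
have inj_le v (t : R) : U v -> 0 <= t <= 1 -> psi v = psi (t *: v) -> v = t *: v.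
  move=> Uv t01; rewrite /psi scalerA => E.
  have [->|v0] := eqVneq v 0; first by rewrite scaler0.
  move: E => /eqP; rewrite -subr_eq0 -scalerBl scaler_eq0 (negbTE v0) orbF subr_eq0 => /eqP E.
  have := mono v t Uv t01; have := H1 v Uv; case/andP: t01 => t0 t1 h1 hm.
  have : (1 - t) * (1 + H v) <= 0 by nra.
  rewrite pmulr_lle0 // subr_le0 => t1'.
  have -> : t = 1 by apply/eqP; rewrite eq_le t1 t1'.
  by rewrite scale1r.
have inj v w : U v -> U w -> psi v = psi w -> v = w.
  move=> Uv Uw E; have hv := H1 v Uv; have hw := H1 w Uw.
  have Ew : w = ((1 + H v) / (1 + H w)) *: v.
    by rewrite mulrC -scalerA -/(psi v) E /psi scalerA mulVf ?scale1r // gt_eqF.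
  have Ev : v = ((1 + H w) / (1 + H v)) *: w.
    by rewrite mulrC -scalerA -/(psi w) -E /psi scalerA mulVf ?scale1r // gt_eqF.
  have [le|/ltW le] := leP (1 + H v) (1 + H w).
    rewrite Ew; apply: inj_le => //; last by rewrite -Ew.
    by rewrite divr_ge0 ?(ltW hv) ?(ltW hw) //= ler_pdivrMr // mul1r.
  symmetry; rewrite [in RHS]Ev; apply: inj_le => //; last by rewrite -Ev.
  by rewrite divr_ge0 ?(ltW hv) ?(ltW hw) //= ler_pdivrMr // mul1r.
have surj w : exists v, U v /\ psi v = w.
  (* [psi] sends [t *: w] to [f t *: w], so a parameter with [f t = 1] is sought. *)
  pose f (t : R) : R := (1 + H (t *: w)) * t.
  pose ray (t : R) : 'rV[R]_n := t *: w.
  have rayc : continuous ray by move=> t; exact: scalel_continuous.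
  pose V := ray @^-1` U.
  have oV : open V by apply: open_comp => // t _; exact: rayc.
  have fc t : V t -> {for t, continuous f}.
    move=> Vt.
    have c0 : {for t, continuous (H \o ray)}.
      by apply: continuous_comp; [exact: rayc|exact: (cinf_cont (HC _ Vt))].
    have c1 : {for t, continuous (fun t => 1 + H (ray t))}.
      exact: (continuousD (@cst_continuous _ _ (1 : R) t) c0).
    have c2 : {for t, continuous (@id R)} by exact: cvg_id.
    exact: (continuousM c1 c2).
  have V0 : V 0 by rewrite /V /ray /= scale0r.
  have HN0 : exists N0, H 0 < N0%:R.
    by exists (Num.truncn (H 0)).+1; exact: truncnS_gt.
  have [N0 HN] := HN0.
  pose V1 := V `&` (H \o ray) @^-1` [set x | x < N0%:R].
  have oV1 : open V1.
    apply: open_setI_preimage; [exact: oV|exact: open_lt|].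
    by move=> t Vt; apply: continuous_comp; [exact: rayc|exact: (cinf_cont (HC _ Vt))].
  have V10 : V1 0 by split=> //=; rewrite /ray scale0r.
  have /nbhs_ballP[t0 /= t0p st0] := open_nbhs_nbhs (conj oV1 V10).
  have [N1 HN1] : exists N1, t0^-1 < N1%:R.
    by exists (Num.truncn t0^-1).+1; exact: truncnS_gt.
  (* For [t < t0] continuity at the origin bounds $H(tw)$ by $N_0$; for [t0 <= t] the condition
     [f t <= 1] gives $H(tw)<1/t\le 1/t_0<N_1$. *)
  pose N := maxn N0 N1.
  have inA t : 0 <= t -> V t -> f t <= 1 -> A N (ray t).
    move=> tp Vt ft; apply: HA => //.
    have [tt|tt] := ltP t t0.
      have /st0[_ /=] : ball 0 t0 t by rewrite -ball_normE /= sub0r normrN ger0_norm.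
      by move=> h; rewrite (lt_le_trans h) // ler_nat leq_maxl.
    have tt0 : 0 < t by exact: lt_le_trans tt.
    have tN : t^-1 < N%:R.
      by rewrite (le_lt_trans _ (lt_le_trans HN1 _)) // ?ler_nat ?leq_maxr // lef_pV2.
    apply: lt_trans tN; rewrite -[ltRHS]mul1r ltr_pdivlMr //.
    by move: ft; rewrite /f -/(ray t); lra.
  (* The parameters with [f t <= 1]. Membership in [A N] keeps the limit inside [U], and the double
     negation makes the set closed although [f] is continuous on [V] only. If [f] were less than 1
     at the maximum of [B], a slightly larger parameter would still lie in [B]. *)
  pose B := `[0, 1] `&` (ray @^-1` A N) `&` ~` (V `&` f @^-1` [set x | 1 < x]).
  have cB : compact B.
    apply: subclosed_compact (@segment_compact R 0 1) _; last by move=> t [[]].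
    apply: closedI; last first.
      apply: open_closedC; apply: open_setI_preimage; [exact: oV|exact: open_gt|exact: fc].
    apply: closedI; first exact: compact_closed (@segment_compact R 0 1).
    by apply: closed_comp => // t _; exact: rayc.
  have B0 : B !=set0.
    exists 0; split; [split|].
    + by rewrite /= in_itv /= lexx ler01.
    + by apply: inA => //; rewrite /f mulr0 ler01.
    + by move=> [_ /=]; rewrite /f mulr0 ltr10.
  have idc : {within B, continuous (@id R)}.
    by apply: continuous_subspaceT => t; exact: cvg_id.
  have [a /set_mem[[a01 Aa] fa] amax] := compact_EVT_max B0 cB idc.
  move: a01; rewrite /= in_itv /= => /andP[a0 a1].
  have Va : V a by exact: AU Aa.
  have fa1 : f a <= 1 by rewrite leNgt; apply/negP => fa1; apply: fa.
  exists (a *: w); split=> //.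
  rewrite /psi scalerA -/(f a).
  suff -> : f a = 1 by rewrite scale1r.
  apply/eqP; rewrite eq_le fa1 /= leNgt; apply/negP => fal.
  have alt : a < 1.
    rewrite ltNge; apply/negP => a1'; have aE : a = 1 by apply/eqP; rewrite eq_le a1 a1'.
    by move: fal; rewrite /f aE mulr1; have := H0 _ Va; rewrite /ray aE; lra.
  have oV2 : open (V `&` f @^-1` [set x | x < 1]).
    by apply: open_setI_preimage; [exact: oV|exact: open_lt|exact: fc].
  have /nbhs_ballP[e /= e0 se] := open_nbhs_nbhs (conj oV2 (conj Va fal)).
  pose b := Num.min 1 (a + e / 2).
  have ab : a < b by rewrite lt_min alt /= ltrDl divr_gt0.
  have bb : ball a e b.
    rewrite -ball_normE /= distrC gtr0_norm ?subr_gt0 //.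
    have : b <= a + e / 2 by rewrite ge_min lexx orbT.
    lra.
  have [Vb fb] := se _ bb; have b0 : 0 <= b by rewrite (le_trans a0) // ltW.
  have /amax : b \in B.
    rewrite inE; split; [split|].
    + by rewrite /= in_itv /= b0 ge_min lexx.
    + by apply: inA => //; exact: ltW.
    + by move=> [_ /=]; rewrite ltNge (ltW fb).
  by rewrite leNgt ab.
pose psi' w := xget 0 [set v | U v /\ psi v = w].
have psiP w : U (psi' w) /\ psi (psi' w) = w.
  have [v Hv] := surj w.
  exact: (@xgetPex _ 0 [set v | U v /\ psi v = w] (ex_intro _ v Hv)).
have psiK v : U v -> psi' (psi v) = v.
  by move=> Uv; have [U' E] := psiP (psi v); exact: inj.
(* A kernel vector [u] satisfies $(1+H)u=-(D_uH)v$, so $u=lv$; then $l(1+H+D_vH)v=0$ with a positive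
   bracket. *)
have uJ v : U v -> Jm psi v \in unitmx.
  move=> Uv; rewrite -row_free_unit; apply: inj_row_free => u.
  have [Ch h0 dh] := HH v Uv.
  rewrite -(derive_Jm _ (cinf_diff (Cpsi _ Uv))).
  have d1 := cinf_diff (cinfD (cinf_cst (1 : R) v) Ch).
  have [_ /(_ u) ->] := diffZf d1 (cinf_diff (cinf_id v)).
  rewrite (deriveD (f := fun=> (1 : R)) (g := H)); [|exact: derivable_cst|exact/diff_derivable/cinf_diff].
  rewrite derive_cst add0r derive_id => /eqP; rewrite addrC addr_eq0 => /eqP E.
  have h1 := H1 v Uv; pose l := - 'D_u H v / (1 + H v).
  have uE : u = l *: v.
    by rewrite /l mulrC -scalerA scaleNr -E scalerA mulVf ?scale1r // gt_eqF.
  have DuE : 'D_u H v = l * 'D_v H v.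
    have dH := cinf_diff Ch.
    by rewrite {1}uE (deriveE (l *: v) dH) linearZ /= -(deriveE v dH).
  have [v00|v0] := eqVneq v 0; first by rewrite uE v00 scaler0.
  move: E; rewrite DuE {1}uE scalerA => /eqP; rewrite -subr_eq0 opprK -scalerDl.
  rewrite scaler_eq0 (negbTE v0) orbF.
  rewrite mulrC -mulrDr mulf_eq0 => /orP[/eqP l0|]; first by rewrite uE l0 scale0r.
  by rewrite gt_eqF // ltr_pwDl.
exists psi, psi'; split; split=> //.
- by rewrite /psi scaler0.
- move=> z; have [Uv vE] := psiP z.
  have [ O [g [oO Ov OU ofO [gK Cg]]]] :=
    inverse_function (Cpsi _ Uv) (uJ _ Uv) (open_nbhs_nbhs (conj oU Uv)).
  have zO : (psi @` O) z by exists (psi' z).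
  apply: cinf_ext (Cg z zO).
  apply: filterS (open_nbhs_nbhs (conj ofO zO)) => _ [y Oy <-].
  by rewrite gK // psiK //; exact: OU.
- by move=> z; have [] := psiP z.
- by move=> z; have [] := psiP z.
Qed.

(** The levels [rk k] increase strictly to [r] from [rk 0 = r / 2]. The bump between two consecutive
    levels vanishes on all lower sublevel sets, so the series of bumps is locally finite, and it
    gains at least 1 at each level passed. *)
Lemma star_diffeo (I : choiceType) (K : set I) (Q : I -> 'rV[R]_n -> R)
    (rho rho' r : R) :
  let U s := [set v | ball 0 rho v /\ forall i, K i -> Q i v < s] in
  0 < rho -> 0 < r -> rho' < rho ->
  (forall i, K i -> forall v, ball 0 rho v -> cinf (Q i) v /\ 0 <= 'D_v (Q i) v) ->
  (forall i, K i -> Q i 0 = 0) ->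
  (forall s, s <= r -> open (U s)) ->
  (forall v, U r v -> `|v| <= rho') ->
  let V := [set v | exists2 s, s < r & U s v] in
  exists psi psi' : 'rV[R]_n -> 'rV[R]_n,
    [/\ psi 0 = 0, forall v, V v -> cinf psi v & forall z, cinf psi' z] /\
    [/\ forall z, V (psi' z), forall v, V v -> psi' (psi v) = v &
        forall z, psi (psi' z) = z].
Proof.
move=> U rho0 r0 rr HQ Q0 oU Urho V.
pose rk k : R := r - r / k.+2%:R.
have rkS k : rk k < rk k.+1.
  by rewrite /rk ltrD2l ltrN2 ltr_pM2l // ltf_pV2 ?posrE ?ltr0n // ltr_nat.
have rkr k : rk k < r by rewrite /rk ltrBlDr ltrDl divr_gt0.
have rk0 k : 0 < rk k.
  by rewrite /rk subr_gt0 ltr_pdivrMr // ltr_pMr // ltr1n.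
have rkcof s : s < r -> exists k, s <= rk k.
  move=> sr; have d0 : 0 < r - s by rewrite subr_gt0.
  exists (Num.truncn (r / (r - s))).+1; rewrite /rk lerBrDr -lerBrDl.
  rewrite ler_pdivrMr // mulrC -ler_pdivrMr // ltW // (lt_trans (truncnS_gt _)) //.
  by rewrite ltr_nat.
have rkle k l : (k <= l)%N -> rk k <= rk l.
  elim: l => [|l IH]; first by rewrite leqn0 => /eqP ->.
  by rewrite leq_eqVlt => /predU1P[->//|]; rewrite ltnS => /IH kl; rewrite (le_trans kl) // ltW.
have Usub s s' v : s <= s' -> U s v -> U s' v.
  by move=> ss [bv H]; split=> // i /H; move/lt_le_trans; exact.
have VE v : V v -> exists k, U (rk k) v.
  by move=> [s /rkcof[k sk] Us]; exists k; exact: Usub Us.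
have UV k v : U (rk k) v -> V v by move=> Uk; exists (rk k).
have exh k := @bump_exhaustion I K Q rho rho' r rr HQ oU _ _ (rkS k) (ltW (rkr k.+1)).
have [h Hh] := choice exh.
(* A level above [v], with default 0 outside [V]. By [SE] every such level truncates the series to
   the same value. *)
pose kf v := xget 0%N [set k | U (rk k) v].
have kfP v : V v -> U (rk (kf v)) v.
  by move=> /VE ex; exact: (@xgetPex _ 0%N [set k | U (rk k) v] ex).
pose S N v : R := \sum_(k < N) h k v.
have hz k l v : U (rk k) v -> (k <= l)%N -> h l v = 0.
  move=> Uk kl; have [_ hz _] := Hh l; apply: hz; exact: Usub (rkle _ _ kl) Uk.
have Sle N M v : U (rk N) v -> (N <= M)%N -> S M v = S N v.
  move=> UN /subnK <-; elim: (M - N)%N => [//|m IH].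
  by rewrite addSn /S big_ord_recr /= -/(S (m + N)%N v) IH (hz N) // ?addr0 // leq_addl.
have SE N M v : U (rk N) v -> U (rk M) v -> S M v = S N v.
  move=> UN UM; have [le|/ltnW le] := leqP N M; first exact: Sle.
  by symmetry; exact: Sle.
pose H v := S (kf v) v.
have HE N v : U (rk N) v -> H v = S N v.
  by move=> UN; apply: SE => //; apply: kfP; exact: UV UN.
have hb k v : ball 0 rho v -> [/\ cinf (h k) v, 0 <= h k v & 0 <= 'D_v (h k) v].
  by have [hb _ _] := Hh k; exact: hb.
have CS N v : ball 0 rho v -> cinf (S N) v /\ 0 <= 'D_v (S N) v.
  move=> bv; elim: N => [|N [CN DN]].
    rewrite (_ : S 0%N = fun=> 0); last by apply/funext => w; rewrite /S big_ord0.
    by split; [exact: cinf_cst|rewrite derive_cst].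
  have -> : S N.+1 = fun w => S N w + h N w.
    by apply/funext => w; rewrite /S big_ord_recr.
  have [Ch h0 dh] := hb N v bv; split; first exact: cinfD.
  rewrite (deriveD (f := S N) (g := h N)); first exact: addr_ge0.
    exact/diff_derivable/cinf_diff.
  exact/diff_derivable/cinf_diff.
(* The closed sublevel set at [rk N], written through complements because [Q i] is known to be
   continuous only on the ball of radius [rho]. *)
pose A N := [set v | `|0 - v| <= rho'] `&` \bigcap_(i in K) ~` (ball 0 rho `&` Q i @^-1` [set x | rk N < x]).
have inb v : `|v| <= rho' -> ball 0 rho v.
  by move=> v'; rewrite -ball_normE /= sub0r normrN (le_lt_trans v').
have oV : open V.
  rewrite (_ : V = \bigcup_(s in [set s | s < r]) U s); last first.
    by apply/seteqP; split => v [s sr Us]; exists s.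
  by apply: bigcup_open => s sr; apply: oU; exact: ltW.
have AV N : A N `<=` V.
  move=> v [/=]; rewrite sub0r normrN => vr vA; exists (rk N.+1) => //.
  split; first exact: inb.
  move=> i Ki; rewrite (le_lt_trans _ (rkS N)) // leNgt; apply/negP => lt.
  by apply: (vA i Ki); split=> //; exact: inb.
apply: (@radial_diffeo V H A) => //.
- by exists (rk 0%N) => //; split=> [|i Ki]; [exact: ballxx|rewrite Q0].
- move=> v t [s sr [bv Uv]] t01; exists s => //.
  have btv (u : R) : 0 <= u <= 1 -> ball 0 rho (u *: v).
    move=> u01; have := ball_convex u01 bv (ballxx (0 : 'rV[R]_n) rho0).
    by rewrite subr0 addr0.
  split=> [|i Ki]; first exact: btv.
  apply: le_lt_trans (Uv i Ki); apply: ray_monotone => // u u01.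
  by apply: HQ => //; exact: btv.
- move=> v Vv; have Uk := kfP v Vv; have bv : ball 0 rho v by case: Uk.
  have [CS1 DS1] := CS (kf v) v bv.
  have HS : \forall w \near v, S (kf v) w = H w.
    apply: filterS (open_nbhs_nbhs (conj (oU _ (ltW (rkr (kf v)))) Uk)) => w Uw.
    by rewrite (HE (kf v)).
  split; first exact: cinf_ext CS1.
    by apply: sumr_ge0 => k _; have [] := hb k v bv.
  by rewrite -(near_eq_derive v HS).
- move=> N; apply: closedI; first exact: compact_closed (@closed_ball_compact _ _ 0 rho').
  apply: closed_bigI => i Ki; apply: open_closedC.
  apply: open_setI_preimage; [exact: ball_open|exact: open_gt|].
  by move=> v bv; exact: cinf_cont (proj1 (HQ _ Ki _ bv)).
- move=> N v Vv HvN.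
  have vr : `|v| <= rho' by apply: Urho; have [s sr] := Vv; apply: Usub; exact: ltW.
  split; first by rewrite /= sub0r normrN.
  move=> i Ki [bv /= Qi].
  (* A point outside [A N] avoids the sublevel sets up to index [N]; the first [N] bumps are then
     all at least 1, so [H v] cannot be below [N]. *)
  have nU k : (k <= N)%N -> ~ U (rk k) v.
    by move=> kN [_ /(_ i Ki)]; rewrite ltNge (le_trans (rkle _ _ kN)) // ltW.
  have Uk := kfP v Vv.
  have Nk : (N < kf v)%N by rewrite ltnNge; apply/negP => /nU.
  have : S N v <= H v.
    rewrite /H; move: Nk => /ltnW /subnK <-; elim: (kf v - N)%N => [//|m IH].
    rewrite addSn (le_trans IH) // /S big_ord_recr /= lerDl.
    by have [] := hb (m + N)%N v bv.
  have : N%:R <= S N v.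
    have -> : N%:R = \sum_(k < N) (1 : R) by rewrite sumr_const card_ord.
    apply: ler_sum => k _; have [_ _ h1] := Hh k; apply: h1 => //; exact: nU.
  by move=> /le_trans le /le; rewrite leNgt HvN.
Qed.

End RadialDiffeo.

(** * Charts, smooth maps and transition functions *)

Section Charts.
Context {R : realType}.

Definition cinv {T : topologicalType} (p0 : T) (c : chart R T) (v : 'rV[R]_(cdim c)) : T :=
  xget p0 [set q | cdom c q /\ c q = v].

Section ChartInverse.
Context {T : topologicalType} (p0 : T) (c : chart R T) (Hc : is_chart c).

Lemma chart_open : open (cdom c). Proof. by case: Hc. Qed.

Lemma chart_inj p q : cdom c p -> cdom c q -> c p = c q -> p = q.
Proof. by case: Hc => _ ci _ _ cp cq; apply: ci; rewrite inE. Qed.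

Lemma chart_cont p : cdom c p -> {for p, continuous c}.
Proof. by case: Hc => _ _ cc _; exact: cc. Qed.

Lemma chart_image_open (O : set T) : open O -> O `<=` cdom c -> open (c @` O).
Proof. by case: Hc => _ _ _; exact. Qed.

Lemma cinvP v : (c @` cdom c) v -> cdom c (cinv p0 v) /\ c (cinv p0 v) = v.
Proof.
move=> [q cq qv].
exact: (@xgetPex _ p0 [set q | cdom c q /\ c q = v] (ex_intro _ q (conj cq qv))).
Qed.

Lemma cinvK q : cdom c q -> cinv p0 (c q) = q.
Proof.
move=> cq; have [|c1 c2] := @cinvP (c q); first by exists q.
exact: chart_inj.
Qed.

Lemma cinv_cont v : (c @` cdom c) v -> {for v, continuous (@cinv T p0 c)}.
Proof.
move=> vi; have [cq qv] := cinvP vi; move=> B /=; rewrite nbhsE /= => -[ O [oO Oq] OB].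
have oI : open (O `&` cdom c) by apply: openI => //; exact: chart_open.
have oi : open (c @` (O `&` cdom c)).
  by apply: chart_image_open => // q [].
have vi' : (c @` (O `&` cdom c)) v by exists (cinv p0 v).
apply: filterS (open_nbhs_nbhs (conj oi vi')) => _ [q [Oq' cq'] <-] /=.
by rewrite cinvK //; exact: OB.
Qed.

Lemma near_chart_dom p : cdom c p -> \forall q \near p, cdom c q.
Proof. by move=> cp; apply: open_nbhs_nbhs; split=> //; exact: chart_open. Qed.

End ChartInverse.

End Charts.

Section SmoothFunctions.
Context {R : realType} {X : manifold R}.
Implicit Types (p q : X).

Lemma smooth_chart_is (c : chart R X) : smooth_chart c -> is_chart c.
Proof. by case. Qed.

(** Smooth charts are compatible with the atlas by definition; an atlas chart at [p] mediates
    between two of them. *)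
Lemma transition (c c' : chart R X) p : smooth_chart c -> smooth_chart c' ->
  cdom c p -> cdom c' p ->
  exists F, cinf F (c p) /\ \forall q \near p, c' q = F (c q).
Proof.
move=> [_ Hc] [_ Hc'] cp c'p; have [a aX ap] := matlas_cover p.
have [[F1 [_ _ _ /smooth_nearE C1 E1]] _] := Hc a aX p cp ap.
have [_ [F2 [_ _ _ /smooth_nearE C2 E2]]] := Hc' a aX p c'p ap.
exists (F2 \o F1); split.
  by apply: cinf_comp => //; rewrite -(nbhs_singleton E1).
by near=> q; rewrite /= -(near E1) ?(near E2).
Unshelve. all: by end_near. Qed.

(* [f] is smooth near [p] as a map into a normed space. *)
Definition smf {W : normedModType R} (f : X -> W) p :=
  exists (c : chart R X) F,
    [/\ smooth_chart c, cdom c p, cinf F (c p) & \forall q \near p, f q = F (c q)].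

Lemma smfP {W : normedModType R} (f : X -> W) (c : chart R X) p : smf f p ->
  smooth_chart c -> cdom c p ->
  exists F, cinf F (c p) /\ \forall q \near p, f q = F (c q).
Proof.
move=> [c' [F [Hc' c'p CF E]]] Hc cp.
have [G [CG EG]] := transition Hc Hc' cp c'p.
exists (F \o G); split.
  by apply: cinf_comp => //; rewrite -(nbhs_singleton EG).
by near=> q; rewrite /= -(near EG) ?(near E).
Unshelve. all: by end_near. Qed.

Lemma smf_cont {W : normedModType R} (f : X -> W) p : smf f p -> {for p, continuous f}.
Proof.
move=> [c [F [Hc cp CF E]]].
have H : {for p, continuous (F \o c)}.
  apply: continuous_comp; last exact: cinf_cont.
  exact: chart_cont (smooth_chart_is Hc) _ cp.
by apply: near_eq_for_continuous H; apply: filterS E => q ->.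
Qed.

Lemma smf_ext {W : normedModType R} (f g : X -> W) p :
  (\forall q \near p, f q = g q) -> smf f p -> smf g p.
Proof.
move=> fg [c [F [Hc cp CF E]]]; exists c, F; split=> //.
by near=> q; rewrite -(near fg) ?(near E).
Unshelve. all: by end_near. Qed.

Lemma smf_chart (c : chart R X) p : smooth_chart c -> cdom c p -> smf c p.
Proof.
by move=> Hc cp; exists c, id; split=> //; [exact: cinf_id|exact: nearW].
Qed.

Lemma smf_comp {W : normedModType R} n (f : X -> 'rV[R]_n) (F : 'rV[R]_n -> W) p :
  smf f p -> cinf F (f p) -> smf (F \o f) p.
Proof.
move=> [c [G [Hc cp CG E]]] CF; exists c, (F \o G); split=> //.
  by apply: cinf_comp => //; rewrite -(nbhs_singleton E).
by near=> q; rewrite /= -(near E).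
Unshelve. all: by end_near. Qed.

Lemma smf_row_mx n n' (f : X -> 'rV[R]_n) (g : X -> 'rV[R]_n') p :
  smf f p -> smf g p -> smf (fun q => row_mx (f q) (g q)) p.
Proof.
move=> [c [F [Hc cp CF E]]] /smfP/(_ Hc cp)[G [CG EG]].
exists c, (fun v => row_mx (F v) (G v)); split=> //; first exact: cinf_row_mx.
by near=> q; rewrite (near E) ?(near EG).
Unshelve. all: by end_near. Qed.

End SmoothFunctions.

Section SmoothMaps.
Context {R : realType} {X Y : manifold R}.

Lemma smooth_at_cont (f : X -> Y) p : smooth_at f p -> {for p, continuous f}.
Proof. by move=> [c [c' [F [_ _ []]]]]. Qed.

Lemma smf_smooth_at {W : normedModType R} (f : X -> Y) (h : Y -> W) p :
  smooth_at f p -> smf h (f p) -> smf (h \o f) p.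
Proof.
move=> [c [c' [F [cX cY [cp c'p fc /smooth_nearE CF E]]]]].
move=> /smfP/(_ (matlas_chart cY) c'p)[G [CG EG]].
exists c, (G \o F); split=> //; first exact: matlas_chart.
  by apply: cinf_comp => //; rewrite -(nbhs_singleton E).
have EG' : \forall q \near p, h (f q) = G (c' (f q)) by exact: fc EG.
by near=> q; rewrite /= -(near E) ?(near EG').
Unshelve. all: by end_near. Qed.

(** Smoothness may be tested in any smooth chart of the target, while [smooth_at] asks for an atlas
    chart. Continuity of [f], part of [smooth_at], is recovered through the inverse of [c]. *)
Lemma smooth_at_chart (f : X -> Y) (c : chart R Y) p : smooth_chart c ->
  (\forall q \near p, cdom c (f q)) -> smf (c \o f) p -> smooth_at f p.
Proof.
move=> Hc fc Cf; have [a aX ap] := matlas_cover p.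
have [a' a'Y a'p] := matlas_cover (f p).
have cfp := nbhs_singleton fc.
have fcont : {for p, continuous f}.
  apply: (@near_eq_for_continuous _ _ (@cinv _ _ (f p) c \o (c \o f))).
    by near=> q; rewrite /= (cinvK _ (smooth_chart_is Hc)) //; near: q.
  have ci : {for c (f p), continuous (@cinv R Y (f p) c)}.
    have im : (c @` cdom c) (c (f p)) by exists (f p).
    exact: (cinv_cont (smooth_chart_is Hc) im).
  by apply: continuous_comp; first exact: smf_cont.
have [F [CF EF]] := smfP Cf (matlas_chart aX) ap.
have [G [CG EG]] := transition Hc (matlas_chart a'Y) cfp a'p.
have EG' : \forall q \near p, a' (f q) = G (c (f q)) by exact: fcont EG.
exists a, a', (G \o F); split=> //; split=> //.
- apply/smooth_nearE/cinf_comp => //.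
  by rewrite -(nbhs_singleton EF).
- by near=> q; rewrite (near EG') //= -(near EF).
Unshelve. all: by end_near. Qed.

Lemma smooth_at_ext (f g : X -> Y) p :
  (\forall q \near p, f q = g q) -> smooth_at f p -> smooth_at g p.
Proof.
move=> fg Cf; have [a aY ap] := matlas_cover (f p).
have fc := smooth_at_cont Cf.
have N : \forall q \near p, cdom a (f q).
  exact: fc (near_chart_dom (smooth_chart_is (matlas_chart aY)) ap).
apply: (smooth_at_chart (matlas_chart aY)).
  by near=> q; rewrite -(near fg) //; near: q.
apply: smf_ext (smf_smooth_at Cf (smf_chart (matlas_chart aY) ap)).
by near=> q; rewrite /= (near fg).
Unshelve. all: by end_near. Qed.

End SmoothMaps.

Section NewChart.
Context {R : realType} {X : manifold R}.

(** Functions with independent differentials, as many as the dimension, are local coordinates. The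
    domain is cut down so that the image is a ball, which later gives convexity. *)
Lemma new_chart k (theta : X -> 'rV[R]_k) (c : chart R X) (F : 'rV[R]_(cdim c) -> 'rV[R]_k)
    (p : X) (N : set X) :
  smooth_chart c -> cdom c p -> cdim c = k -> cinf F (c p) ->
  (\forall q \near p, theta q = F (c q)) ->
  (forall w : 'rV[R]_(cdim c), w *m Jm F (c p) = 0 -> w = 0) -> nbhs p N ->
  exists (D : set X) e,
    [/\ 0 < e, smooth_chart (Chart k D theta), D p, D `<=` N &
        theta @` D = ball (theta p) e].
Proof.
(* The dimension is a field of the chart: opening the record allows [cdim c = k] to be substituted
   in the types, which makes the Jacobian of [F] square. *)
case: c F => m dom cm F /= Hc cp mk; move: F; rewrite {}mk in cm Hc *; move=> F CF EF JF Np.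
pose c := Chart k dom cm.
have Ic : is_chart c by exact: smooth_chart_is Hc.
have cdm : open dom by exact: (chart_open Ic).
have cc q : dom q -> {for q, continuous cm} by exact: (chart_cont Ic).
have uJ : Jm F (cm p) \in unitmx by rewrite -row_free_unit; exact: inj_row_free.
pose N0 := dom `&` interior (N `&` [set q | theta q = F (cm q)]).
have N0p : N0 p.
  split=> //; have NE : nbhs p (N `&` [set q | theta q = F (cm q)]) by exact: filterI.
  exact: NE.
have oN0 : open N0 by apply: openI => //; exact: open_interior.
have N0s q : N0 q -> [/\ dom q, N q & theta q = F (cm q)].
  by move=> [dq /interior_subset[]].
have oN' : open (cm @` N0) by apply: (chart_image_open Ic) => // q [].
have nN' : nbhs (cm p) (cm @` N0 `&` [set v | cinf F v]).
  apply: filterI; last exact: cinf_near.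
  by apply: open_nbhs_nbhs; split=> //; exists p.
have [ O [g [oO Op ON oFO [gK Cg]]]] := inverse_function CF uJ nN'.
have thp : theta p = F (cm p) by case: (N0s p N0p).
have FOp : (F @` O) (theta p) by exists (cm p).
have /nbhs_ballP[e /= e0 eF] := open_nbhs_nbhs (conj oFO FOp).
pose D := (N0 `&` cm @^-1` O) `&` theta @^-1` ball (theta p) e.
have oD1 : open (N0 `&` cm @^-1` O).
  by apply: open_setI_preimage => // q [dq _]; exact: cc.
have D1th q : (N0 `&` cm @^-1` O) q -> {for q, continuous theta}.
  move=> [N0q Oq]; have [dq _ _] := N0s q N0q.
  have H : {for q, continuous (F \o cm)}.
    apply: continuous_comp; first exact: cc.
    by apply: cinf_cont; case: (ON _ Oq).
  apply: near_eq_for_continuous H.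
  apply: filterS (open_nbhs_nbhs (conj oN0 N0q)) => q' /N0s[_ _ ->] //.
have oD : open D by apply: open_setI_preimage => //; exact: ball_open.
have Ds q : D q -> [/\ N0 q, O (cm q), theta q = F (cm q), dom q & cm q = g (theta q)].
  move=> [[N0q Oq] _]; have [dq _ E] := N0s q N0q; split=> //.
  by rewrite E gK.
have Dp : D p by split=> //; exact: ballxx.
have gc v : (F @` O) v -> {for v, continuous g} by move=> /Cg/cinf_cont.
(* Openness of [theta] reduces to that of the old chart map and continuity of the local inverse
   [g]. *)
have thimg (O' : set X) : O' `<=` D -> theta @` O' = (F @` O) `&` g @^-1` (cm @` O').
  move=> O'D; apply/seteqP; split => [_ [q O'q <-]|v [[v' Ov' <-] /= [q O'q]]].
    have [N0q Oq E dq gE] := Ds q (O'D q O'q).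
    by split; [exists (cm q)|exists q].
  have [N0q Oq E dq gE] := Ds q (O'D q O'q).
  by rewrite gK // => E'; exists q => //; rewrite E E'.
have HD : is_chart (Chart k D theta).
  split=> //=.
  - move=> q q' /set_mem Dq /set_mem Dq' E.
    have [_ _ _ dq gE] := Ds q Dq; have [_ _ _ dq' gE'] := Ds q' Dq'.
    by apply: (chart_inj Ic) => //=; rewrite gE gE' E.
  - by move=> q [D1q _]; exact: D1th.
  - move=> O' oO' O'D; rewrite thimg //; apply: open_setI_preimage => //.
    by apply: (chart_image_open Ic) => // q /O'D/Ds[].
have nearE q : D q -> \forall q' \near q, theta q' = F (cm q') /\ cm q' = g (theta q').
  by move=> Dq; apply: filterS (open_nbhs_nbhs (conj oD Dq)) => q' /Ds[].
exists D, e; split=> //.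
- split=> // c' c'X q Dq c'q; have [N0q Oq E dq gE] := Ds q Dq.
  have Hc' := matlas_chart c'X.
  have [T1 [C1 E1]] := transition Hc Hc' dq c'q.
  have [T2 [C2 E2]] := transition Hc' Hc c'q dq.
  split.
  + exists (T1 \o g); split=> //=.
      apply/smooth_nearE/cinf_comp; last by rewrite -gE.
      by apply: Cg; exists (cm q).
    near=> q'; rewrite /= (near E1) //=; congr T1.
    by have [] := near (nearE q Dq) q'.
  + exists (F \o T2); split=> //=.
    * apply/smooth_nearE/cinf_comp => //; rewrite -(nbhs_singleton E2) /=.
      by case: (ON _ Oq).
    * near=> q'; rewrite /= -(near E2) //=.
      by have [] := near (nearE q Dq) q'.
- by move=> q /Ds[/N0s[]].
- apply/seteqP; split=> [_ [q [_ bq] <-] //|v bv].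
  have [v' Ov' v'E] := eF _ bv; have [[q N0q qE] _] := ON _ Ov'.
  have [dq _ E] := N0s q N0q.
  have tq : theta q = v by rewrite E qE.
  by exists q => //; split; [split; rewrite //= qE|rewrite /= tq].
Unshelve. all: by end_near. Qed.

End NewChart.

(** * Submersions in coordinates *)

Section Submersions.
Context {R : realType}.

Lemma near_coord (T : topologicalType) (c : chart R T) (p : T) (P : 'rV[R]_(cdim c) -> Prop) :
  is_chart c -> cdom c p -> (\forall q \near p, P (c q)) -> \forall v \near c p, P v.
Proof.
move=> Hc cp NP.
have H : nbhs p (cdom c `&` [set q | P (c q)]) by apply: filterI => //; exact: near_chart_dom.
have ip : (c @` interior (cdom c `&` [set q | P (c q)])) (c p) by exists p.
have oi : open (c @` interior (cdom c `&` [set q | P (c q)])).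
  by apply: (chart_image_open Hc); [exact: open_interior|move=> q /interior_subset[]].
by apply: filterS (open_nbhs_nbhs (conj oi ip)) => _ [q /interior_subset[_ Pq] <-].
Qed.

Lemma transition_Jm (X : manifold R) (c c' : chart R X) p T T' :
  smooth_chart c -> cdom c p -> cinf T (c p) -> cinf T' (c' p) ->
  (\forall q \near p, c' q = T (c q)) -> (\forall q \near p, c q = T' (c' q)) ->
  Jm T (c p) *m Jm T' (c' p) = 1%:M.
Proof.
move=> Hc cp CT CT' E E'; have Ep := nbhs_singleton E; rewrite Ep in CT' *.
rewrite -(Jm_comp (cinf_diff CT) (cinf_diff CT')) -(Jm_id (c p)).
apply: near_eq_Jm; apply: near_coord => //; first exact: smooth_chart_is.
by near=> q; rewrite /= -(near E) // -(near E').
Unshelve. all: by end_near. Qed.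

Lemma submersion_smooth (X Y : manifold R) (f : X -> Y) p : submersion f -> smooth_at f p.
Proof.
by move=> /(_ p)[c [c' [F [cX cY rep _]]]]; exists c, c', F.
Qed.

(** The definition provides surjectivity in a single pair of charts; the invertible Jacobians of the
    transition maps carry it to all others. *)
Lemma submersion_surj (X Y : manifold R) (f : X -> Y) (a : chart R X) (b : chart R Y) p F :
  submersion f -> smooth_chart a -> smooth_chart b -> cdom a p -> cdom b (f p) ->
  cinf F (a p) -> (\forall q \near p, b (f q) = F (a q)) ->
  forall w : 'rV[R]_(cdim b), exists v : 'rV[R]_(cdim a), v *m Jm F (a p) = w.
Proof.
move=> /(_ p)[c [c' [F1 [cX cY [cp c'p fc /smooth_nearE CF1 E1] surj]]]] Ha Hb ap bp CF E w.
have Hc := matlas_chart cX; have Hc' := matlas_chart cY.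
have [T [CT ET]] := transition Hc' Hb c'p bp.
have [T' [CT' ET']] := transition Hb Hc' bp c'p.
have [S [CS ES]] := transition Hc Ha cp ap.
have TT := transition_Jm Hb bp CT' CT ET' ET.
have F1p := nbhs_singleton E1; have Sp := nbhs_singleton ES.
have ET2 : \forall q \near p, b (f q) = T (c' (f q)) by exact: fc ET.
rewrite F1p in CT TT.
have JE : Jm (T \o F1) (c p) = Jm (F \o S) (c p).
  apply: near_eq_Jm; apply: near_coord => //; first exact: smooth_chart_is.
  by near=> q; rewrite /= -(near E1) // -(near ET2) // (near E) // (near ES).
move: JE; rewrite (Jm_comp (cinf_diff CF1) (cinf_diff CT)).
rewrite Sp in CF *; rewrite (Jm_comp (cinf_diff CS) (cinf_diff CF)) => JE.
have [v vE] := surj (w *m Jm T' (b (f p))).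
have vE' : v *m Jm F1 (c p) = w *m Jm T' (b (f p)).
  exact: etrans (esym (diff_Jm v (cinf_diff CF1))) vE.
exists (v *m Jm S (c p)); rewrite -mulmxA -JE mulmxA vE'.
by rewrite -mulmxA TT mulmx1.
Unshelve. all: by end_near. Qed.

Lemma chart_at (X : manifold R) (p : X) :
  exists (D : set X) (phi : X -> 'rV[R]_(mdim X)) e,
    [/\ 0 < e, smooth_chart (Chart _ D phi), D p, phi p = 0 & phi @` D = ball 0 e].
Proof.
have [a aX ap] := matlas_cover p.
have [F [CF F0 JF]] : exists F : 'rV[R]_(cdim a) -> 'rV[R]_(mdim X),
    [/\ cinf F (a p), F (a p) = 0 & forall w : 'rV[R]_(cdim a), w *m Jm F (a p) = 0 -> w = 0].
  move: (a p); rewrite (matlas_dim aX) => v0; exists (fun v => v - v0).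
  split; rewrite ?subrr //; first by apply: cinfB; [exact: cinf_id|exact: cinf_cst].
  move=> w; rewrite JmB; [|exact: cinf_diff (cinf_id _)|exact: cinf_diff (cinf_cst _ _)].
  by rewrite Jm_id (Jm_eq (M := 0)) ?subr0 ?mulmx1 // => u; rewrite derive_cst mulmx0.
have [|D [e [e0 HD Dp _ im]]] :=
  @new_chart R X _ (F \o a) a F p setT (matlas_chart aX) ap (matlas_dim aX) CF _ JF filterT.
  exact: nearW.
by exists D, (F \o a), e; rewrite -F0.
Qed.

(** [K] completes the linear functions in the columns of [J] to coordinates; it is the transpose of
    a basis of a complement to the row space of the transpose of [J]. *)
Lemma complement_mx N n (J : 'M[R]_(N, n)) :
  (forall w : 'rV[R]_n, exists v : 'rV[R]_N, v *m J = w) ->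
  (n <= N)%N /\ exists K : 'M[R]_(N, N - n),
    forall w : 'rV[R]_N, w *m K = 0 -> w *m J = 0 -> w = 0.
Proof.
move=> surj.
have rJ : \rank J = n.
  apply/eqP; rewrite -/(row_full J) -sub1mx; apply/row_subP => i.
  by have [v <-] := surj (row i 1%:M); exact: submxMl.
have rJT : \rank J^T = n by rewrite mxrank_tr.
have nN : (n <= N)%N by rewrite -{1}rJ rank_leq_row.
split=> //.
have [K HK] : exists K : 'M[R]_(N - n, N), (K :=: (J^T)^C)%MS.
  have : \rank (J^T)^C%MS = (N - n)%N by rewrite mxrank_compl rJT.
  by move=> <-; exists (row_base (J^T)^C)%MS; exact: eq_row_base.
exists K^T => w wK wJ; apply/trmx_inj; rewrite trmx0.
have full : row_full (J^T + (J^T)^C)%MS by exact: addsmx_compl_full.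
have w1 : (1%:M <= col_mx J^T K)%MS.
  by rewrite -addsmxE (adds_eqmx (eqmx_refl _) HK) sub1mx.
have /submxP[L LE] := w1.
have wc : col_mx J^T K *m w^T = 0.
  rewrite mul_col_mx -trmx_mul wJ trmx0.
  by rewrite -[K in K *m _]trmxK -trmx_mul wK trmx0 col_mx0.
by rewrite -[w^T]mul1mx LE -mulmxA wc mulmx0.
Qed.

End Submersions.

(** * Charts of the arrows adapted to the source map *)

Section AdaptedCharts.
Context {R : realType} (G : lie_groupoid R) (x : obj G).
Context (D0 : set (obj G)) (phi0 : obj G -> 'rV[R]_(mdim (obj G))).
Context (Hphi0 : smooth_chart (Chart (mdim (obj G)) D0 phi0)).
Context (D0x : D0 x) (phi0x : phi0 x = 0).

Local Notation n := (mdim (obj G)).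
Local Notation d := (mdim (arr G) - mdim (obj G))%N.

(* A chart of the arrows in which the source map is the projection to the last [n]
   coordinates, so that it is a slice chart for the source fibre of [x]. *)
Definition adapted (D : set (arr G)) (m : arr G -> 'rV[R]_(d + n)) e p :=
  [/\ 0 < e, smooth_chart (Chart (d + n) D m), D p, m p = 0 & m @` D = ball 0 e] /\
  [/\ forall g, D g -> D0 (src g) & forall g, D g -> rsubmx (m g) = phi0 (src g)].

Lemma src_smooth (p : arr G) : smooth_at (src (l:=G)) p.
Proof. apply: submersion_smooth; exact: src_submersion. Qed.

Lemma src_cont (p : arr G) : {for p, continuous (src (l:=G))}.
Proof. exact: smooth_at_cont (src_smooth p). Qed.

Lemma phi0_is : is_chart (Chart n D0 phi0). Proof. exact: smooth_chart_is Hphi0. Qed.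

Lemma phi0_eq0 y : D0 y -> phi0 y = 0 -> y = x.
Proof. by move=> D0y y0; apply: (chart_inj phi0_is) => //=; rewrite phi0x. Qed.

Lemma smf_phi0_src p : D0 (src p) -> smf (fun g : arr G => phi0 (src g)) p.
Proof.
by move=> Dp; exact: (smf_smooth_at (src_smooth p) (smf_chart Hphi0 Dp)).
Qed.

Lemma near_D0_src p : D0 (src p) -> \forall g \near p, D0 (src (l:=G) g).
Proof. by move=> Dp; exact: src_cont (near_chart_dom phi0_is Dp). Qed.

(** [d] is a truncated subtraction; that nothing is truncated follows from the source map being a
    submersion. *)
Lemma dim_arr (p : arr G) : src p = x -> (d + n)%N = mdim (arr G).
Proof.
move=> px; have [c cX cp] := matlas_cover p.
have Dp : D0 (src p) by rewrite px.
have [F [CF EF]] := smfP (smf_phi0_src Dp) (matlas_chart cX) cp.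
have surj := submersion_surj (@src_submersion R G) (matlas_chart cX) Hphi0 cp Dp CF EF.
by have [nN _] := complement_mx surj; rewrite subnK // -(matlas_dim cX).
Qed.

Lemma adapted_exists p N : src p = x -> nbhs p N ->
  exists (D : set (arr G)) m e, adapted D m e p /\ D `<=` N.
Proof.
move=> px Np; have [c cX cp] := matlas_cover p; have Hc := matlas_chart cX.
have Dp : D0 (src p) by rewrite px.
have [F [CF EF]] := smfP (smf_phi0_src Dp) Hc cp.
have surj := submersion_surj (@src_submersion R G) Hc Hphi0 cp Dp CF EF.
have [_ [K HK]] := complement_mx surj.
have cd : cdim c = (d + n)%N by rewrite (matlas_dim cX) (dim_arr px).
have [K' HK'] : exists K' : 'M[R]_(cdim c, d), forall w : 'rV[R]_(cdim c),
    w *m K' = 0 -> w *m Jm F (c p) = 0 -> w = 0.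
  have qE : (cdim c - n)%N = d by rewrite (matlas_dim cX).
  by rewrite -qE; exists K.
(* Fibre coordinates: linear functions in the old chart, complementary to the differential of the
   source map at [p]. *)
pose u v := (v - c p) *m K'.
have Cu v : cinf u v.
  by apply: cinf_mulmx; apply: cinfB; [exact: cinf_id|exact: cinf_cst].
have Ju : Jm u (c p) = K'.
  rewrite (@Jm_mulmx _ _ _ _ (fun v => v - c p)); last exact: cinf_diff (cinfB (cinf_id _) (cinf_cst _ _)).
  rewrite JmB // Jm_id (Jm_eq (M := 0)) ?subr0 ?mul1mx // => w.
  by rewrite derive_cst mulmx0.
pose theta g := row_mx (u (c g)) (phi0 (src g)).
have [||||D [e [e0 HD Dp' DN im]]] := @new_chart R (arr G) _ theta c
  (fun v => row_mx (u v) (F v)) p (N `&` [set g | D0 (src g)]) Hc cp cd.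
- exact: cinf_row_mx.
- by near=> g; rewrite /theta (near EF).
- move=> w; rewrite Jm_row_mx // mul_mx_row Ju => /eqP.
  by rewrite -row_mx0 => /eqP/eq_row_mx[w1 w2]; exact: HK'.
- by apply: filterI => //; exact: near_D0_src.
have th0 : theta p = 0 by rewrite /theta px phi0x /u subrr mul0mx row_mx0.
exists D, theta, e; split; last by move=> g /DN[].
split; first by split=> //; rewrite -th0.
by split=> [g /DN[]//|g Dg]; rewrite row_mxKr.
Unshelve. all: by end_near. Qed.

Section AdaptedFacts.
Context (D : set (arr G)) (m : arr G -> 'rV[R]_(d + n)) (e : R) (p : arr G).
Context (Had : adapted D m e p).

Lemma adapted_chart : smooth_chart (Chart (d + n) D m). Proof. by case: Had => -[]. Qed.

Lemma adapted_is : is_chart (Chart (d + n) D m).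
Proof. exact: smooth_chart_is adapted_chart. Qed.

Lemma adapted_inj g g' : D g -> D g' -> m g = m g' -> g = g'.
Proof. exact: (chart_inj adapted_is). Qed.

Lemma adapted_open : open D. Proof. exact: (chart_open adapted_is). Qed.

Lemma adapted_cont g : D g -> {for g, continuous m}.
Proof. exact: (chart_cont adapted_is). Qed.

Definition minv : 'rV[R]_(d + n) -> arr G := @cinv R (arr G) p (Chart (d + n) D m).

Lemma minvP v : ball 0 e v -> D (minv v) /\ m (minv v) = v.
Proof.
case: Had => -[_ _ _ _ im] _; rewrite -im => Hv.
exact: (@cinvP R (arr G) p (Chart (d + n) D m)).
Qed.

Lemma minvK g : D g -> minv (m g) = g.
Proof. exact: (cinvK p adapted_is). Qed.

Lemma minv_cont v : ball 0 e v -> {for v, continuous minv}.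
Proof.
case: Had => -[_ _ _ _ im] _; rewrite -im => Hv.
exact: (@cinv_cont R (arr G) p (Chart (d + n) D m) adapted_is v Hv).
Qed.

Lemma adapted_ball g : D g -> ball 0 e (m g).
Proof. by case: Had => -[_ _ _ _ <-] _ Dg; exists g. Qed.

Lemma adapted_p : D p /\ m p = 0. Proof. by case: Had => -[]. Qed.

Lemma adapted_D0 g : D g -> D0 (src g). Proof. by case: Had => _ [+ _]; exact. Qed.

Lemma adapted_src g : D g -> rsubmx (m g) = phi0 (src g).
Proof. by case: Had => _ [_]; exact. Qed.

Lemma adapted_fibre g : D g -> rsubmx (m g) = 0 <-> src g = x.
Proof.
move=> Dg; rewrite adapted_src //; split=> [|->//].
by apply: phi0_eq0; exact: adapted_D0.
Qed.

Lemma ball_row0 (v : 'rV[R]_(d + n)) : ball 0 e v -> ball 0 e (row_mx (lsubmx v) (0 : 'rV[R]_n)).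
Proof.
rewrite -ball_normE /= !sub0r !normrN => ve; apply: le_lt_trans ve.
apply: rV_norm_le => // j; rewrite mxE; case: splitP => k jk; last by rewrite mxE normr0.
by rewrite mxE; exact: rV_norm_ge.
Qed.

(** The fibre coordinates may be replaced by any functions that agree with them on the fibre: the
    change of coordinates has a block triangular Jacobian with identity blocks on the diagonal. This
    adapts a chart to the units and, later, to the retraction. *)
Lemma shear (xi : arr G -> 'rV[R]_d) N :
  smf xi p -> xi p = 0 -> (\forall g \near p, src g = x -> xi g = lsubmx (m g)) ->
  nbhs p N ->
  exists D' e', adapted D' (fun g => row_mx (xi g) (phi0 (src g))) e' p /\ D' `<=` N.
Proof.
move=> Cxi xip Exi Np; have [Dp mp0] := adapted_p.
have e0 : 0 < e by case: Had => -[].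
have [E [CE EE]] := smfP Cxi adapted_chart Dp; rewrite /= mp0 in CE EE.
have Cr (v : 'rV[R]_(d + n)) : cinf (fun v : 'rV[R]_(d + n) => rsubmx v : 'rV[R]_n) v.
  by apply: cinf_rsubmx; exact: cinf_id.
pose L (u : 'rV[R]_d) : 'rV[R]_(d + n) := row_mx u 0.
have CL u : cinf L u by apply: cinf_row_mx; [exact: cinf_id|exact: cinf_cst].
have L0 : L 0 = 0 by rewrite /L row_mx0.
have JL : Jm L 0 = row_mx 1%:M 0.
  rewrite /L Jm_row_mx; [|exact: cinf_id|exact: cinf_cst].
  by rewrite Jm_id (Jm_eq (M := 0)) // => w; rewrite derive_cst mulmx0.
have CE0 : cinf E (L 0) by rewrite L0.
have b0 : ball (0 : 'rV[R]_(d + n)) e 0 by exact: ballxx.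
have EL : \forall u \near (0 : 'rV[R]_d), E (L u) = u.
  have Lc := cinf_cont (CL 0).
  have mi : {for L 0, continuous minv} by rewrite L0; exact: minv_cont.
  have mi0 : minv (L 0) = p by rewrite L0 -mp0 minvK.
  have N1 : \forall u \near (0 : 'rV[R]_d), ball 0 e (L u).
    by apply: Lc; rewrite L0; exact: nbhsx_ballx.
  have mLc : {for 0, continuous (minv \o L)} by exact: continuous_comp.
  have N2 : \forall u \near (0 : 'rV[R]_d), src (minv (L u)) = x -> xi (minv (L u)) = lsubmx (m (minv (L u))).
    by apply: (mLc (fun g => src g = x -> xi g = lsubmx (m g))); rewrite /= mi0.
  have N3 : \forall u \near (0 : 'rV[R]_d), xi (minv (L u)) = E (m (minv (L u))).
    by apply: (mLc (fun g => xi g = E (m g))); rewrite /= mi0.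
  near=> u.
  have bu : ball 0 e (L u) by near: u.
  have [Dm mm] := minvP bu.
  have <- : E (m (minv (L u))) = E (L u) by rewrite mm.
  rewrite -(near N3) // (near N2) //; first by rewrite mm row_mxKl.
  by apply/(adapted_fibre Dm); rewrite mm row_mxKr.
have JE : Jm L 0 *m Jm E 0 = 1%:M.
  rewrite -[in Jm E 0]L0 -(Jm_comp (cinf_diff (CL 0)) (cinf_diff CE0)) -(Jm_id (0 : 'rV[R]_d)).
  exact: near_eq_Jm EL.
have DE v : 'D_v (fun v : 'rV[R]_(d + n) => rsubmx v : 'rV[R]_n) 0 = rsubmx v.
  have dr := cinf_diff (Cr 0).
  rewrite (deriveE v dr).
  have := diff_lin (0 : 'rV[R]_(d + n)) (@rV_linear_continuous _ _ _ (@rsubmx R 1 d n)).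
  exact: (congr1 (fun L => L v)).
have [||||D' [e' [e'0 HD' Dp' D'N im]]] := @new_chart R (arr G) _
  (fun g => row_mx (xi g) (phi0 (src g))) (Chart (d + n) D m)
  (fun v => row_mx (E v) (rsubmx v)) p (N `&` [set g | D0 (src g)]) adapted_chart Dp erefl.
- by rewrite /= mp0; apply: cinf_row_mx.
- have ND : \forall g \near p, D g by exact: (near_chart_dom adapted_is Dp).
  by near=> g; rewrite (near EE) //= adapted_src //; near: g.
(* A kernel vector has no base part, hence lies in the slice, where the derivative of [E] is the
   identity. *)
- move=> w; rewrite /= mp0 Jm_row_mx // mul_mx_row => Ew.
  have [w1 w2'] := eq_row_mx (etrans Ew (esym (@row_mx0 R 1 d n))).
  have w2 : rsubmx w = 0.
    exact: etrans (esym (DE w)) (etrans (derive_Jm w (cinf_diff (Cr 0))) w2').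
  have wE : w = L (lsubmx w) by rewrite /L -w2 hsubmxK.
  move: w1; rewrite wE.
  have -> : L (lsubmx w) = lsubmx w *m Jm L 0 by rewrite JL mul_mx_row mulmx1 mulmx0.
  by rewrite -mulmxA JE mulmx1 => ->; rewrite mul0mx.
- by apply: filterI => //; apply: near_D0_src; exact: adapted_D0.
have th0 : row_mx (xi p) (phi0 (src p)) = 0.
  by rewrite xip -adapted_src // mp0 linear0 row_mx0.
exists D', e'; split; last by move=> g /D'N[].
split; first by split=> //; rewrite -th0.
by split=> [g /D'N[]//|g Dg]; rewrite row_mxKr.
Unshelve. all: by end_near. Qed.

End AdaptedFacts.

End AdaptedCharts.

(** * Consequences of properness: compactness of the fibre *)

Section Compactness.
Context {R : realType} (G : lie_groupoid R) (x : obj G).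
Context (D0 : set (obj G)) (phi0 : obj G -> 'rV[R]_(mdim (obj G))).
Context (Hphi0 : smooth_chart (Chart (mdim (obj G)) D0 phi0)).
Context (D0x : D0 x) (phi0x : phi0 x = 0).
Context (hfix : fixed_point x) (hproper : proper_at x).

Local Notation n := (mdim (obj G)).
Local Notation d := (mdim (arr G) - mdim (obj G))%N.

Definition nball e : set (obj G) := [set y | D0 y /\ `|phi0 y| < e].

Lemma fixed_tgt (g : arr G) : src g = x -> tgt g = x.
Proof.
move=> gx; have : (tgt (l:=G) @` (src (l:=G) @^-1` [set x])) (tgt g) by exists g.
by rewrite hfix.
Qed.

Lemma nball_x e : 0 < e -> nball e x.
Proof. by move=> e0; split=> //; rewrite phi0x normr0. Qed.

Lemma nball_open e : open (nball e).
Proof.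
rewrite (_ : nball e = D0 `&` phi0 @^-1` ball 0 e); last first.
  by apply/seteqP; split=> y [D0y]; rewrite /= -ball_normE /= sub0r normrN.
apply: open_setI_preimage; [exact: chart_open (phi0_is Hphi0)|exact: ball_open|].
exact: (chart_cont (phi0_is Hphi0)).
Qed.

Lemma nball_basis (A : set (obj G)) : nbhs x A -> exists2 e, 0 < e & nball e `<=` A.
Proof.
move=> Ax; have Hc := phi0_is Hphi0.
have D0A : nbhs x (D0 `&` A).
  by apply: filterI => //; exact: (near_chart_dom Hc D0x).
have oi : open (phi0 @` interior (D0 `&` A)).
  by apply: (chart_image_open Hc); [exact: open_interior|move=> q /interior_subset[]].
have i0 : (phi0 @` interior (D0 `&` A)) 0 by exists x.
have /nbhs_ballP[e /= e0 eA] := open_nbhs_nbhs (conj oi i0).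
exists e => // y [D0y ye].
have [|q /interior_subset[D0q Aq] qy] := eA (phi0 y).
  by rewrite -ball_normE /= sub0r normrN.
by have <- : q = y by exact: (chart_inj Hc).
Qed.

Lemma incr_ge (i : nat -> nat) : {homo i : a b / (a < b)%N} -> forall k, (k <= i k)%N.
Proof.
move=> Hi; elim=> [//|k IH]; apply: leq_ltn_trans IH _; exact: Hi.
Qed.

(** Properness in the form used throughout: arrows whose two ends tend to [x] accumulate at an arrow
    of $G_x$. *)
Lemma seq_extract (g : nat -> arr G) :
  (forall k, nball k.+1%:R^-1 (src (g k)) /\ nball k.+1%:R^-1 (tgt (g k))) ->
  exists (i : nat -> nat) (h : arr G),
    [/\ {homo i : a b / (a < b)%N}, g (i k) @[k --> \oo] --> h & src h = x].
Proof.
move=> Hg.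
have cv (f : nat -> obj G) : (forall k, nball k.+1%:R^-1 (f k)) -> f k @[k --> \oo] --> x.
  move=> Hf A /nball_basis[e e0 eA]; rewrite nbhs_simpl /=.
  near=> k; apply: eA; have [Dk ke] := Hf k; split=> //; apply: lt_trans ke _.
  near: k; exact: (near_infty_natSinv_lt (PosNum e0)).
have cs : src (g k) @[k --> \oo] --> x by apply: cv => k; case: (Hg k).
have ct : tgt (g k) @[k --> \oo] --> x by apply: cv => k; case: (Hg k).
have ca : anchor (g k) @[k --> \oo] --> (x, x) by exact: cvg_pair.
have [i [h [Hi gh]]] := hproper ca.
exists i, h; split=> //.
have c1 : src (g (i k)) @[k --> \oo] --> src h.
  by apply: (cvg_comp (fun k => g (i k)) (src (l:=G)) gh); exact: src_cont.
have c2 : src (g (i k)) @[k --> \oo] --> x.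
  apply: (cvg_comp i (fun k => src (g k)) _ cs) => A [N _ NA].
  by exists N => // k /= Nk; apply: NA => /=; exact: leq_trans (incr_ge Hi k).
exact: (cvg_unique (@mhausdorff R (obj G)) c1 c2).
Unshelve. all: by end_near. Qed.

Lemma proper_near (N : set (arr G)) : open N -> (forall g, src g = x -> N g) ->
  exists2 e, 0 < e & forall g, nball e (src g) -> nball e (tgt g) -> N g.
Proof.
move=> oN HN; apply: contrapT => H.
have ex k : exists g, [/\ nball k.+1%:R^-1 (src g), nball k.+1%:R^-1 (tgt (l:=G) g) & ~ N g].
  apply: contrapT => Hk; apply: H; exists k.+1%:R^-1; first by rewrite invr_gt0.
  by move=> g sg tg; apply: contrapT => Ng; apply: Hk; exists g.
have [g Hg] := choice ex.
have [|i [h [Hi gh hx]]] := @seq_extract g; first by move=> k; case: (Hg k).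
have [K _ HK] : \forall k \near \oo, N (g (i k)).
  by apply: gh; apply: open_nbhs_nbhs; split=> //; exact: HN.
by have [_ _] := Hg (i K); apply; apply: HK => /=.
Qed.

(** From sequences to covers: second countability reduces the cover to a sequence of sets, and if no
    finite number of them sufficed, fibre points missed by the first [K] sets would accumulate at a
    point missed by all. *)
Lemma fibre_cover (W : arr G -> set (arr G)) :
  (forall p, src p = x -> open (W p) /\ W p p) ->
  exists2 l : seq (arr G), (forall p, p \in l -> src p = x) &
    forall g, src g = x -> exists2 p, p \in l & W p g.
Proof.
move=> HW; have [B /countable_injP[f finj] [Bo Bb]] := @msecond_countable R (arr G).
(* [f] numbers the basic open sets; [c k] picks a centre whose neighbourhood contains the [k]-th
   one, or the unit if there is none. *)
pose P k := [set p : arr G | src p = x /\ exists U, [/\ B U, f U = k & U `<=` W p]].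
pose c k := xget (gunit x) (P k).
have cx k : src (c k) = x.
  by rewrite /c; case: xgetP => [q _ []//|_]; rewrite src_gunit.
pose l K := [seq c k | k <- iota 0 K].
apply: contrapT => H.
have ex K : exists g : arr G, src g = x /\ forall k, (k < K)%N -> ~ W (c k) g.
  apply: contrapT => HK; apply: H; exists (l K).
    by move=> p /mapP[k _ ->].
  move=> g gx; apply: contrapT => Hg; apply: HK; exists g; split=> // k kK Wk.
  by apply: Hg; exists (c k) => //; apply/mapP; exists k; rewrite ?mem_iota.
have [g Hg] := choice ex.
have [|i [h [Hi gh hx]]] := @seq_extract g.
  move=> k; have [gx _] := Hg k; rewrite fixed_tgt // gx.
  by split; apply: nball_x; rewrite invr_gt0.
have [oW Wh] := HW h hx.
have [U [BU Uh] UW] := Bb h (W h) (open_nbhs_nbhs (conj oW Wh)).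
have Ph : P (f U) h by split=> //; exists U.
have [_ [U' [BU' fU' UW']]] : P (f U) (c (f U)).
  exact: (@xgetPex _ (gunit x) (P (f U)) (ex_intro _ h Ph)).
have UE : U' = U by apply: finj => //; rewrite inE.
have [K _ HK] : \forall k \near \oo, U (g (i k)).
  by apply: gh; apply: open_nbhs_nbhs; split=> //; exact: Bo.
pose k := maxn K (f U).+1.
have [_ Hk] := Hg (i k).
apply: (Hk (f U)); last by apply: UW'; rewrite UE; apply: HK => /=; exact: leq_maxl.
by apply: leq_trans (incr_ge Hi k); exact: leq_maxr.
Qed.

(** Eventual statements that are locally uniform along the fibre are uniform on it; the tube lemma
    for the compact $G_x$. *)
Lemma fibre_near (I : Type) (F : set_system I) (P : I -> arr G -> Prop) : Filter F ->
  (forall p, src p = x -> exists W, [/\ open W, W p &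
     \forall i \near F, forall g, W g -> src g = x -> P i g]) ->
  \forall i \near F, forall g, src g = x -> P i g.
Proof.
move=> FF H.
have ex p : exists W : set (arr G), src p = x -> [/\ open W, W p &
     \forall i \near F, forall g, W g -> src g = x -> P i g].
  have [px|px] := pselect (src p = x); last by exists setT.
  by have [W HW] := H p px; exists W.
have [W HW] := choice ex.
have [|l lx lW] := @fibre_cover W; first by move=> p /HW[].
have : \forall i \near F, forall p, p \in l -> forall g, W p g -> src g = x -> P i g.
  elim: l lx {lW} => [|p l IH] lx; first by apply: nearW => i p; rewrite in_nil.
  have [_ _ Hp] := HW p (lx p (mem_head _ _)).
  have IH' := IH (fun q ql => lx q (mem_behead (s := p :: l) ql)).
  near=> i => q; rewrite inE => /orP[/eqP ->|ql]; first by near: i.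
  by move: q ql; near: i.
apply: filterS => i Hi g gx; have [p pl Wg] := lW g gx; exact: Hi pl g Wg gx.
Unshelve. all: by end_near. Qed.

End Compactness.

(** * A smooth retraction of a neighbourhood of $G_x$ onto $G_x$ *)

Section Retraction.
Context {R : realType} (G : lie_groupoid R) (x : obj G).
Context (D0 : set (obj G)) (phi0 : obj G -> 'rV[R]_(mdim (obj G))).
Context (Hphi0 : smooth_chart (Chart (mdim (obj G)) D0 phi0)).
Context (D0x : D0 x) (phi0x : phi0 x = 0).
Context (hfix : fixed_point x) (hproper : proper_at x).

Local Notation n := (mdim (obj G)).
Local Notation d := (mdim (arr G) - mdim (obj G))%N.
Local Notation adapted := (@adapted R G D0 phi0).

(* A smooth retraction of the open set [O] onto its intersection with the source fibre. *)
Definition retr (O : set (arr G)) (pi : arr G -> arr G) :=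
  open O /\ forall g, O g ->
    [/\ src (pi g) = x, smooth_at pi g & src g = x -> pi g = g].

Section Glue.
Context (D : set (arr G)) (m : arr G -> 'rV[R]_(d + n)) (e : R) (p : arr G).
Context (Had : adapted D m e p).

Let e0 : 0 < e. Proof. by case: Had => -[]. Qed.
(** [sqn] dominates the square of the maximum norm, so both sublevel sets lie well inside the chart
    image, the ball of radius [e]. *)
Let a := (e / 2) ^+ 2.
Let b := (e / 3) ^+ 2.

Let b0 : 0 < b. Proof. by rewrite exprn_gt0 // divr_gt0. Qed.

Let ba : b < a.
Proof. by rewrite /a /b ltr_pXn2r // ?nnegrE ?divr_ge0 ?(ltW e0) //; have := e0; lra. Qed.

Definition core := [set g | D g /\ sqn (m g) < (e / 3) ^+ 2].

Let S := [set g | D g /\ sqn (m g) <= a].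

Let sqn_c (v : 'rV[R]_(d + n)) : {for v, continuous (@sqn R (d + n))}.
Proof. by apply: cinf_cont; apply: cinf_sqn; exact: cinf_id. Qed.

Lemma core_open : open core.
Proof.
rewrite (_ : core = D `&` (@sqn R (d + n) \o m) @^-1` [set t | t < b]) //.
apply: open_setI_preimage; [exact: adapted_open Had|exact: open_lt|].
move=> g Dg; apply: continuous_comp; first exact: (adapted_cont Had).
exact: sqn_c.
Qed.

Lemma core_p : core p.
Proof. by have [Dp mp] := adapted_p Had; split=> //; rewrite mp sqn0. Qed.

(** [S] contains the support of the cutoff. It is closed among all arrows, not merely in the chart,
    because it is a compact subset of a Hausdorff space; so the old retraction can be kept on the
    open complement. *)
Let S_closed : closed S.
Proof.
apply: compact_closed; first exact: mhausdorff.
pose C := [set v : 'rV[R]_(d + n) | `|0 - v| <= e / 2] `&` [set v | sqn v <= a].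
have Cb v : C v -> ball 0 e v.
  by move=> [+ _]; rewrite -ball_normE /= => /le_lt_trans; apply; have := e0; lra.
have cC : compact C.
  apply: subclosed_compact (@closed_ball_compact R (d + n) 0 (e / 2)) _; last by move=> v [].
  apply: closedI; first exact: compact_closed (@closed_ball_compact _ _ 0 (e / 2)).
  rewrite (_ : [set v | _] = @sqn R (d + n) @^-1` [set t | t <= a]) //.
  by apply: closed_comp => [v _|]; [exact: sqn_c|exact: closed_le].
have -> : S = minv D m p @` C.
  apply/seteqP; split=> [g [Dg ga]|_ [v Cv <-]].
    exists (m g); last by rewrite (minvK Had).
    split=> //=; rewrite sub0r normrN -(@ler_pXn2r _ 2) ?nnegrE ?divr_ge0 ?(ltW e0) //.
    by rewrite (le_trans (norm_sqn_ge _)).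
  have [Dv mv] := minvP Had (Cb v Cv).
  by split=> //; rewrite mv; case: Cv.
apply: continuous_compact => //; apply: continuous_in_subspaceT => v /set_mem Cv.
exact: (minv_cont Had (Cb v Cv)).
Qed.

(** The two halves of [z] stand for [m (pi g)] and [m g]. Averaging retractions makes sense here
    because the fibre is a flat slice of a convex ball in the chart. *)
Let interp (z : 'rV[R]_((d + n) + (d + n))) : 'rV[R]_(d + n) :=
  row_mx (cutoff b a (rsubmx z) *: (lsubmx (rsubmx z) - lsubmx (lsubmx z))
          + lsubmx (lsubmx z)) 0.

Let cinf_interp z : cinf interp z.
Proof.
have Cl : cinf (fun z : 'rV[R]_((d + n) + (d + n)) => lsubmx z) z.
  by apply: cinf_lsubmx; exact: cinf_id.
have Cr : cinf (fun z : 'rV[R]_((d + n) + (d + n)) => rsubmx z) z.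
  by apply: cinf_rsubmx; exact: cinf_id.
apply: cinf_row_mx; last exact: cinf_cst.
apply: cinfD; last exact: cinf_lsubmx.
apply: cinfZ; first exact: cinf_cutoff.
by apply: cinfB; exact: cinf_lsubmx.
Qed.

Let glue (pi : arr G -> arr G) g :=
  if `[< S g >] then minv D m p (interp (row_mx (m (pi g)) (m g))) else pi g.

Let interpE (u v : 'rV[R]_(d + n)) : interp (row_mx u v) =
  row_mx (cutoff b a v *: (lsubmx v - lsubmx u) + lsubmx u) 0.
Proof. by rewrite /interp row_mxKl row_mxKr. Qed.

Let interp_core (u v : 'rV[R]_(d + n)) : sqn v <= b ->
  interp (row_mx u v) = row_mx (lsubmx v) 0.
Proof. by move=> vb; rewrite interpE cutoff1 // scale1r subrK. Qed.

Let interp_out (u v : 'rV[R]_(d + n)) : a <= sqn v ->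
  interp (row_mx u v) = row_mx (lsubmx u) 0.
Proof. by move=> vb; rewrite interpE cutoff0 // scale0r add0r. Qed.

Let interp_eq (v : 'rV[R]_(d + n)) : interp (row_mx v v) = row_mx (lsubmx v) 0.
Proof. by rewrite interpE subrr scaler0 add0r. Qed.

Let interp_ball (u v : 'rV[R]_(d + n)) : ball 0 e u -> ball 0 e v ->
  ball 0 e (interp (row_mx u v)).
Proof.
move=> /ball_row0 ub /ball_row0 vb.
have := ball_convex (cutoff01 v ba) vb ub.
by rewrite interpE opp_row_mx add_row_mx scale_row_mx add_row_mx subr0 scaler0 addr0.
Qed.

Let fibreE g : D g -> src g = x -> row_mx (lsubmx (m g)) 0 = m g.
Proof.
move=> Dg /(adapted_fibre Hphi0 D0x phi0x Had Dg) r0.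
by rewrite -[RHS]hsubmxK r0.
Qed.

Let src_minv (u : 'rV[R]_d) : ball 0 e (row_mx u (0 : 'rV[R]_n)) ->
  src (minv D m p (row_mx u 0)) = x.
Proof.
move=> /(minvP Had)[Dv mv].
by apply/(adapted_fibre Hphi0 D0x phi0x Had Dv); rewrite mv row_mxKr.
Qed.

Lemma core_S g : core g -> S g.
Proof. by move=> [Dg gb]; split=> //; apply: ltW; exact: lt_trans gb ba. Qed.

(** The new domain has three open pieces: the core, where only the chart projection counts; [O] off
    [S], where [pi] is kept; and [O3], where [g] and [pi g] both lie in the chart and are
    interpolated. A fibre point of [O] lying in [S] belongs to [O3], as [pi] fixes it. *)
Lemma retr_glue (O : set (arr G)) (pi : arr G -> arr G) : retr O pi ->
  exists O' pi', [/\ retr O' pi', forall g, O g -> src g = x -> O' g &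
    forall g, core g -> O' g /\ pi' g = minv D m p (row_mx (lsubmx (m g)) 0)].
Proof.
move=> [oO HO].
have pic g : O g -> {for g, continuous pi}.
  by move=> /HO[_ /smooth_at_cont].
have oD : open D by exact: adapted_open Had.
pose O3 := (O `&` pi @^-1` D) `&` D.
have oO3 : open O3 by apply: openI => //; exact: open_setI_preimage.
have coreE g : core g -> glue pi g = minv D m p (row_mx (lsubmx (m g)) 0).
  move=> cg; rewrite /glue asboolT; last exact: core_S.
  by rewrite interp_core //; case: cg => _ /ltW.
(* Off [S] the cutoff vanishes and interpolation returns [pi g], so one smooth formula holds on all
   of [O3]. *)
have O3E g : O3 g -> glue pi g = minv D m p (interp (row_mx (m (pi g)) (m g))).
  move=> [[Og Dpg] Dg]; rewrite /glue; case: asboolP => // nS.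
  have [spi _ _] := HO g Og.
  rewrite interp_out; last by rewrite leNgt; apply/negP => lt; apply: nS; split=> //; exact: ltW.
  by rewrite fibreE // (minvK Had).
have O3b g : O3 g -> ball 0 e (interp (row_mx (m (pi g)) (m g))).
  by move=> [[Og Dpg] Dg]; apply: interp_ball; exact: adapted_ball Had _ _.
have coreb g : core g -> ball 0 e (row_mx (lsubmx (m g)) (0 : 'rV[R]_n)).
  by move=> [Dg _]; apply: ball_row0; exact: adapted_ball Had _ _.
exists (core `|` (O `&` ~` S) `|` O3), (glue pi); split.
- split.
    apply: openU => //; apply: openU; first exact: core_open.
    by apply: openI => //; exact/closed_openC/S_closed.
  move=> g [[cg|[Og nSg]]|O3g].
  + have [Dg _] := cg; split.
    * by rewrite coreE // src_minv //; exact: coreb.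
    * have nc : \forall g' \near g, core g' by apply: open_nbhs_nbhs; split=> //; exact: core_open.
      apply: (smooth_at_chart (adapted_chart Had)).
        apply: filterS nc => g' cg' /=; rewrite coreE //.
        by have [] := minvP Had (coreb _ cg').
      apply: (@smf_ext _ _ _ (fun g' => row_mx (lsubmx (m g')) 0)).
        apply: filterS nc => g' cg' /=; rewrite coreE //.
        by have [_ ->] := minvP Had (coreb _ cg').
      apply: (smf_comp (F := fun v : 'rV[R]_(d + n) => row_mx (lsubmx v) 0 : 'rV[R]_(d + n))
        (smf_chart (adapted_chart Had) Dg)).
      by apply: cinf_row_mx; [apply: cinf_lsubmx; exact: cinf_id|exact: cinf_cst].
    * by move=> sg; rewrite coreE // fibreE // (minvK Had).
  + have [s1 s2 s3] := HO g Og.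
    have gE g' : ~ S g' -> glue pi g' = pi g' by move=> nS; rewrite /glue asboolF.
    split; [by rewrite gE| |by rewrite gE].
    apply: smooth_at_ext s2.
    have oS : open (~` S) by exact: closed_openC.
    by apply: filterS (open_nbhs_nbhs (conj oS nSg)) => g' /gE.
  + have [[Og Dpg] Dg] := O3g; have [s1 s2 s3] := HO g Og; split.
    * by rewrite O3E // interpE src_minv // -interpE; exact: O3b.
    * have nO3 : \forall g' \near g, O3 g' by apply: open_nbhs_nbhs; split.
      apply: (smooth_at_chart (adapted_chart Had)).
        apply: filterS nO3 => g' O3g' /=; rewrite O3E //.
        by have [] := minvP Had (O3b _ O3g').
      apply: (@smf_ext _ _ _ (fun g' => interp (row_mx (m (pi g')) (m g')))).
        apply: filterS nO3 => g' O3g' /=; rewrite O3E //.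
        by have [_ ->] := minvP Had (O3b _ O3g').
      have C1 := smf_smooth_at s2 (smf_chart (adapted_chart Had) Dpg).
      have C2 := smf_chart (adapted_chart Had) Dg.
      exact: (smf_comp (smf_row_mx C1 C2) (cinf_interp _)).
    * by move=> sg; rewrite O3E // s3 // interp_eq fibreE // (minvK Had).
- move=> g Og sg; have [Sg|nS] := pselect (S g); last by left; right.
  have [Dg _] := Sg; right; split=> //; split=> //=.
  by have [_ _ ->] := HO g Og.
- by move=> g cg; split; [left; left|exact: coreE].
Qed.

End Glue.

Lemma gunit_fibre : src (gunit (l:=G) x) = x. Proof. exact: src_gunit. Qed.

(** Subtracting the fibre coordinates of the unit at the source flattens the units; on the fibre of
    [x] nothing changes, since $1_x$ has coordinates zero. *)
Lemma unit_adapted : exists D m e, adapted D m e (gunit x) /\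
  forall y, D (gunit y) -> lsubmx (m (gunit y)) = 0.
Proof.
have [D [m [e [Had _]]]] := adapted_exists Hphi0 D0x phi0x gunit_fibre filterT.
have [D1 m1] := adapted_p Had.
pose u g := lsubmx (m (gunit (src g))).
have su : smooth_at (fun g : arr G => gunit (src g)) (gunit x).
  have [a aM ax] := matlas_cover (gunit (l:=G) x).
  apply: (smooth_at_chart (matlas_chart aM)).
    have gc : {for gunit x, continuous (gunit (l:=G) \o src (l:=G))}.
      apply: continuous_comp; first exact: src_cont.
      exact: (smooth_at_cont (@gunit_smooth R G _)).
    by apply: gc; rewrite /= src_gunit; exact: (near_chart_dom (smooth_chart_is (matlas_chart aM))).
  have C1 : smf (a \o gunit (l:=G)) x.
    exact: (smf_smooth_at (@gunit_smooth R G x) (smf_chart (matlas_chart aM) ax)).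
  by apply: (smf_smooth_at (h := a \o gunit (l:=G)) (@src_smooth R G _)); rewrite src_gunit.
have Cm : smf (fun g => m (gunit (src g))) (gunit x).
  apply: (smf_smooth_at su); rewrite src_gunit.
  exact: (smf_chart (adapted_chart Had) D1).
pose xi g := lsubmx (m g) - u g.
have Cxi : smf xi (gunit x).
  have C := smf_row_mx (smf_chart (adapted_chart Had) D1) Cm.
  pose F (z : 'rV[R]_((d + n) + (d + n))) : 'rV[R]_d := lsubmx (lsubmx z) - lsubmx (rsubmx z).
  have CF z : cinf F z.
    by apply: cinfB; apply: cinf_lsubmx; [apply: cinf_lsubmx|apply: cinf_rsubmx]; exact: cinf_id.
  apply: smf_ext (smf_comp C (CF _)); apply: nearW => g.
  by rewrite /= /F row_mxKl row_mxKr.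
have [|||D' [e' [Had' _]]] := @shear R G x D0 phi0 Hphi0 D0x phi0x D m e (gunit x) Had xi setT Cxi.
- by rewrite /xi /u src_gunit subrr.
- by apply: nearW => g gx; rewrite /xi /u gx m1 linear0 subr0.
- exact: filterT.
exists D', (fun g => row_mx (xi g) (phi0 (src g))), e'; split=> // y _.
by rewrite row_mxKl /xi /u src_gunit subrr.
Qed.

Lemma retraction_exists : exists O pi,
  [/\ retr O pi, forall g, src g = x -> O g & \forall y \near x, pi (gunit y) = gunit x].
Proof.
have ex p : exists Dme : set (arr G) * (arr G -> 'rV[R]_(d + n)) * R,
    src p = x -> adapted Dme.1.1 Dme.1.2 Dme.2 p.
  have [px|px] := pselect (src p = x); last by exists (setT, (fun=> 0), 0).
  have [D [m [e [Had _]]]] := adapted_exists Hphi0 D0x phi0x px filterT.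
  by exists (D, m, e).
have [ch Hch] := choice ex.
pose W p := core (ch p).1.1 (ch p).1.2 (ch p).2.
have [|l lx lW] := @fibre_cover R G x D0 phi0 Hphi0 D0x phi0x hfix hproper W.
  by move=> p px; split; [exact: core_open (Hch p px)|exact: core_p (Hch p px)].
have [ O [pi [HO lO]]] : exists O pi, retr O pi /\
    forall g p, src g = x -> p \in l -> W p g -> O g.
  elim: l lx {lW} => [|p l IH] lx.
    (* The empty domain is vacuously retracted, so gluing can start from nothing. *)
    by exists set0, id; split; [split=> //; exact: open0|move=> g p _; rewrite in_nil].
  have [| O [pi [HO lO]]] := IH; first by move=> q ql; apply: lx; rewrite inE ql orbT.
  have [ O' [pi' [HO' OO' cO']]] := retr_glue (Hch p (lx p (mem_head _ _))) HO.
  exists O', pi'; split=> // g q gx; rewrite inE => /orP[/eqP -> Wg|ql Wq].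
    by have [] := cO' g Wg.
  by apply: OO' => //; exact: lO gx ql Wq.
have FO g : src g = x -> O g by move=> gx; have [p pl Wg] := lW g gx; exact: lO gx pl Wg.
(* The order matters: only on the core of the chart glued last is the value of the retraction known
   explicitly. *)
have [D [m [e [Had Hm]]]] := unit_adapted.
have [ O' [pi' [HO' OO' cO']]] := retr_glue Had HO.
exists O', pi'; split=> //; first by move=> g gx; apply: OO' => //; exact: FO.
have uc : {for x, continuous (gunit (l:=G))} by exact: (smooth_at_cont (@gunit_smooth R G x)).
have nc : \forall y \near x, core D m e (gunit y).
  by apply: uc; apply: open_nbhs_nbhs; split; [exact: core_open Had|exact: core_p Had].
apply: filterS nc => y cy; have [_ ->] := cO' _ cy.
have [Du m1] := adapted_p Had; rewrite Hm; last by case: cy.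
by rewrite row_mx0 -m1 (minvK Had).
Qed.

End Retraction.

(** * Monotonicity of $|T|^2$ along rays *)

Section RadialPositivity.
Context {R : realType}.

Lemma derive_sqn m n (f : 'rV[R]_m -> 'rV[R]_n) v u : cinf f v ->
  'D_u (fun w => sqn (f w)) v = 2 * \sum_j f v 0 j * ('D_u f v) 0 j.
Proof.
move=> Cf; have df := diff_derivable (v := u) (cinf_diff Cf).
have dj j : derivable (fun w => f w 0 j : R) v u.
  by have /derivable_mxP := df; exact.
have E j : ('D_u f v) 0 j = 'D_u (fun w => f w 0 j : R) v by rewrite (derive_mx df) mxE.
have -> : (fun w => sqn (f w)) = \sum_j (fun w => f w 0 j * f w 0 j).
  by apply/funext => w; rewrite /sqn fct_sumE.
rewrite derive_sum; last by move=> j; exact: derivableM.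
rewrite mulr_sumr; apply: eq_bigr => j _.
rewrite (deriveM (f := fun w => f w 0 j : R) (g := fun w => f w 0 j : R)) // E.
by rewrite /GRing.scale /=; ring.
Qed.

Lemma norm_row0 m n (v : 'rV[R]_n) : `|row_mx (0 : 'rV[R]_m) v| <= `|v|.
Proof.
apply: rV_norm_le => // j; rewrite mxE; case: splitP => k _; last exact: rV_norm_ge.
by rewrite mxE normr0.
Qed.

Lemma norm_row_mx_lt m n (u : 'rV[R]_m) (v : 'rV[R]_n) e :
  `|u| < e -> `|v| < e -> `|row_mx u v| < e.
Proof.
move=> ue ve; have e0 : 0 < e by exact: le_lt_trans ue.
pose b := Num.max `|u| `|v|.
apply: (@le_lt_trans _ _ b); last by rewrite gt_max ue.
apply: rV_norm_le => [|j]; first by rewrite le_max normr_ge0.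
rewrite mxE; case: splitP => k _; rewrite le_max (rV_norm_ge _ k) ?orbT //.
Qed.

(* Polarisation: [4 <a, b> = |a + b|^2 - |a - b|^2], where [a] and [b] are both close to
   the same vector. *)
Lemma inner_ge0 n (a b c : 'rV[R]_n) (t : R) : 0 <= t ->
  `|a - c| <= t -> `|b - c| <= t -> n.+1%:R * t <= `|c| ->
  0 <= \sum_j a 0 j * b 0 j.
Proof.
move=> t0 ac bc tc.
have pol : 4 * (\sum_j a 0 j * b 0 j) = sqn (a + b) - sqn (a - b).
  rewrite /sqn mulr_sumr -sumrB; apply: eq_bigr => j _; rewrite !mxE; ring.
have h1 : `|a - b| <= 2 * t.
  have -> : a - b = (a - c) - (b - c) by rewrite opprB addrA subrK.
  by rewrite (le_trans (ler_normB _ _)) //; lra.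
have h2 : 2 * n%:R * t <= `|a + b|.
  have E : c *+ 2 = (a + b) - ((a - c) + (b - c)).
    by apply/rowP => j; rewrite !mxE; ring.
  have : `|c *+ 2| <= `|a + b| + (t + t).
    rewrite E (le_trans (ler_normB _ _)) // lerD2l (le_trans (ler_normD _ _)) // lerD //.
  rewrite normrMn mulr2n; move: tc; rewrite -natr1; move: (n%:R : R) => N; nra.
have h3 : sqn (a - b) <= sqn (a + b).
  apply: le_trans (sqn_le _) (le_trans _ (norm_sqn_ge _)).
  have N1 : (n%:R : R) <= n%:R ^+ 2.
    by rewrite -natrX ler_nat; case: (n) => // k; rewrite expnS expn1 leq_pmulr.
  have h2' : (2 * n%:R * t) ^+ 2 <= `|a + b| ^+ 2.
    by rewrite ler_pXn2r ?nnegrE // ?mulr_ge0 // ?ler0n.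
  have h1' : `|a - b| ^+ 2 <= (2 * t) ^+ 2.
    by rewrite ler_pXn2r ?nnegrE // ?mulr_ge0.
  apply: le_trans h2'; apply: le_trans (ler_wpM2l (ler0n _ n) h1') _.
  have : 0 <= (2 * t) ^+ 2 by rewrite sqr_ge0.
  have -> : (2 * n%:R * t) ^+ 2 = n%:R ^+ 2 * (2 * t) ^+ 2 by ring.
  by move=> tt; rewrite ler_wpM2r.
have : 0 <= 4 * (\sum_j a 0 j * b 0 j) by rewrite pol subr_ge0.
by rewrite pmulr_rge0.
Qed.

(** [T] models the target map. With $v$ the last $n$ coordinates of $z$ and $A$ the invertible
    transverse derivative at 0, both $T(z)$ and the derivative of $T$ along $(0,v)$ are close to
    $vA$, relative to $|v|$; their inner product is half the derivative of $|T|^2$. The estimate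
    holds in a full ball, hence for all nearby fibre points at once. *)
Lemma radial_positive d n (T : 'rV[R]_(d + n) -> 'rV[R]_n) :
  cinf T 0 -> (\forall u \near (0 : 'rV[R]_d), T (row_mx u 0) = 0) ->
  (forall w : 'rV[R]_n, exists v, v *m Jm T 0 = w) ->
  exists2 r, 0 < r & forall z, ball 0 r z ->
    0 <= 'D_(row_mx 0 (rsubmx z)) (fun y => sqn (T y)) z.
Proof.
move=> CT T0 surj; pose J := Jm T 0.
pose L (u : 'rV[R]_d) : 'rV[R]_(d + n) := row_mx u 0.
have CL u : cinf L u by apply: cinf_row_mx; [exact: cinf_id|exact: cinf_cst].
have L0 : L 0 = 0 by rewrite /L row_mx0.
have JL : Jm L 0 = row_mx 1%:M 0.
  rewrite /L Jm_row_mx; [|exact: cinf_id|exact: cinf_cst].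
  by rewrite Jm_id (Jm_eq (M := 0)) // => w; rewrite derive_cst mulmx0.
have uJ : usubmx J = 0.
  have : Jm L 0 *m Jm T (L 0) = 0.
    rewrite -(Jm_comp (cinf_diff (CL 0))); last by apply: cinf_diff; rewrite L0.
    rewrite (@near_eq_Jm _ _ _ _ (fun=> 0)) //.
    by apply: Jm_eq => w; rewrite derive_cst mulmx0.
  by rewrite L0 -/J JL -[J]vsubmxK mul_row_col mul1mx mul0mx addr0 vsubmxK.
pose A := dsubmx J.
have JE (z : 'rV[R]_(d + n)) : z *m J = rsubmx z *m A.
  by rewrite -[z in LHS]hsubmxK -[J]vsubmxK mul_row_col uJ mulmx0 add0r.
have uA : A \in unitmx.
  rewrite -row_full_unit -sub1mx; apply/row_subP => i.
  by have [v] := surj (row i 1%:M); rewrite JE => <-; exact: submxMl.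
have [C C0 HC] := mulmx_bound (invmx A).
(* Since $|vA|\ge |v|/C$, the error [eta * |v|] is at most $|vA|/(n+1)$, as [inner_ge0] requires. *)
pose eta := C^-1 / n.+1%:R.
have eta0 : 0 < eta by rewrite divr_gt0 // invr_gt0.
have nT0 : \forall z \near (0 : 'rV[R]_(d + n)), T (row_mx (lsubmx z) 0) = 0.
  have lc : {for (0 : 'rV[R]_(d + n)), continuous (@lsubmx R 1 d n)}.
    by apply: (cinf_cont (f := fun z => lsubmx z)); apply: cinf_lsubmx; exact: cinf_id.
  by apply: (lc (fun u => T (row_mx u 0) = 0)); rewrite linear0.
have [r r0 Hr] : exists2 r, 0 < r & forall z, ball (0 : 'rV[R]_(d + n)) r z ->
    [/\ cinf T z, T (row_mx (lsubmx z) 0) = 0 &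
        forall w : 'rV[R]_(d + n), `|w *m (Jm T z - J)| <= eta * `|w|].
  have H1 := Jm_close CT eta0; have H2 := cinf_near CT.
  have /nbhs_ballP[r r0 sr] : nbhs (0 : 'rV[R]_(d + n)) [set z | [/\ cinf T z, T (row_mx (lsubmx z) 0) = 0 &
        forall w : 'rV[R]_(d + n), `|w *m (Jm T z - J)| <= eta * `|w|]].
    by near=> z; split; near: z.
  by exists r.
exists r => // z bz; have [CTz T0z Hz] := Hr z bz.
pose v := rsubmx z; pose V : 'rV[R]_(d + n) := row_mx 0 v.
pose z0 : 'rV[R]_(d + n) := row_mx (lsubmx z) 0.
have zV : z - z0 = V.
  by rewrite -[z in LHS]hsubmxK opp_row_mx add_row_mx subrr subr0.
have bz0 : ball (0 : 'rV[R]_(d + n)) r z0.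
  move: bz; rewrite -ball_normE /= !sub0r !normrN; apply: le_lt_trans.
  apply: rV_norm_le => // j; rewrite mxE; case: splitP => k _; last by rewrite mxE normr0.
  by rewrite mxE; exact: rV_norm_ge.
(* The mean value inequality is applied between [z] and its projection [z0] to the slice, where [T]
   vanishes; this makes the error proportional to $|v|$ and not to $|z|$. *)
have e1 : `|T z - v *m A| <= eta * `|V|.
  pose k y := T y - y *m J.
  have : `|k z - k z0| <= eta * `|z - z0|.
    apply: (mean_value_Jm (a := 0) (r := r)) => // y /Hr[CTy _ Hy].
    have Cy := cinf_mulmx J (cinf_id y); split; first by apply: cinf_diff; exact: cinfB.
    move=> w; rewrite /k (JmB (cinf_diff CTy) (cinf_diff Cy)).
    by rewrite (Jm_mulmx _ (cinf_diff (cinf_id y))) Jm_id mul1mx.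
  by rewrite zV /k T0z !JE row_mxKr mul0mx subr0 subr0.
have e2 : `|V *m Jm T z - v *m A| <= eta * `|V|.
  by have := Hz V; rewrite mulmxBr [V *m J]JE row_mxKr.
rewrite derive_sqn // mulr_ge0 //.
apply: (inner_ge0 (c := v *m A) (t := eta * `|V|)).
- by rewrite mulr_ge0 // ltW.
- exact: e1.
- by rewrite (derive_Jm _ (cinf_diff CTz)).
- have := HC (v *m A); rewrite mulmxK // -ler_pdivrMl // => h.
  apply: le_trans h; rewrite /eta mulrA mulrCA mulfV ?mulr1; last by rewrite pnatr_eq0.
  by rewrite ler_wpM2l ?invr_ge0 ?(ltW C0) // norm_row0.
Unshelve. all: by end_near. Qed.

End RadialPositivity.

(** * The tube around $G_x$: retraction and source as coordinates *)

Section Tube.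
Context {R : realType} (G : lie_groupoid R) (x : obj G).
Context (D0 : set (obj G)) (phi0 : obj G -> 'rV[R]_(mdim (obj G))).
Context (Hphi0 : smooth_chart (Chart (mdim (obj G)) D0 phi0)).
Context (D0x : D0 x) (phi0x : phi0 x = 0).
Context (hfix : fixed_point x) (hproper : proper_at x).
Context (O : set (arr G)) (pi : arr G -> arr G).
Context (Hpi : retr x O pi) (FO : forall g, src g = x -> O g).
Context (pi1 : \forall y \near x, pi (gunit y) = gunit x).

Local Notation n := (mdim (obj G)).
Local Notation d := (mdim (arr G) - mdim (obj G))%N.
Local Notation adapted := (@adapted R G D0 phi0).
Local Notation nball := (nball D0 phi0).
Let fibreP := (adapted_fibre Hphi0 D0x phi0x).

(* An adapted chart in which [pi] is the projection onto the slice. *)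
Definition pichart D (m : arr G -> 'rV[R]_(d + n)) e p :=
  adapted D m e p /\
  forall g, D g -> D (pi g) /\ m (pi g) = row_mx (lsubmx (m g)) 0.

Lemma pi_id g : src g = x -> pi g = g.
Proof. by move=> gx; have [_ _ ->] := (proj2 Hpi) g (FO gx). Qed.

Lemma pi_cont g : O g -> {for g, continuous pi}.
Proof. by move=> Og; have [_ /smooth_at_cont ? _] := (proj2 Hpi) g Og. Qed.

(** [shear] applies with the fibre coordinates of [pi g], which agree with those of [g] on the fibre
    because [pi] fixes it. *)
Lemma pichart_exists p N : src p = x -> nbhs p N ->
  exists D m e, pichart D m e p /\ D `<=` N.
Proof.
move=> px Np; have [oO HO] := Hpi; have Op := FO px.
have [D1 [m1 [e1 [Had1 _]]]] := adapted_exists Hphi0 D0x phi0x px filterT.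
have [D1p m1p] := adapted_p Had1; have pp := pi_id px.
have D1pp : D1 (pi p) by rewrite pp.
pose xi g := lsubmx (m1 (pi g)).
have Cxi : smf xi p.
  have [_ sp _] := HO p Op.
  have C1 := smf_smooth_at sp (smf_chart (adapted_chart Had1) D1pp).
  apply: (smf_comp (F := fun v : 'rV[R]_(d + n) => lsubmx v) C1).
  by apply: cinf_lsubmx; exact: cinf_id.
have nO : nbhs p O by exact: open_nbhs_nbhs.
have nD1 : nbhs p D1 by apply: open_nbhs_nbhs; split=> //; exact: adapted_open Had1.
have nD1' : nbhs p (pi @^-1` D1).
  by apply: (pi_cont Op); rewrite pp.
have [|||D' [e' [Had' D'N]]] := shear Hphi0 D0x phi0x Had1 (N := N `&` (O `&` (D1 `&` pi @^-1` D1))) Cxi.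
- by rewrite /xi pp m1p linear0.
- by apply: filterS nO => g Og gx; rewrite /xi; have [_ _ ->] := HO g Og.
- by apply: filterI => //; apply: filterI => //; exact: filterI.
pose m g := row_mx (xi g) (phi0 (src g)).
exists D', m, e'; split; last by move=> g /D'N[].
split=> // g D'g; have [Ng [Og [D1g D1pg]]] := D'N g D'g.
have [spg _ _] := HO g Og.
have bv : ball (0 : 'rV[R]_(d + n)) e' (row_mx (lsubmx (m g)) (0 : 'rV[R]_n)).
  by apply: ball_row0; exact: adapted_ball Had' _ D'g.
(* [g'] is the point of the slice below [g] in the new chart. It equals [pi g] because both lie on
   the fibre with the same coordinates in the old chart. *)
have [D'g' mg'] := minvP Had' bv; set g' := minv _ _ _ _ in D'g' mg'.
have [_ [Og' [D1g' _]]] := D'N g' D'g'.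
have sg' : src g' = x by apply/(fibreP Had' D'g'); rewrite mg' row_mxKr.
suff E : g' = pi g by rewrite -E.
apply: (adapted_inj Had1) => //.
rewrite -[LHS]hsubmxK -[RHS]hsubmxK; congr row_mx; last first.
  by rewrite ((fibreP Had1 D1g').2 sg') ((fibreP Had1 D1pg).2 spg).
have := congr1 lsubmx mg'; rewrite !row_mxKl /xi.
by have [_ _ ->] := HO g' Og'.
Qed.

Lemma pichart_shrink D m e p e' : pichart D m e p -> 0 < e' -> e' <= e ->
  pichart (D `&` m @^-1` ball 0 e') m e' p.
Proof.
move=> [Had Hp] e'0 e'e; have [[e0 Hc Dp mp im] [sD ms]] := Had.
have Ic := smooth_chart_is Hc.
have oD' : open (D `&` m @^-1` ball (0 : 'rV[R]_(d + n)) e').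
  apply: open_setI_preimage; [exact: adapted_open Had|exact: ball_open|].
  exact: (adapted_cont Had).
split; first split.
- split=> //.
  + split; first split=> //=.
    * by move=> g g' /set_mem[Dg _] /set_mem[Dg' _]; exact: adapted_inj Had _ _ Dg Dg'.
    * by move=> g [Dg _]; exact: (adapted_cont Had).
    * by move=> U oU UD; apply: (chart_image_open Ic) => // g /UD[].
    move=> c' c'X g [Dg bg] c'g; have [[F [? ? ? ? EF]] [F' [? ? ? ? EF']]] := (proj2 Hc) c' c'X g Dg c'g.
    by split; [exists F|exists F'].
  + by split=> //=; rewrite mp; exact: ballxx.
  + apply/seteqP; split=> [_ [g [_ bg] <-]//|v bv].
    have bv' : ball (0 : 'rV[R]_(d + n)) e v.
      by move: bv; rewrite -ball_normE /= => /lt_le_trans; exact.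
    have [Dv mv] := minvP Had bv'.
    by exists (minv D m p v) => //; split=> //=; rewrite mv.
- by split=> g [Dg _]; [exact: sD|exact: ms].
- move=> g [Dg bg]; have [Dpg mpg] := Hp g Dg; split=> //; split=> //=.
  rewrite mpg; move: bg; rewrite /= -ball_normE /= !sub0r !normrN; apply: le_lt_trans.
  apply: rV_norm_le => // j; rewrite mxE; case: splitP => k _; last by rewrite mxE normr0.
  by rewrite mxE; exact: rV_norm_ge.
Qed.

Lemma pichart_src D m e p g : pichart D m e p -> D g -> src (pi g) = x.
Proof.
move=> [Had Hp] Dg; have [Dpg mpg] := Hp g Dg.
by apply/(fibreP Had Dpg); rewrite mpg row_mxKr.
Qed.

Definition picovered g := exists D m e p, [/\ src p = x, pichart D m e p & D g].

Lemma picovered_open : open picovered.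
Proof.
rewrite openE => g [D [m [e [p [px HD Dg]]]]].
apply: filterS (open_nbhs_nbhs (conj (adapted_open (proj1 HD)) Dg)) => g' Dg'.
by exists D, m, e, p.
Qed.

Lemma picovered_fibre g : src g = x -> picovered g.
Proof.
move=> gx; have [D [m [e [HD _]]]] := pichart_exists gx filterT.
by exists D, m, e, g; split=> //; have [] := adapted_p (proj1 HD).
Qed.

(* On a small enough neighbourhood the pair [(pi, src)] is injective. *)
Lemma tube_injective : exists2 e, 0 < e & forall g g',
  nball e (src g) -> nball e (tgt g) -> nball e (src g') -> nball e (tgt g') ->
  pi g = pi g' -> src g = src g' -> g = g'.
Proof.
apply: contrapT => H.
pose P k (w : arr G * arr G) := [/\ [/\ nball k.+1%:R^-1 (src w.1), nball k.+1%:R^-1 (tgt w.1),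
  nball k.+1%:R^-1 (src w.2) & nball k.+1%:R^-1 (tgt w.2)], pi w.1 = pi w.2, src w.1 = src w.2 & w.1 <> w.2].
have ex k : exists w, P k w.
  apply: contrapT => Hk; apply: H; exists k.+1%:R^-1; first by rewrite invr_gt0.
  by move=> g g' *; apply: contrapT => gg'; apply: Hk; exists (g, g').
have [w Hw] := choice ex.
have [|i [h [Hi wh hx]]] := @seq_extract R G x D0 phi0 Hphi0 D0x phi0x hproper (fun k => (w k).1).
  by move=> k; have [[]] := Hw k.
have nle k : forall y, nball (i k).+1%:R^-1 y -> nball k.+1%:R^-1 y.
  move=> y [D0y yk]; split=> //; apply: lt_le_trans yk _.
  by rewrite lef_pV2 ?posrE // ler_nat ltnS; exact: incr_ge.
have [|j [h' [Hj wh' hx']]] := @seq_extract R G x D0 phi0 Hphi0 D0x phi0x hproper (fun k => (w (i k)).2).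
  by move=> k; have [[_ _ a b] _ _ _] := Hw (i k); split; exact: nle.
have wh1 : (w (i (j k))).1 @[k --> \oo] --> h.
  apply: (cvg_comp j (fun k => (w (i k)).1) _ wh) => A [N _ NA].
  by exists N => // k /= Nk; apply: NA => /=; exact: leq_trans (incr_ge Hj k).
have p1 : pi (w (i (j k))).1 @[k --> \oo] --> pi h.
  by apply: (cvg_comp (fun k => (w (i (j k))).1) pi wh1); apply: pi_cont; exact: FO.
have p2 : pi (w (i (j k))).2 @[k --> \oo] --> pi h'.
  by apply: (cvg_comp (fun k => (w (i (j k))).2) pi wh'); apply: pi_cont; exact: FO.
have pE : (fun k => pi (w (i (j k))).1) = (fun k => pi (w (i (j k))).2).
  by apply/funext => k; have [] := Hw (i (j k)).
rewrite pE in p1.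
(* [pi] agrees on the two sequences and fixes both limits, so the limits coincide; around the common
   limit [pi] and the source are coordinates, which separates points. *)
have hh : h' = h by rewrite -(pi_id hx) -(pi_id hx'); exact: (cvg_unique (@mhausdorff R (arr G)) p2 p1).
rewrite hh in wh'.
have [D [m [e [HD _]]]] := pichart_exists hx filterT.
have [Had Hp] := HD; have [Dh _] := adapted_p Had.
have nD : nbhs h D by apply: open_nbhs_nbhs; split=> //; exact: adapted_open Had.
have [k [D1 D2]] : exists k, D (w (i (j k))).1 /\ D (w (i (j k))).2.
  have N1 := wh1 _ nD; have N2 := wh' _ nD.
  have [K _ HK] : \forall k \near \oo, D (w (i (j k))).1 /\ D (w (i (j k))).2.
    by near=> k; split; near: k.
  by exists K; apply: HK => /=.
have [_ pw sw nw] := Hw (i (j k)); apply: nw.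
apply: (adapted_inj Had) => //.
rewrite -[LHS]hsubmxK -[RHS]hsubmxK !(adapted_src Had) // sw; congr row_mx.
have [_ m1] := Hp _ D1; have [_ m2] := Hp _ D2.
by have := congr1 (fun g => lsubmx (m g)) pw; rewrite m1 m2 !row_mxKl.
Unshelve. all: by end_near. Qed.

Lemma nball_le e e' y : e <= e' -> nball e y -> nball e' y.
Proof. by move=> ee [D0y ye]; split=> //; exact: lt_le_trans ee. Qed.

Lemma tube_radius (e0 : R) : 0 < e0 -> exists e1, [/\ 0 < e1, e1 <= e0,
  forall g, nball e1 (src g) -> nball e1 (tgt g) -> picovered g,
  forall g g', nball e1 (src g) -> nball e1 (tgt g) -> nball e1 (src g') ->
    nball e1 (tgt g') -> pi g = pi g' -> src g = src g' -> g = g' &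
  forall y, nball e1 y -> pi (gunit y) = gunit x].
Proof.
move=> e00; have [a a0 Ha] := tube_injective.
have [b b0 Hb] := nball_basis Hphi0 D0x phi0x pi1.
have [c c0 Hc] := proper_near Hphi0 D0x phi0x hproper picovered_open picovered_fibre.
pose e1 := Num.min e0 (Num.min a (Num.min b c)).
have le0 : e1 <= e0 by rewrite ge_min lexx.
have lea : e1 <= a by rewrite !ge_min lexx orbT.
have leb : e1 <= b by rewrite !ge_min lexx !orbT.
have lec : e1 <= c by rewrite !ge_min lexx !orbT.
exists e1; split=> //.
- by rewrite !lt_min e00 a0 b0 c0.
- by move=> g s t; apply: Hc; exact: nball_le lec _.
- by move=> g g' s t s' t'; apply: Ha; exact: nball_le lea _.
- by move=> y /(nball_le leb)/Hb.
Qed.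

End Tube.

(** * The functions $Q_g$ and the invariant neighbourhood *)

Section Saturation.
Context {R : realType} (G : lie_groupoid R) (x : obj G).
Context (D0 : set (obj G)) (phi0 : obj G -> 'rV[R]_(mdim (obj G))).
Context (Hphi0 : smooth_chart (Chart (mdim (obj G)) D0 phi0)).
Context (D0x : D0 x) (phi0x : phi0 x = 0).
Context (hfix : fixed_point x) (hproper : proper_at x).
Context (O : set (arr G)) (pi : arr G -> arr G).
Context (Hpi : retr x O pi) (FO : forall g, src g = x -> O g).

Local Notation n := (mdim (obj G)).
Local Notation d := (mdim (arr G) - mdim (obj G))%N.
Local Notation adapted := (@adapted R G D0 phi0).
Local Notation pichart := (@pichart R G D0 phi0 pi).
Local Notation picovered := (@picovered R G x D0 phi0 pi).
Local Notation nball := (nball D0 phi0).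
Let fibreP := (adapted_fibre Hphi0 D0x phi0x).

Context (e0 : R) (im0 : phi0 @` D0 = ball 0 e0).
Context (e1 : R) (e1_gt0 : 0 < e1) (e1e0 : e1 <= e0).
Context (Hcov : forall g, nball e1 (src g) -> nball e1 (tgt g) -> picovered g).
Context (Hinj : forall g g', nball e1 (src g) -> nball e1 (tgt g) ->
  nball e1 (src g') -> nball e1 (tgt g') -> pi g = pi g' -> src g = src g' -> g = g').
Context (Hunit : forall y, nball e1 y -> pi (gunit y) = gunit x).

Lemma tgt_smooth (p : arr G) : smooth_at (tgt (l:=G)) p.
Proof. apply: submersion_smooth; exact: tgt_submersion. Qed.

Lemma tgt_cont (p : arr G) : {for p, continuous (tgt (l:=G))}.
Proof. exact: smooth_at_cont (tgt_smooth p). Qed.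

Lemma smf_minv {W : normedModType R} (f : arr G -> W) D m e p g :
  adapted D m e p -> D g -> smf f g ->
  cinf (fun z => f (minv D m p z)) (m g).
Proof.
move=> Had Dg Cf; have [F [CF EF]] := smfP Cf (adapted_chart Had) Dg.
apply: cinf_ext CF.
apply: (@near_coord R (arr G) (Chart (d + n) D m) g (fun v => F v = f (minv D m p v))) => //.
  exact: adapted_is Had.
have nD : \forall g' \near g, D g' by exact: (near_chart_dom (adapted_is Had) Dg).
by near=> g'; rewrite /= (minvK Had) ?(near EF) //; near: g'.
Unshelve. all: by end_near. Qed.

Definition tcoord D m p (z : 'rV[R]_(d + n)) := phi0 (tgt (minv D m p z)).

(** The bounds by [e1] keep both ends of every arrow of the chart in the region where [pi] and the
    source determine the arrow. *)
Definition strong D m e p :=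
  [/\ src p = x, pichart D m e p, e <= e1, forall g, D g -> nball e1 (tgt g) &
    forall z, ball 0 e z -> cinf (tcoord D m p) z /\
      0 <= 'D_(row_mx 0 (rsubmx z)) (fun y => sqn (tcoord D m p y)) z].

Lemma smf_phi0_tgt g : D0 (tgt g) -> smf (fun g : arr G => phi0 (tgt g)) g.
Proof.
by move=> Dp; exact: (smf_smooth_at (tgt_smooth g) (smf_chart Hphi0 Dp)).
Qed.

(** [radial_positive] applies to the target map: it vanishes on the slice because [x] is a fixed
    point, and its Jacobian is surjective because the target is a submersion. *)
Lemma strong_exists p : src p = x -> exists D m e, strong D m e p.
Proof.
move=> px; have tp := fixed_tgt hfix px.
have nt : nbhs p (tgt (l:=G) @^-1` nball e1).
  apply: tgt_cont; rewrite tp; apply: open_nbhs_nbhs; split; last exact: nball_x.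
  exact: nball_open Hphi0 _.
have [D [m [e [HD Dt]]]] := pichart_exists Hphi0 D0x phi0x Hpi FO px nt.
have [Had Hp] := HD; have [Dp mp] := adapted_p Had.
have eg0 : 0 < e by case: Had => -[].
have Ct z : ball 0 e z -> cinf (tcoord D m p) z.
  move=> bz; have [Dz mz] := minvP Had bz; rewrite -mz.
  by apply: (smf_minv (f := fun g => phi0 (tgt g)) Had Dz); apply: smf_phi0_tgt; have [] := Dt _ Dz.
have b0 : ball (0 : 'rV[R]_(d + n)) e 0 by exact: ballxx.
have [||r r0 Hr] := radial_positive (Ct 0 b0).
- have Lc : {for (0 : 'rV[R]_d), continuous (fun u : 'rV[R]_d => row_mx u (0 : 'rV[R]_n))}.
    by apply: cinf_cont; apply: cinf_row_mx; [exact: cinf_id|exact: cinf_cst].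
  have nb : \forall u \near (0 : 'rV[R]_d), ball (0 : 'rV[R]_(d + n)) e (row_mx u 0).
    have nb0 : nbhs (row_mx (0 : 'rV[R]_d) (0 : 'rV[R]_n)) (ball (0 : 'rV[R]_(d + n)) e).
      by rewrite row_mx0; exact: nbhsx_ballx.
    exact: (Lc _ nb0).
  apply: filterS nb => u bu; have [Du mu] := minvP Had bu.
  rewrite /tcoord (fixed_tgt hfix) //.
  by apply/(fibreP Had Du); rewrite mu row_mxKr.
- rewrite -mp; apply: (@submersion_surj R (arr G) (obj G) (tgt (l:=G)) (Chart (d + n) D m)
    (Chart n D0 phi0) p (tcoord D m p) (@tgt_submersion R G) (adapted_chart Had) Hphi0 Dp).
  + by rewrite tp.
  + by rewrite /= mp; exact: Ct.
  + have nD : \forall g' \near p, D g' by exact: (near_chart_dom (adapted_is Had) Dp).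
    by apply: filterS nD => g Dg; rewrite /= /tcoord (minvK Had).
pose e' := Num.min e (Num.min r e1).
have e'0 : 0 < e' by rewrite !lt_min eg0 r0 e1_gt0.
have e'e : e' <= e by rewrite ge_min lexx.
have e'r : e' <= r by rewrite !ge_min lexx orbT.
have e'e1 : e' <= e1 by rewrite !ge_min lexx !orbT.
have HD' := pichart_shrink HD e'0 e'e.
have bs s (z : 'rV[R]_(d + n)) : e' <= s -> ball 0 e' z -> ball 0 s z.
  by move=> es; rewrite -ball_normE /= => /lt_le_trans; exact.
have tE z : ball 0 e' z -> tcoord D m p z = tcoord (D `&` m @^-1` ball 0 e') m p z.
  move=> bz; rewrite /tcoord; congr (phi0 (tgt _)).
  have [Dz mz] := minvP Had (bs _ _ e'e bz).
  have [[Dz' _] mz'] := minvP (proj1 HD') bz.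
  by apply: (adapted_inj Had) => //; rewrite mz mz'.
have ntE z : ball 0 e' z -> \forall y \near z, tcoord D m p y = tcoord (D `&` m @^-1` ball 0 e') m p y.
  move=> bz; apply: filterS (open_nbhs_nbhs (conj (ball_open 0 e') bz)) => y.
  exact: tE.
exists (D `&` m @^-1` ball 0 e'), m, e'; split=> //; first by move=> g [/Dt].
move=> z bz; split; first exact: cinf_ext (ntE z bz) (Ct z (bs _ _ e'e bz)).
rewrite -(near_eq_derive (f := fun y => sqn (tcoord D m p y))).
  exact: Hr (bs _ _ e'r bz).
by apply: filterS (ntE z bz) => y ->.
Qed.

Lemma uniform_radius : exists rho, [/\ 0 < rho, rho <= e1 &
  forall g, src g = x -> exists D m e p, [/\ strong D m e p, D g & rho <= e]].
Proof.
have ex p : exists Dme : set (arr G) * (arr G -> 'rV[R]_(d + n)) * R,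
    src p = x -> strong Dme.1.1 Dme.1.2 Dme.2 p.
  have [px|px] := pselect (src p = x); last by exists (setT, (fun=> 0), 0).
  by have [D [m [e Hs]]] := strong_exists px; exists (D, m, e).
have [ch Hch] := choice ex.
have [|l lx lW] := @fibre_cover R G x D0 phi0 Hphi0 D0x phi0x hfix hproper (fun p => (ch p).1.1).
  move=> p /Hch[_ [Had _] _ _ _]; split; first exact: adapted_open Had.
  by have [] := adapted_p Had.
have [rho [r0 re1 Hr]] : exists rho, [/\ 0 < rho, rho <= e1 & forall p, p \in l -> rho <= (ch p).2].
  elim: l lx {lW} => [|p l IH] lx; first by exists e1.
  have [|rho [r0 re1 Hr]] := IH; first by move=> q ql; apply: lx; rewrite inE ql orbT.
  have ep : 0 < (ch p).2 by have [_ [[[]]]] := Hch p (lx p (mem_head _ _)).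
  exists (Num.min rho (ch p).2); split.
  - by rewrite lt_min r0.
  - by rewrite ge_min re1.
  - move=> q; rewrite inE => /orP[/eqP ->|/Hr]; first by rewrite ge_min lexx orbT.
    by move=> h; rewrite ge_min h.
exists rho; split=> // g gx; have [p pl Dg] := lW g gx.
exists (ch p).1.1, (ch p).1.2, (ch p).2, p; split=> //; first exact/Hch/lx.
exact: Hr.
Qed.

Context (rho : R) (rho0 : 0 < rho) (rhoe1 : rho <= e1).
Context (Hrho : forall g, src g = x -> exists D m e p, [/\ strong D m e p, D g & rho <= e]).

(* The arrow over [(g, v)] in the trivialisation [(pi, phi0 o src)] of the tube. *)
Definition lies_over g v := [set w : arr G |
  [/\ nball e1 (src w), nball e1 (tgt w), pi w = g & phi0 (src w) = v]].

(** Chosen without reference to a chart; uniqueness identifies it with the local formula of every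
    chart, which supplies its regularity. The default is harmless: for [g] in the fibre and [v]
    shorter than [rho] the arrow exists. *)
Definition Psi g v : arr G := xget (gunit x) (lies_over g v).

Lemma Psi_uniq g v w : lies_over g v w -> Psi g v = w.
Proof.
move=> Hw; have HP : lies_over g v (Psi g v).
  exact: (@xgetPex _ (gunit x) (lies_over g v) (ex_intro _ w Hw)).
move: HP Hw => [[D0s s1] t1 p1 v1] [[D0s' s2] t2 p2 v2].
apply: Hinj => //; first by rewrite p1 p2.
by apply: (chart_inj (phi0_is Hphi0)) => //=; rewrite v1 v2.
Qed.

Lemma lies_over_chart D m e p g v : pichart D m e p -> D g -> src g = x ->
  ball 0 e (row_mx (lsubmx (m g)) v) ->
  let w := minv D m p (row_mx (lsubmx (m g)) v) in
  nball e1 (src w) -> nball e1 (tgt w) -> lies_over g v w.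
Proof.
move=> [Had Hp] Dg gx bz w sw tw; have [Dw mw] := minvP Had bz.
have [Dpw mpw] := Hp _ Dw; split=> //; last by rewrite -(adapted_src Had Dw) mw row_mxKr.
apply: (adapted_inj Had) => //; rewrite mpw mw row_mxKl -[RHS]hsubmxK.
by rewrite ((fibreP Had Dg).2 gx).
Qed.

Lemma nball_chart D m e p g : adapted D m e p -> e <= e1 -> D g -> nball e1 (src g).
Proof.
move=> Had ee1 Dg; split; first exact: adapted_D0 Had _ Dg.
rewrite -(adapted_src Had Dg); have := adapted_ball Had Dg.
rewrite -ball_normE /= sub0r normrN => me; apply: lt_le_trans ee1; apply: le_lt_trans me.
by apply: rV_norm_le => // j; rewrite mxE; exact: rV_norm_ge.
Qed.

Lemma strong_ball D m e p g (v : 'rV[R]_n) : strong D m e p -> rho <= e -> D g ->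
  `|v| < rho -> ball 0 e (row_mx (lsubmx (m g)) v).
Proof.
move=> [_ [Had _] _ _ _] re Dg vr; rewrite -ball_normE /= sub0r normrN.
apply: norm_row_mx_lt; last exact: lt_le_trans re.
have := adapted_ball Had Dg; rewrite -ball_normE /= sub0r normrN; apply: le_lt_trans.
by apply: rV_norm_le => // j; rewrite mxE; exact: rV_norm_ge.
Qed.

Lemma strong_over D m e p g v : strong D m e p -> rho <= e -> D g -> src g = x ->
  `|v| < rho -> lies_over g v (minv D m p (row_mx (lsubmx (m g)) v)).
Proof.
move=> Hs re Dg gx vr; have bz := strong_ball Hs re Dg vr.
have [_ HD ee1 Dt _] := Hs; have [Had _] := HD; have [Dw _] := minvP Had bz.
by apply: (lies_over_chart HD Dg gx bz); [exact: nball_chart Had ee1 Dw|exact: Dt].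
Qed.

Lemma PsiP g v : src g = x -> `|v| < rho -> lies_over g v (Psi g v).
Proof.
move=> gx vr; have [D [m [e [p [Hs Dg re]]]]] := Hrho gx.
have H := strong_over Hs re Dg gx vr.
by rewrite (Psi_uniq H).
Qed.

Definition Qf g v := sqn (phi0 (tgt (Psi g v))).

Lemma Qf_chart D m e p g v : strong D m e p -> rho <= e -> D g -> src g = x ->
  `|v| < rho -> Qf g v = sqn (tcoord D m p (row_mx (lsubmx (m g)) v)).
Proof.
by move=> Hs re Dg gx vr; rewrite /Qf (Psi_uniq (strong_over Hs re Dg gx vr)).
Qed.

Let inb (v : 'rV[R]_n) : ball 0 rho v <-> `|v| < rho.
Proof. by rewrite -ball_normE /= sub0r normrN. Qed.

Lemma Qf_smooth g : src g = x -> forall v, ball 0 rho v ->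
  cinf (Qf g) v /\ 0 <= 'D_v (Qf g) v.
Proof.
move=> gx v bv; have [D [m [e [p [Hs Dg re]]]]] := Hrho gx.
pose u := lsubmx (m g); pose S y := sqn (tcoord D m p y).
pose L (v : 'rV[R]_n) : 'rV[R]_(d + n) := row_mx u v.
have CL : cinf L v by apply: cinf_row_mx; [exact: cinf_cst|exact: cinf_id].
have bz : ball 0 e (L v) by apply: (strong_ball Hs re Dg); exact/inb.
have [_ _ _ _ /(_ _ bz)[Ct Dt]] := Hs.
have CS : cinf S (L v) by exact: cinf_sqn.
have QE : \forall v' \near v, S (L v') = Qf g v'.
  apply: filterS (open_nbhs_nbhs (conj (ball_open 0 rho) bv)) => v' /inb v'r.
  by rewrite (Qf_chart Hs re Dg gx v'r).
split; first exact: cinf_ext QE (cinf_comp CL CS).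
rewrite -(near_eq_derive v QE).
(* [L] is affine with linear part [row_mx 0], so the two difference quotients coincide. *)
have -> : 'D_v (fun v' => S (L v')) v = 'D_(row_mx 0 v) S (L v).
  have E : (fun h : R => h^-1 *: (((fun v' => S (L v')) \o shift v) (h *: v) - S (L v))) =
      (fun h : R => h^-1 *: ((S \o shift (L v)) (h *: row_mx 0 v) - S (L v))).
    by apply/funext => h; rewrite /= /L scale_row_mx add_row_mx scaler0 add0r.
  by rewrite /derive E.
by move: Dt; rewrite row_mxKr.
Qed.

Lemma Qf0 g : src g = x -> Qf g 0 = 0.
Proof.
move=> gx; have tx := fixed_tgt hfix gx.
rewrite /Qf (@Psi_uniq g 0 g) ?tx ?phi0x ?sqn0 //.
split; rewrite ?gx ?tx ?phi0x //; try exact: nball_x.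
exact: (pi_id Hpi FO).
Qed.

Definition Us s := [set v : 'rV[R]_n | ball 0 rho v /\ forall g, src g = x -> Qf g v < s].

(** An infinite intersection of open conditions; compactness of the fibre, through [fibre_near],
    makes it open. *)
Lemma Us_open s : open (Us s).
Proof.
rewrite openE => v [bv Hv].
have : \forall v' \near v, forall g, src g = x -> `|v'| < rho -> Qf g v' < s.
  apply: (fibre_near Hphi0 D0x phi0x hfix hproper (F := nbhs v)
    (P := fun v' g => `|v'| < rho -> Qf g v' < s)) => p px.
  have [D [m [e [q [Hs Dp re]]]]] := Hrho px.
  pose S y := sqn (tcoord D m q y); pose z0 : 'rV[R]_(d + n) := row_mx (lsubmx (m p)) v.
  have [_ [Had _] _ _ Ht] := Hs.
  have bz : ball 0 e z0 by apply: (strong_ball Hs re Dp); exact/inb.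
  have Sc : {for z0, continuous S} by apply: cinf_cont; apply: cinf_sqn; have [] := Ht z0 bz.
  have Sz0 : S z0 < s by rewrite /S -(Qf_chart Hs re Dp px) //; [exact: Hv|exact/inb].
  have /nbhs_ballP[r /= r0 Hr] : nbhs z0 [set z | S z < s].
    by apply: (Sc [set t | t < s]); apply: open_nbhs_nbhs; split=> //; exact: open_lt.
  (* In the maximum norm the ball of radius [r] about [z0] is a product, so one radius serves for
     [g] near [p] and [v'] near [v]. *)
  exists (D `&` m @^-1` ball (m p) r); split.
  - apply: open_setI_preimage; [exact: adapted_open Had|exact: ball_open|].
    exact: adapted_cont Had.
  - by split=> //=; exact: ballxx.
  - have nb : \forall v' \near v, ball v r v' by exact: nbhsx_ballx.
    apply: filterS nb => v' bv' g [Dg bg] gx v'r.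
    rewrite (Qf_chart Hs re Dg gx v'r); apply: Hr.
    move: bg bv'; rewrite /= -!ball_normE /= => bg bv'.
    rewrite /z0 opp_row_mx add_row_mx; apply: norm_row_mx_lt => //.
    apply: le_lt_trans bg; apply: rV_norm_le => // j.
    rewrite -linearB mxE; exact: rV_norm_ge.
move=> H; have nb := open_nbhs_nbhs (conj (ball_open 0 rho) bv).
near=> v'; have bv' : ball 0 rho v' by near: v'.
split=> // g gx; have H' : forall g, src g = x -> `|v'| < rho -> Qf g v' < s by near: v'.
by apply: H' => //; exact/inb.
Unshelve. all: by end_near. Qed.

(** As $Q_{1_x}(v)=|v|^2$, the sublevel set of this level stays within radius [rho / 2], away from
    the boundary of the ball on which the $Q_g$ are controlled. *)
Definition rad := (rho / 2) ^+ 2.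

Lemma rad_gt0 : 0 < rad. Proof. by rewrite exprn_gt0 // divr_gt0. Qed.

Lemma rad_ball (v : 'rV[R]_n) : sqn v < rad -> `|v| < rho / 2.
Proof. by apply: sqn_lt_norm; rewrite divr_gt0. Qed.

Definition phi0inv : 'rV[R]_n -> obj G := @cinv R (obj G) x (Chart n D0 phi0).

Lemma phi0invP v : ball 0 e0 v -> D0 (phi0inv v) /\ phi0 (phi0inv v) = v.
Proof. by rewrite -im0 => Hv; exact: (@cinvP R (obj G) x (Chart n D0 phi0)). Qed.

(** The arrow over $(1_x,v)$ is the unit at the point with coordinate $v$; this is where [pi]
    mapping units to $1_x$ bounds the neighbourhood. *)
Lemma Qf_unit v : ball 0 rho v -> Qf (gunit x) v = sqn v.
Proof.
move=> /inb vr; have [|Dy yv] := @phi0invP v.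
  by rewrite -ball_normE /= sub0r normrN (lt_le_trans vr) // (le_trans rhoe1).
have ny : nball e1 (phi0inv v) by split=> //; rewrite yv (lt_le_trans vr).
rewrite /Qf (@Psi_uniq _ v (gunit (phi0inv v))) ?tgt_gunit ?yv //.
by split; rewrite ?src_gunit ?tgt_gunit //; exact: Hunit.
Qed.

Lemma Us_bound v : Us rad v -> `|v| <= rho / 2.
Proof.
move=> [bv /(_ (gunit x))]; rewrite src_gunit => /(_ erefl).
by rewrite Qf_unit // => /rad_ball/ltW.
Qed.

(** The condition $\sup_g Q_g(v)<$ [rad], expressed without forming the supremum. *)
Definition Vs := [set v | exists2 s, s < rad & Us s v].

(* If [w] is an arrow from [y], composing with [w] maps the arrows starting at [tgt w]
   to arrows starting at [y], so that the supremum defining [Us] does not increase. *)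
Lemma Vs_invariant w : nball e1 (src w) -> nball e1 (tgt w) ->
  Vs (phi0 (src w)) -> Vs (phi0 (tgt w)).
Proof.
move=> sw tw [s sr [bv HQ]]; exists s => //.
(* Every short arrow with the source of [w] is the arrow over its own retraction, so the bounds on
   the $Q_g$ bound its target. *)
have over w' : nball e1 (src w') -> nball e1 (tgt w') -> phi0 (src w') = phi0 (src w) ->
    sqn (phi0 (tgt w')) < s.
  move=> sw' tw' E.
  have [D [m [e [p [px HD Dw]]]]] := Hcov sw' tw'.
  have px' : src (pi w') = x by exact: (pichart_src Hphi0 D0x phi0x HD Dw).
  have : lies_over (pi w') (phi0 (src w)) w' by split.
  by move=> /Psi_uniq Pw; have := HQ _ px'; rewrite /Qf Pw.
(* Applying [over] to [w] itself puts its target within [rho], so that the arrows over it exist and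
   can be composed with [w]. *)
have zr : `|phi0 (tgt w)| < rho.
  have : sqn (phi0 (tgt w)) < rad by apply: lt_trans sr; exact: over.
  by move=> /rad_ball h; apply: lt_trans h _; have := rho0; lra.
split; first exact/inb.
move=> g gx; have [sP tP pP vP] := PsiP gx zr.
have sPE : src (Psi g (phi0 (tgt w))) = tgt w.
  by apply: (chart_inj (phi0_is Hphi0)) => //=; [case: sP|case: tw].
rewrite /Qf -(tgt_gmul sPE); apply: over; rewrite ?(src_gmul sPE) ?(tgt_gmul sPE) //.
Qed.

End Saturation.

Lemma set_type_continuous (S T : topologicalType) (A : set T) (f : S -> set_type A) p :
  {for p, continuous (fun q => set_val (f q))} -> {for p, continuous f}.
Proof.
move=> fc B; rewrite nbhsE => -[_ [[V oV <-] Vp] VB].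
have nV : nbhs (set_val (f p)) V by exact: open_nbhs_nbhs.
have H : nbhs p ((fun q => set_val (f q)) @^-1` V) by exact: fc nV.
by apply: (filterS _ H) => q Vq; exact: (VB (f q) Vq).
Qed.

(** * The trivialisation of $G_U$ *)

Section Trivialisation.
Context {R : realType} (G : lie_groupoid R) (x : obj G).
Context (D0 : set (obj G)) (phi0 : obj G -> 'rV[R]_(mdim (obj G))).
Context (Hphi0 : smooth_chart (Chart (mdim (obj G)) D0 phi0)).
Context (D0x : D0 x) (phi0x : phi0 x = 0).
Context (hfix : fixed_point x).
Context (O : set (arr G)) (pi : arr G -> arr G).
Context (Hpi : retr x O pi) (FO : forall g, src g = x -> O g).

Local Notation n := (mdim (obj G)).
Local Notation d := (mdim (arr G) - mdim (obj G))%N.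
Local Notation adapted := (@adapted R G D0 phi0).
Local Notation pichart := (@pichart R G D0 phi0 pi).
Local Notation picovered := (@picovered R G x D0 phi0 pi).
Local Notation nball := (nball D0 phi0).
Let fibreP := (adapted_fibre Hphi0 D0x phi0x).

Context (e0 : R) (im0 : phi0 @` D0 = ball 0 e0).
Context (e1 : R) (e1e0 : e1 <= e0).
Context (Hcov : forall g, nball e1 (src g) -> nball e1 (tgt g) -> picovered g).
Context (Hinj : forall g g', nball e1 (src g) -> nball e1 (tgt g) ->
  nball e1 (src g') -> nball e1 (tgt g') -> pi g = pi g' -> src g = src g' -> g = g').
Context (Hunit : forall y, nball e1 y -> pi (gunit y) = gunit x).
Context (rho : R) (rho0 : 0 < rho) (rhoe1 : rho <= e1).
Context (Hrho : forall g, src g = x ->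
  exists D m e p, [/\ strong x D0 phi0 pi e1 D m e p, D g & rho <= e]).

Local Notation Vs := (@Vs R G x D0 phi0 pi e1 rho).
Local Notation Psi := (@Psi R G x D0 phi0 pi e1).
Local Notation lies_over := (@lies_over R G D0 phi0 pi e1).
Local Notation phi0inv := (@phi0inv R G x D0 phi0).

Context (psi psi' : 'rV[R]_n -> 'rV[R]_n).
Context (psi0 : psi 0 = 0) (Cpsi : forall v, Vs v -> cinf psi v).
Context (Cpsi' : forall z, cinf psi' z) (Vpsi' : forall z, Vs (psi' z)).
Context (psiK : forall v, Vs v -> psi' (psi v) = v) (psi'K : forall z, psi (psi' z) = z).

Definition invU := [set y | D0 y /\ Vs (phi0 y)].

Definition base_map (y : obj G) : euclidean R n := psi (phi0 y).

(** The unit is a default for arrows that [pi] does not send into $G_x$; on the tube it does not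
    occur. *)
Definition to_isotropy (g : arr G) : isotropy x := insubd (isotropy1 x) (pi g).

Definition tube_map (g : arr G) : prod_space (isotropy x) (euclidean R n) :=
  (to_isotropy g, base_map (src g)).

Lemma Vs_norm v : Vs v -> `|v| < rho.
Proof. by move=> [s _ [+ _]]; rewrite -ball_normE /= sub0r normrN. Qed.

Lemma Vs_ball0 v : Vs v -> ball 0 e0 v.
Proof.
move=> /Vs_norm vr; rewrite -ball_normE /= sub0r normrN (lt_le_trans vr) //.
exact: le_trans e1e0.
Qed.

Lemma invU_nball y : invU y -> nball e1 y.
Proof. by move=> [D0y /Vs_norm vr]; split=> //; exact: lt_le_trans rhoe1. Qed.

Lemma isotropyP g : isotropy_set x g <-> src g = x.
Proof.
split=> [[]//|gx]; split; first exact: gx.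
exact: (fixed_tgt hfix gx).
Qed.

Lemma isotropy_src (a : isotropy x) : src (set_val a) = x.
Proof. by apply/isotropyP; exact: set_valP. Qed.

Lemma to_isotropyE g : src (pi g) = x -> set_val (to_isotropy g) = pi g.
Proof.
move=> gx; rewrite /to_isotropy; apply: (insubdK (isotropy1 x)).
by rewrite inE; apply/isotropyP.
Qed.

Lemma to_isotropy_val g (a : isotropy x) : pi g = set_val a -> to_isotropy g = a.
Proof. by move=> E; rewrite /to_isotropy E; exact: valKd. Qed.

Lemma cover_invU g : restriction invU g -> picovered g.
Proof. by move=> [sg tg]; apply: Hcov; exact: invU_nball. Qed.

Lemma invU_tgt g : nball e1 (src g) -> nball e1 (tgt g) -> invU (src g) -> invU (tgt g).
Proof.
move=> sg tg [D0s Vsg]; split; first by case: tg.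
exact: (Vs_invariant Hphi0 D0x phi0x Hcov Hinj rho0 Hrho sg tg Vsg).
Qed.

Lemma restriction_over g : restriction invU g -> lies_over (pi g) (phi0 (src g)) g.
Proof. by move=> [/invU_nball sg /invU_nball tg]. Qed.

(** Surjectivity onto $G_x\times U$ rests here: the arrow over $(h,v)$ starts in $U$, and invariance
    makes it end in $U$. *)
Lemma Psi_restriction h v : src h = x -> Vs v ->
  lies_over h v (Psi h v) /\ restriction invU (Psi h v).
Proof.
move=> hx Vv; have H := PsiP Hphi0 D0x phi0x Hinj Hrho hx (Vs_norm Vv).
split=> //; have [s1 t1 _ vE] := H.
have Us : invU (src (Psi h v)) by split; [case: s1|rewrite vE].
by split=> //; exact: invU_tgt.
Qed.

Lemma base_smf y : invU y -> smf base_map y.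
Proof. by move=> [D0y Vy]; exact: (smf_comp (smf_chart Hphi0 D0y) (Cpsi Vy)). Qed.

Lemma base_diffeo : diffeo_from invU base_map.
Proof.
split=> [y Uy|].
  have [a aM ay] := matlas_cover y.
  have [F [CF EF]] := smfP (base_smf Uy) (matlas_chart aM) ay.
  exists a, (Chart n setT id), F; split=> //; split=> //.
  - exact: smf_cont (base_smf Uy).
  - exact/smooth_nearE.
have Ic := phi0_is Hphi0.
have inv z : D0 (phi0inv (psi' z)) /\ phi0 (phi0inv (psi' z)) = psi' z.
  by apply: phi0invP im0 _ _; exact: Vs_ball0.
exists (fun z => phi0inv (psi' z)); split.
- move=> z; have [D0z zv] := inv z.
  have [a aM ay] := matlas_cover (phi0inv (psi' z)).
  have [T [CT ET]] := transition Hphi0 (matlas_chart aM) D0z ay.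
  rewrite /= zv in CT.
  have ic : {for psi' z, continuous phi0inv}.
    by apply: (@cinv_cont R (obj G) x (Chart n D0 phi0) Ic); exists (phi0inv (psi' z)).
  have gc : {for z, continuous (phi0inv \o psi')}.
    by apply: continuous_comp => //; exact: cinf_cont.
  exists (Chart n setT id), a, (T \o psi'); split=> //; split=> //.
  - by apply/smooth_nearE/cinf_comp.
  - have ET' : \forall q \near z, a (phi0inv (psi' q)) = T (phi0 (phi0inv (psi' q))).
      exact: gc _ ET.
    by apply: filterS ET' => q -> /=; have [_ ->] := inv q.
- by move=> z; have [D0z zv] := inv z; split=> //; rewrite zv.
- move=> y [D0y Vy]; rewrite /base_map psiK //.
  exact: (cinvK x Ic).
- by move=> z; rewrite /base_map; have [_ ->] := inv z.
Qed.

(** The source fibre is the whole isotropy group because [x] is fixed, so adapted charts are slice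
    charts for it. *)
Lemma slice_chart D m e p : pichart D m e p ->
  atlas (isotropy x) (Chart d (set_val @^-1` D) (fun a => lsubmx (m (set_val a)))).
Proof.
move=> [Had Hp]; exists d, n, D, m; split=> //; first exact: adapted_chart Had.
apply/seteqP; split=> [_ [g [Dg /isotropyP gx] <-]|_ [[g Dg <-] /= r0]].
  by split; [exists g|exact/(fibreP Had Dg)].
by exists g => //; split=> //; apply/isotropyP/(fibreP Had Dg).
Qed.

Lemma tube_chart D m e p : pichart D m e p ->
  atlas (prod_space (isotropy x) (euclidean R n))
    (Chart (d + n) ((set_val @^-1` D) `*` setT) (fun q => row_mx (lsubmx (m (set_val q.1))) q.2)).
Proof.
move=> HD; exists (Chart d (set_val @^-1` D) (fun a => lsubmx (m (set_val a)))), (Chart n setT id).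
by split=> //; exact: slice_chart HD.
Qed.

(** In a chart where [pi] is the projection to the slice, the map reads
    $(u,v)\mapsto(u,\psi(v))$. *)
Lemma tube_map_smooth w : restriction invU w -> smooth_at tube_map w.
Proof.
move=> Uw; have [D [m [e [p [px HD Dw]]]]] := cover_invU Uw.
have [Had Hp] := HD; have [Us _] := Uw; have [D0s Vw] := Us.
have nD : \forall g \near w, D g by exact: (near_chart_dom (adapted_is Had) Dw).
have pD g : D g -> src (pi g) = x by move=> Dg; exact: (pichart_src Hphi0 D0x phi0x HD Dg).
have [c cX cw] := matlas_cover w.
pose Th g : 'rV[R]_(d + n) := row_mx (lsubmx (m g)) (psi (rsubmx (m g))).
have CTh : smf Th w.
  apply: (smf_comp (F := fun v : 'rV[R]_(d + n) => row_mx (lsubmx v) (psi (rsubmx v)) : 'rV[R]_(d + n))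
    (smf_chart (adapted_chart Had) Dw)).
  have Cr : cinf (fun v : 'rV[R]_(d + n) => rsubmx v) (m w).
    by apply: cinf_rsubmx; exact: cinf_id.
  apply: cinf_row_mx; first by apply: cinf_lsubmx; exact: cinf_id.
  by apply: (cinf_comp Cr); rewrite (adapted_src Had Dw); exact: Cpsi.
have [F [CF EF]] := smfP CTh (matlas_chart cX) cw.
exists c, (Chart (d + n) ((set_val @^-1` D) `*` setT) (fun q => row_mx (lsubmx (m (set_val q.1))) q.2)), F.
split=> //; first exact: tube_chart HD.
have valE g : D g -> set_val (to_isotropy g) = pi g by move=> /pD; exact: to_isotropyE.
split=> //.
- by split=> //=; rewrite valE //; have [] := Hp w Dw.
- have c1 : {for w, continuous to_isotropy}.
    apply: set_type_continuous.
    apply: (@near_eq_for_continuous _ _ pi).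
      by apply: filterS nD => g Dg; rewrite valE.
    have smfl : smf (fun g => row_mx (lsubmx (m g)) 0 : 'rV[R]_(d + n)) w.
      apply: (smf_comp (F := fun v : 'rV[R]_(d + n) => row_mx (lsubmx v) 0 : 'rV[R]_(d + n))
        (smf_chart (adapted_chart Had) Dw)).
      by apply: cinf_row_mx; [apply: cinf_lsubmx; exact: cinf_id|exact: cinf_cst].
    have spi : smooth_at pi w.
      apply: (smooth_at_chart (adapted_chart Had)).
        by apply: filterS nD => g Dg; have [] := Hp g Dg.
      by apply: smf_ext smfl; apply: filterS nD => g Dg /=; have [_ ->] := Hp g Dg.
    exact: smooth_at_cont spi.
  have c2 : {for w, continuous (base_map \o src (l:=G))}.
    apply: continuous_comp; first exact: src_cont.
    exact: smf_cont (base_smf Us).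
  exact: (cvg_pair c1 c2).
- exact/smooth_nearE.
- near=> g.
  have Dg : D g by near: g.
  rewrite -(near EF) //= /Th valE // /base_map; have [_ ->] := Hp g Dg.
  by rewrite row_mxKl (adapted_src Had Dg).
Unshelve. all: by end_near. Qed.

Definition tube_inv (q : prod_space (isotropy x) (euclidean R n)) : arr G :=
  Psi (set_val q.1) (psi' q.2).

(** The chart is taken around the value $w$ of the inverse; it also contains the retraction of $w$,
    so it induces a chart of the product near $q$, and the inverse reads
    $(u,z)\mapsto(u,\psi'(z))$. *)
Lemma tube_inv_smooth : smooth tube_inv.
Proof.
move=> q; have hx := isotropy_src q.1; set h := set_val q.1 in hx.
have [Lw Uw] := Psi_restriction hx (Vpsi' q.2).
set v := psi' q.2 in Lw Uw; have qw : tube_inv q = Psi h v by [].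
set w := Psi h v in Lw Uw qw.
have [sw tw pw vw] := Lw.
have [D [m [e [p [px HD Dw]]]]] := cover_invU Uw.
have [Had Hp] := HD; have [Dh mh] := Hp w Dw; rewrite pw in Dh mh.
pose ze (q : prod_space (isotropy x) (euclidean R n)) : 'rV[R]_(d + n) :=
  row_mx (lsubmx (m (set_val q.1))) (psi' q.2).
have zq : ze q = m w.
  by rewrite /ze -/h mh row_mxKl -/v -vw -(adapted_src Had Dw) hsubmxK.
have valc : continuous (fun q : prod_space (isotropy x) (euclidean R n) => set_val q.1 : arr G).
  move=> q'; apply: continuous_comp; first exact: cvg_fst.
  exact: initial_continuous.
have sndc : continuous (fun q : prod_space (isotropy x) (euclidean R n) => q.2 : 'rV[R]_n).
  by move=> q'; exact: cvg_snd.
have ND : \forall q' \near q, D (set_val q'.1).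
  by apply: (valc q); exact: (near_chart_dom (adapted_is Had) Dh).
have lc (u : 'rV[R]_(d + n)) : {for u, continuous (fun u : 'rV[R]_(d + n) => row_mx (lsubmx u) 0 : 'rV[R]_(d + n))}.
  by apply: cinf_cont; apply: cinf_row_mx; [apply: cinf_lsubmx; exact: cinf_id|exact: cinf_cst].
have rc (u : 'rV[R]_n) : {for u, continuous (fun u : 'rV[R]_n => row_mx 0 (psi' u) : 'rV[R]_(d + n))}.
  by apply: cinf_cont; apply: cinf_row_mx; [exact: cinf_cst|exact: Cpsi'].
have zec : {for q, continuous ze}.
  have c1 : {for q, continuous (fun q' : prod_space (isotropy x) (euclidean R n) =>
      row_mx (lsubmx (m (set_val q'.1))) 0 : 'rV[R]_(d + n))}.
    apply: (@continuous_comp _ _ _ (fun q' : prod_space (isotropy x) (euclidean R n) => m (set_val q'.1))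
      (fun u : 'rV[R]_(d + n) => row_mx (lsubmx u) 0 : 'rV[R]_(d + n))); last exact: lc.
    apply: (@continuous_comp _ _ _ (fun q' : prod_space (isotropy x) (euclidean R n) => set_val q'.1 : arr G) m).
      exact: valc.
    exact: (adapted_cont Had).
  have c2 : {for q, continuous (fun q' : prod_space (isotropy x) (euclidean R n) =>
      row_mx 0 (psi' q'.2) : 'rV[R]_(d + n))}.
    apply: (@continuous_comp _ _ _ (fun q' : prod_space (isotropy x) (euclidean R n) => q'.2 : 'rV[R]_n)
      (fun u : 'rV[R]_n => row_mx 0 (psi' u) : 'rV[R]_(d + n))); first exact: sndc.
    exact: rc.
  have -> : ze = (fun q' => row_mx (lsubmx (m (set_val q'.1))) 0 + row_mx 0 (psi' q'.2)).
    by apply/funext => q'; rewrite /ze add_row_mx addr0 add0r.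
  exact: (continuousD c1 c2).
have bw : ball 0 e (m w) by exact: adapted_ball Had _ Dw.
have mc : {for ze q, continuous (minv D m p)} by rewrite zq; exact: (minv_cont Had).
have mzc : {for q, continuous (minv D m p \o ze)} by exact: continuous_comp.
have mzq : minv D m p (ze q) = w by rewrite zq (minvK Had).
have Nb : \forall q' \near q, ball 0 e (ze q').
  by apply: (zec (ball (0 : 'rV[R]_(d + n)) e)); rewrite zq; apply: open_nbhs_nbhs; split=> //; exact: ball_open.
have oN : open (nball e1) by exact: nball_open Hphi0 _.
have Ns : \forall q' \near q, nball e1 (src (minv D m p (ze q'))).
  apply: (mzc (src (l:=G) @^-1` nball e1)); rewrite /= mzq.
  by apply: src_cont; exact: open_nbhs_nbhs.
have Nt : \forall q' \near q, nball e1 (tgt (minv D m p (ze q'))).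
  apply: (mzc (tgt (l:=G) @^-1` nball e1)); rewrite /= mzq.
  by apply: tgt_cont; exact: open_nbhs_nbhs.
(* The arrow chosen by [Psi] acquires a smooth formula: near [q] the chart point has short source
   and target, hence is the unique arrow over [q']. *)
have NE : \forall q' \near q, minv D m p (ze q') = tube_inv q'.
  near=> q'; rewrite /tube_inv; symmetry; apply: (Psi_uniq x Hphi0 Hinj).
  by apply: (lies_over_chart Hphi0 D0x phi0x HD); rewrite ?isotropy_src //; near: q'.
have tic : {for q, continuous tube_inv} by exact: near_eq_for_continuous NE mzc.
have [c cX cw] := matlas_cover w.
have [T [CT ET]] := transition (adapted_chart Had) (matlas_chart cX) Dw cw.
rewrite /= in CT ET.
pose F (r : 'rV[R]_(d + n)) := T (row_mx (lsubmx r) (psi' (rsubmx r))).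
exists (Chart (d + n) ((set_val @^-1` D) `*` setT) (fun q => row_mx (lsubmx (m (set_val q.1))) q.2)), c, F.
split=> //; first exact: tube_chart HD.
split=> //.
- apply/smooth_nearE.
  pose K (r : 'rV[R]_(d + n)) : 'rV[R]_(d + n) := row_mx (lsubmx r) (psi' (rsubmx r)).
  have CK r : cinf K r.
    have Cr : cinf (fun v : 'rV[R]_(d + n) => rsubmx v) r by apply: cinf_rsubmx; exact: cinf_id.
    apply: cinf_row_mx; first by apply: cinf_lsubmx; exact: cinf_id.
    by apply: (cinf_comp Cr); exact: Cpsi'.
  apply: (cinf_comp (CK _)); rewrite /K /= row_mxKl row_mxKr.
  by rewrite -[row_mx _ _]/(ze q) zq.
- have ET' : \forall q' \near q, c (tube_inv q') = T (m (tube_inv q')).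
    by apply: (tic (fun g => c g = T (m g))); rewrite qw.
  near=> q'; rewrite (near ET') // /F /= row_mxKl row_mxKr -(near NE) //.
  have bq : ball 0 e (ze q') by near: q'.
  by have [_ ->] := minvP Had bq.
Unshelve. all: by end_near. Qed.

Lemma tube_diffeo : diffeo_from (restriction invU) tube_map.
Proof.
split; first exact: tube_map_smooth.
exists tube_inv; split; first exact: tube_inv_smooth.
- by move=> q; have [] := Psi_restriction (isotropy_src q.1) (Vpsi' q.2).
- move=> g Ug; have [D [m [e [p [px HD Dg]]]]] := cover_invU Ug.
  rewrite /tube_inv /= to_isotropyE; last exact: (pichart_src Hphi0 D0x phi0x HD Dg).
  rewrite /base_map psiK; last by case: Ug => -[].
  exact: (Psi_uniq x Hphi0 Hinj (restriction_over Ug)).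
- move=> [a z]; have [[_ _ pE vE] _] := Psi_restriction (isotropy_src a) (Vpsi' z).
  rewrite /tube_map /tube_inv /=; congr pair; first exact: to_isotropy_val.
  by rewrite /base_map vE psi'K.
Qed.

Lemma tube_map_isotropy (g : isotropy x) : tube_map (set_val g) = (g, 0).
Proof.
have gx := isotropy_src g; rewrite /tube_map gx /base_map phi0x psi0; congr pair.
by apply: to_isotropy_val; exact: (pi_id Hpi FO).
Qed.

Lemma tube_map_unit y : invU y -> tube_map (gunit y) = (isotropy1 x, base_map y).
Proof.
move=> Uy; rewrite /tube_map src_gunit; congr pair; apply: to_isotropy_val.
by rewrite (Hunit (invU_nball Uy)).
Qed.

End Trivialisation.

Theorem proposition5p4p3 (R : realType) (G : lie_groupoid R) (x : obj G)
    (hfix : fixed_point x) (hproper : proper_at x) :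
  exists (U : set (obj G))
         (Phi : arr G -> prod_space (isotropy x) (euclidean R (mdim (obj G))))
         (phi : obj G -> euclidean R (mdim (obj G))),
    [/\ open U, U x, diffeo_from (restriction U) Phi & diffeo_from U phi] /\
    [/\ forall g : isotropy x, Phi (set_val g) = (g, 0),
        forall g, restriction U g -> (Phi g).2 = phi (src g) &
        forall y, U y -> Phi (gunit y) = (isotropy1 x, phi y)].
Proof.
have [D0 [phi0 [e0 [e00 Hphi0 D0x phi0x im0]]]] := chart_at x.
have [ O [pi [Hpi FO pi1]]] := retraction_exists Hphi0 D0x phi0x hfix hproper.
have [e1 [e10 e1e0 Hcov Hinj Hunit]] :=
  tube_radius Hphi0 D0x phi0x hproper Hpi FO pi1 e00.
have [rho [rho0 rhoe1 Hrho]] :=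
  uniform_radius Hphi0 D0x phi0x hfix hproper Hpi FO e10.
have oU s : open (Us x D0 phi0 pi e1 rho s) by exact: (Us_open Hphi0 D0x phi0x hfix hproper Hinj Hrho).
(* The gap between [rho / 2], which bounds the sublevel sets, and [rho], up to which the $Q_g$ are
   smooth, provides the compact sets behind the exhaustion. *)
have r2 : rho / 2 < rho by lra.
have [psi [psi' [[psi0 Cpsi Cpsi'] [Vpsi' psiK psi'K]]]] :=
  @star_diffeo R (mdim (obj G)) (arr G) (src (l:=G) @^-1` [set x])
    (Qf x D0 phi0 pi e1) rho (rho / 2) (rad rho) rho0 (rad_gt0 rho0) r2
    (fun g gx => Qf_smooth Hphi0 D0x phi0x Hinj Hrho gx)
    (fun g gx => Qf0 Hphi0 D0x phi0x hfix Hpi FO e10 Hinj gx)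
    (fun s _ => oU s)
    (fun v Uv => Us_bound Hphi0 im0 e1e0 Hinj Hunit rho0 rhoe1 Uv).
pose U := invU x D0 phi0 pi e1 rho.
have oV : open (Vs x D0 phi0 pi e1 rho).
  rewrite (_ : Vs _ _ _ _ _ _ = \bigcup_(s in [set s | s < rad rho]) Us x D0 phi0 pi e1 rho s).
    apply: bigcup_open => s _; exact: oU.
  by apply/seteqP; split => v [s sr Us]; exists s.
exists U, (tube_map x phi0 pi psi), (base_map phi0 psi); split; split=> //.
- rewrite (_ : U = D0 `&` phi0 @^-1` Vs x D0 phi0 pi e1 rho) //.
  apply: open_setI_preimage; [exact: chart_open (phi0_is Hphi0)|exact: oV|].
  exact: (chart_cont (phi0_is Hphi0)).
- split=> //; rewrite phi0x; exists (rad rho / 2); first by have := rad_gt0 rho0; lra.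
  split=> [|g gx]; first exact: ballxx.
  rewrite (Qf0 Hphi0 D0x phi0x hfix Hpi FO e10 Hinj gx).
  by have := rad_gt0 rho0; lra.
- exact: tube_diffeo.
- exact: (@base_diffeo R G x D0 phi0 Hphi0 pi e0 im0 e1 e1e0 rho rhoe1 psi psi' Cpsi Cpsi' Vpsi' psiK psi'K).
- exact: (tube_map_isotropy phi0x hfix Hpi FO psi0).
- exact: (tube_map_unit Hunit rhoe1).
Qed.
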